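(* Fix integers $q\ge 1$, $k\ge 1$, a constant $\chi$ and a constant $T>0$. Then there is a constant $C$ depending only on $q,k,\chi,T$ (and not on $n,\alpha,d,t$ or on the particular operators $A,B$) such that the following holds. Let $\Lambda$ be a one-dimensional regular lattice of $n$ qubits, let $A$ be a geometrically local Hamiltonian on $\Lambda$ with interaction range $\chi$, and let $B=\sum_{X\subset\Lambda}B_X$ be a $k$-local Hamiltonian, where $B_X$ is supported on a subset $X$ of at most $k$ qubits. Let $d=\max_{i\in\Lambda}\sum_{X: i\in X}\|B_X\|$ be its effective interaction degree. Let $0<\alpha<1$, $0\le t\le T$, let $B_I(\tau)=-i\alpha e^{iA\tau}Be^{-iA\tau}$, let $e^{\Omega(t)}=\mathcal T\big[e^{\int_0^t B_I(\tau)\,d\tau}\big]$ denote the time-ordered exponential, and let $\overline\Omega(t)=\sum_{j=1}^q\Omega_j(t)$ be the Magnus expansion truncated at order $q$. Then $$\big\|e^{\Omega(t)}-e^{\overline\Omega(t)}\big\|\le C\,n\,(\alpha d t)^{q+1}.$$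
   Context: $\|\cdot\|$ is the spectral (operator) norm. A Hamiltonian $A$ on a one-dimensional regular lattice $\Lambda$ of $n$ qubits is geometrically local with interaction range $\chi$ if $A=\sum_{i=1}^n A_i$ where each $A_i$ is supported on a neighborhood of diameter $\chi$ containing $i$ and $\|A_i\|\le 1$; $\chi$ is a constant independent of $n$. The $B_X$ are indexed by nonempty subsets $X\subset\Lambda$. The time-ordered exponential $\mathcal T[e^{\int_0^t B_I(\tau)d\tau}]$ is the solution $Y(t)$ of $Y'(t)=B_I(t)Y(t)$, $Y(0)=I$. The symbol $e^{\Omega(t)}$ is used for this unitary. The Magnus operators $\Omega_j(t)$ for $B_I$ are defined by $\Omega_j(0)=0$, $\Omega_1'(t)=B_I(t)$ and, for $j\ge 2$, $$\Omega_j'=\sum_{m=1}^{j-1}\frac{b_m}{m!}\sum_{i_1+\dots+i_m=j-1,\ i_l\ge 1}[\Omega_{i_1},[\Omega_{i_2},\dots[\Omega_{i_m},B_I]\dots]],$$ with $b_m$ the Bernoulli numbers ($b_1=-1/2$). *)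

(* Defs.v *)
From HB Require Import structures.
From mathcomp Require Import all_boot all_order all_algebra.
From mathcomp Require Import complex.
From mathcomp Require Import all_classical all_reals all_analysis.
Set Implicit Arguments.
Unset Strict Implicit.
Unset Printing Implicit Defensive.
Import Order.TTheory GRing.Theory Num.Theory.
Import numFieldNormedType.Exports.
Local Open Scope ring_scope.
Local Open Scope classical_set_scope.

(* [complex] carries no topology of its own.  Packed as a [numClosedFieldType],
   it inherits the normed topology of numeric fields, and so do the matrices
   over it. *)
Definition Cx (R : realType) : numClosedFieldType := complex R.

Definition real_Cx {R : realType} (x : R) : Cx R := real_complex R x.

Section Matrices.
Variables (R : realType) (N : nat).
Implicit Types (M : 'M[Cx R]_N) (F : R -> 'M[Cx R]_N).

Definition l2norm (v : 'cV[Cx R]_N) : R :=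
  Num.sqrt (\sum_i (complex.Re (v i 0) ^+ 2 + complex.Im (v i 0) ^+ 2)).

Definition spectral_norm M : R :=
  sup [set l2norm (M *m v) | v in [set v | l2norm v <= 1]].

Definition mexp M : 'M[Cx R]_N :=
  limn (series (fun k : nat => (k`!%:R)^-1 *: M ^+ k)).

Definition mcomm M1 M2 : 'M[Cx R]_N := M1 *m M2 - M2 *m M1.

(* [Ms_1, [Ms_2, ... [Ms_m, M] ... ]] *)
Definition nested_comm (Ms : seq 'M[Cx R]_N) M : 'M[Cx R]_N := foldr mcomm M Ms.

(* [F'] is the derivative of [F] at every real time.  The library's
   [is_derive] does not apply: complex matrices are not a normed module
   over [R] there. *)
Definition has_derivative F F' : Prop :=
  forall t : R, (fun h : R => real_Cx h^-1 *: (F (t + h) - F t)) @ 0^' --> F' t.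

Definition is_time_ordered_exp (G Y : R -> 'M[Cx R]_N) : Prop :=
  Y 0 = 1%:M /\ has_derivative Y (fun t => G t *m Y t).

End Matrices.

(* b_0, ..., b_{n-1}, from \sum_(k <= m) 'C(m+1, k) b_k = [m = 0];
   hence b_1 = -1/2. *)
Fixpoint bernoulli_seq (n : nat) : seq rat :=
  if n is m.+1 then
    let s := bernoulli_seq m in
    rcons s (((m == 0%N)%:R - \sum_(k < m) 'C(m.+1, k)%:R * s`_k) / m.+1%:R)
  else [::].

Definition bernoulli_number (m : nat) : rat := (bernoulli_seq m.+1)`_m.

Lemma size_bernoulli_seq n : size (bernoulli_seq n) = n.
Proof. by elim: n => //= n IHn; rewrite size_rcons IHn. Qed.

Lemma nth_bernoulli_seq n k :
  (k < n)%N -> (bernoulli_seq n)`_k = bernoulli_number k.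
Proof.
elim: n => // n IHn; rewrite ltnS leq_eqVlt => /orP[/eqP->//|ltkn].
by rewrite /= nth_rcons size_bernoulli_seq ltkn IHn.
Qed.

Lemma bernoulli_numberE m :
  \sum_(k < m.+1) 'C(m.+1, k)%:R * bernoulli_number k = (m == 0%N)%:R.
Proof.
rewrite big_ord_recr /= binSn.
have -> : bernoulli_number m =
    ((m == 0%N)%:R - \sum_(k < m) 'C(m.+1, k)%:R * bernoulli_number k) / m.+1%:R.
  rewrite {1}/bernoulli_number /= nth_rcons size_bernoulli_seq ltnn eqxx.
  congr ((_ - _) / _); apply: eq_bigr => k _.
  by rewrite nth_bernoulli_seq.
by rewrite mulrC divfK ?pnatr_eq0 // addrC subrK.
Qed.

Lemma bernoulli_number1 : bernoulli_number 1 = - 2%:R^-1.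
Proof.
have := bernoulli_numberE 0; have := bernoulli_numberE 1.
rewrite !big_ord_recl !big_ord0 /= !bin0 bin1 !addr0 !mul1r => h1 h0.
move: h1; rewrite h0 => /eqP; rewrite addrC addr_eq0 => /eqP h.
by apply: (@mulfI _ 2%:R) => //; rewrite h mulrN mulfV.
Qed.

Section Magnus.
Variables (R : realType) (N : nat).

(* A composition i_1 + ... + i_m = j - 1 has parts smaller than j, so it is
   encoded as an m-tuple over 'I_j. *)
Definition magnus_rhs (G : R -> 'M[Cx R]_N) (Om : nat -> R -> 'M[Cx R]_N)
    (j : nat) (t : R) : 'M[Cx R]_N :=
  \sum_(1 <= m < j) (ratr (bernoulli_number m) / m`!%:R) *:
    \sum_(s : m.-tuple 'I_j |
            all (fun i : 'I_j => 0 < i)%N s && (\sum_(i <- s) i == j.-1)%N)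
      nested_comm [seq Om (nat_of_ord i) t | i <- s] (G t).

(* [Om 0] plays no role. *)
Definition is_magnus (G : R -> 'M[Cx R]_N) (Om : nat -> R -> 'M[Cx R]_N) : Prop :=
  [/\ forall j, (1 <= j)%N -> Om j 0 = 0,
      has_derivative (Om 1%N) G &
      forall j, (2 <= j)%N -> has_derivative (Om j) (magnus_rhs G Om j)].

End Magnus.

(* The computational basis of n qubits; operators are matrices whose rows and
   columns are indexed by it through [enum_rank]. *)
Definition config (n : nat) := {ffun 'I_n -> bool}.

Definition qdim (n : nat) : nat := #|{: config n}|.

Lemma qdimE n : qdim n = (2 ^ n)%N.
Proof. by rewrite /qdim card_ffun card_bool card_ord. Qed.

Notation qop R n := 'M[Cx R]_(qdim n).

Section Locality.
Variables (R : realType) (n : nat).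

Definition restr (S : {set 'I_n}) (x : config n) : {ffun {i | i \in S} -> bool} :=
  [ffun u => x (val u)].

(* M = M_S (x) 1, with M_S acting on the qubits of S. *)
Definition supported_on (S : {set 'I_n}) (M : qop R n) : Prop :=
  exists M_S : {ffun {i | i \in S} -> bool} -> {ffun {i | i \in S} -> bool} -> Cx R,
  forall x y : config n,
    M (enum_rank x) (enum_rank y) =
    M_S (restr S x) (restr S y) * [forall (i | i \notin S), x i == y i]%:R.

(* Distance of sites on the open chain or, if [periodic], on the ring. *)
Definition lattice_dist (periodic : bool) (i j : 'I_n) : nat :=
  let r := (maxn i j - minn i j)%N in if periodic then minn r (n - r)%N else r.

Definition geometrically_local (periodic : bool) (chi : nat) (A : qop R n) : Prop :=
  exists A_ : 'I_n -> qop R n,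
    A = \sum_(i < n) A_ i /\
    forall i : 'I_n, spectral_norm (A_ i) <= 1 /\
      exists S : {set 'I_n},
        [/\ i \in S,
            {in S &, forall j l, (lattice_dist periodic j l <= chi)%N} &
            supported_on S (A_ i)].

Definition local_terms (k : nat) (B_ : {set 'I_n} -> qop R n) : Prop :=
  forall X : {set 'I_n}, X != finset.set0 ->
    supported_on X (B_ X) /\ ((k < #|X|)%N -> B_ X = 0).

Definition local_sum (B_ : {set 'I_n} -> qop R n) : qop R n :=
  \sum_(X : {set 'I_n} | X != finset.set0) B_ X.

Definition interaction_degree (B_ : {set 'I_n} -> qop R n) : R :=
  \big[Num.max/0]_(i < n) \sum_(X : {set 'I_n} | i \in X) spectral_norm (B_ X).

Definition interaction_picture (alpha : R) (A B : qop R n) (tau : R) : qop R n :=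
  (- 'i * real_Cx alpha) *:
    (mexp (('i * real_Cx tau) *: A) *m B *m mexp ((- 'i * real_Cx tau) *: A)).

End Locality.

(* Main.v *)
Require Import Defs.
From mathcomp Require Import all_boot all_order all_algebra.
From mathcomp Require Import complex ring lra zify.
From mathcomp Require Import all_classical all_reals all_analysis.
Set Implicit Arguments.
Unset Strict Implicit.
Unset Printing Implicit Defensive.
Import Order.TTheory GRing.Theory Num.Theory.
Import numFieldNormedType.Exports.
Local Open Scope ring_scope.

(** The flow [Y] and the truncated Magnus exponential [e^Z], [Z = Om_1 + ... + Om_q],
    are compared through the slope of [||Y - e^Z||].  Since [Z] is anti-Hermitian,
    Taylor's formula for [e^{s ad Z}] with a remainder conjugated by unitaries gives
    [(e^Z)' = (P + rem) e^Z] with [P = \sum_(m < q) ad_Z^m(Z') / (m+1)!] and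
    [||rem|| <= ||ad_Z^q(Z')||]; no convergence of the Magnus series is needed.  By the
    Bernoulli identity the terms of order at most [q] in [P - B_I] cancel, so both
    errors are finite sums of nested commutators of order between [q+1] and a constant.

    Nested commutators are controlled by the norms
    [f_p(M) = inf max_i \sum_(S containing i) |S|^p ||M_S||] over decompositions
    [M = \sum_S M_S] into local terms: [f_p [M, M'] <= c_p f_(p+1)(M) f_(p+1)(M')] and
    [||M|| <= n f_0(M)].  It remains to bound [f_p] of [e^{iAs} B e^{-iAs}] by a constant
    times [d].  Decompose along the neighbourhoods [X_r] of the sets [X] of at most [k]
    sites, with weight [lam^r].  In one dimension only boundedly many terms of [A] cross
    the boundary of [X_r]; they move mass from [r] to [r+1], while the terms inside [X_r]
    act isometrically to first order.  So this weighted norm grows at most exponentially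
    in [s], at a rate independent of [n]. *)
(** * Complex moduli, adjoints and the spectral norm *)

(** The obstacle is the dependence on [n]: the operator norms of [A] and [B] grow with [n], and
    estimates of the commutators by them would bring powers of [n] at order [q + 1]. In the locality
    norms the constants are free of [n]; one factor [n] enters, when the final error is converted to
    the operator norm. Two devices keep it so. Norms are never differentiated: a value at [c + h] is
    compared with the value at [c], for [h] small in a way that may depend on [n] and on the
    operators. Terms of order [h^2], even with coefficient [n^4], thus disappear from the slope, and
    no decomposition has to be chosen continuously in time. And the exponents [p] form a scale
    rather than a single norm: a commutator merges overlapping supports and costs one power of the
    size, a loss that can be afforded because the number of nested commutators is bounded in terms
    of [q]. Orders above [q + 1] are absorbed into order [q + 1] while [alpha d t <= 1]; beyond this
    range the estimate is trivial, because both exponentials have norm at most 1. *)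

Section ComplexAbs.
Variable R : realType.
Implicit Types x y : Cx R.

(** The norm of [Cx R] takes its values in [Cx R] itself; a real-valued modulus keeps the estimates
    in the ordered field [R]. *)
Definition cabs x : R := Num.sqrt (complex.Re x ^+ 2 + complex.Im x ^+ 2).

Lemma ReD x y : complex.Re (x + y) = complex.Re x + complex.Re y.
Proof. by case: x y => a b [c d]. Qed.

Lemma ImD x y : complex.Im (x + y) = complex.Im x + complex.Im y.
Proof. by case: x y => a b [c d]. Qed.

Lemma ReM x y : complex.Re (x * y) =
  complex.Re x * complex.Re y - complex.Im x * complex.Im y.
Proof. by case: x y => a b [c d]. Qed.

Lemma Re_conj x : complex.Re x^* = complex.Re x.
Proof. by case: x => a b. Qed.

Lemma Im_conj x : complex.Im x^* = - complex.Im x.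
Proof. by case: x => a b. Qed.

Lemma Cx_eq x y :
  complex.Re x = complex.Re y -> complex.Im x = complex.Im y -> x = y.
Proof. by case: x y => a b [c d] /= -> ->. Qed.

Lemma conj_real (a : R) : (real_Cx a)^* = real_Cx a.
Proof. by apply: Cx_eq; rewrite ?Re_conj ?Im_conj //= oppr0. Qed.

Lemma normCx x : `|x| = real_Cx (cabs x).
Proof. by case: x. Qed.

Lemma real_Cx_le (a b : R) : (real_Cx a <= real_Cx b) = (a <= b).
Proof. exact: lecR. Qed.

Lemma real_Cx_lt (a b : R) : (real_Cx a < real_Cx b) = (a < b).
Proof. exact: ltcR. Qed.

Lemma real_CxM (a b : R) : real_Cx (a * b) = real_Cx a * real_Cx b.
Proof. exact: rmorphM. Qed.

Lemma real_CxD (a b : R) : real_Cx (a + b) = real_Cx a + real_Cx b.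
Proof. exact: rmorphD. Qed.

Lemma real_CxN (a : R) : real_Cx (- a) = - real_Cx a.
Proof. exact: rmorphN. Qed.

Lemma real_CxB (a b : R) : real_Cx (a - b) = real_Cx a - real_Cx b.
Proof. exact: rmorphB. Qed.

Lemma real_CxV (a : R) : real_Cx a^-1 = (real_Cx a)^-1.
Proof. exact: fmorphV. Qed.

Lemma real_Cx1 : real_Cx 1 = 1 :> Cx R.
Proof. by []. Qed.

Lemma real_Cx0 : real_Cx 0 = 0 :> Cx R.
Proof. by []. Qed.

Lemma real_Cx_nat n : real_Cx n%:R = n%:R :> Cx R.
Proof. exact: rmorph_nat. Qed.

Lemma real_CxX (a : R) n : real_Cx (a ^+ n) = real_Cx a ^+ n.
Proof. exact: rmorphXn. Qed.

Lemma cabs_ge0 x : 0 <= cabs x.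
Proof. exact: sqrtr_ge0. Qed.

Lemma cabs_real (a : R) : cabs (real_Cx a) = `|a|.
Proof. by rewrite /cabs /= expr0n addr0 sqrtr_sqr. Qed.

Lemma cabsM x y : cabs (x * y) = cabs x * cabs y.
Proof.
have : real_Cx (cabs (x * y)) = real_Cx (cabs x * cabs y).
  by rewrite real_CxM -!normCx normrM.
by case.
Qed.

Lemma cabs_i : cabs 'i = 1.
Proof. by rewrite /cabs /= expr0n add0r expr1n sqrtr1. Qed.

Lemma cabsN x : cabs (- x) = cabs x.
Proof. by case: x => a b; rewrite /cabs /= !sqrrN. Qed.

Lemma cabs_sqr x : cabs x ^+ 2 = complex.Re x ^+ 2 + complex.Im x ^+ 2.
Proof. by rewrite sqr_sqrtr // addr_ge0 // sqr_ge0. Qed.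

Lemma Re_le_cabs x : `|complex.Re x| <= cabs x.
Proof. by rewrite -sqrtr_sqr ler_wsqrtr // lerDl sqr_ge0. Qed.

Lemma Im_le_cabs x : `|complex.Im x| <= cabs x.
Proof. by rewrite -sqrtr_sqr ler_wsqrtr // lerDr sqr_ge0. Qed.

Lemma cabs_le x : cabs x <= `|complex.Re x| + `|complex.Im x|.
Proof.
rewrite -(@ler_pXn2r _ 2) ?nnegrE ?cabs_ge0 ?addr_ge0 //.
rewrite cabs_sqr sqrrD !real_normK ?num_real // lerD2r lerDl.
by rewrite mulrn_wge0 // mulr_ge0.
Qed.

End ComplexAbs.

(** * Conjugate transposes *)

Section Adjoint.
Variable R : realType.

Definition adjm m n (M : 'M[Cx R]_(m, n)) : 'M[Cx R]_(n, m) :=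
  map_mx Num.conj M^T.

Lemma adjmE m n (M : 'M[Cx R]_(m, n)) i j : adjm M i j = (M j i)^*.
Proof. by rewrite !mxE. Qed.

Lemma adjmK m n (M : 'M[Cx R]_(m, n)) : adjm (adjm M) = M.
Proof. by apply/matrixP => i j; rewrite !adjmE conjCK. Qed.

Lemma adjmD m n (M1 M2 : 'M[Cx R]_(m, n)) : adjm (M1 + M2) = adjm M1 + adjm M2.
Proof. by apply/matrixP => i j; rewrite !mxE rmorphD. Qed.

Lemma adjmN m n (M : 'M[Cx R]_(m, n)) : adjm (- M) = - adjm M.
Proof. by apply/matrixP => i j; rewrite !mxE rmorphN. Qed.

Lemma adjmB m n (M1 M2 : 'M[Cx R]_(m, n)) : adjm (M1 - M2) = adjm M1 - adjm M2.
Proof. by rewrite adjmD adjmN. Qed.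

Lemma adjm0 m n : adjm (0 : 'M[Cx R]_(m, n)) = 0.
Proof. by apply/matrixP => i j; rewrite !mxE rmorph0. Qed.

Lemma adjmZ m n c (M : 'M[Cx R]_(m, n)) : adjm (c *: M) = c^* *: adjm M.
Proof. by apply/matrixP => i j; rewrite !mxE rmorphM. Qed.

Lemma adjmM m n p (M1 : 'M[Cx R]_(m, n)) (M2 : 'M[Cx R]_(n, p)) :
  adjm (M1 *m M2) = adjm M2 *m adjm M1.
Proof. by rewrite /adjm trmx_mul map_mxM. Qed.

Lemma adjm1 n : adjm (1%:M : 'M[Cx R]_n) = 1%:M.
Proof. by rewrite /adjm trmx1 map_mx1. Qed.

Lemma adjm_sum m n (I : Type) (r : seq I) (P : pred I) (F : I -> 'M[Cx R]_(m, n)) :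
  adjm (\sum_(i <- r | P i) F i) = \sum_(i <- r | P i) adjm (F i).
Proof. by apply: (big_morph _ (@adjmD m n)); rewrite adjm0. Qed.

Lemma hermsymmx_adjm n (M : 'M[Cx R]_n) : M \is hermsymmx -> adjm M = M.
Proof.
move/is_hermitianmxP; rewrite expr0 scale1r => {2}->.
by apply/matrixP => i j; rewrite !mxE.
Qed.

End Adjoint.

(** * The operator norm and anti-Hermitian matrices *)

Section SpectralNorm.
Variables (R : realType) (N : nat).
Local Notation C := (Cx R).
Implicit Types (u v w : 'cV[C]_N) (M : 'M[C]_N).

(** The real part of the Hermitian product is a symmetric real bilinear form with the same norm; it
    vanishes on [v], [M v] for anti-Hermitian [M]. *)
Definition rdot u v : R := complex.Re ((adjm u *m v) 0 0).

Lemma rdotC u v : rdot u v = rdot v u.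
Proof. by rewrite /rdot -(Re_conj ((adjm u *m v) 0 0)) -adjmE adjmM adjmK. Qed.

Lemma rdotDr u v w : rdot u (v + w) = rdot u v + rdot u w.
Proof. by rewrite /rdot mulmxDr mxE ReD. Qed.

Lemma rdotDl u v w : rdot (v + w) u = rdot v u + rdot w u.
Proof. by rewrite !(rdotC _ u) rdotDr. Qed.

Lemma rdotZr (a : R) u v : rdot u (real_Cx a *: v) = a * rdot u v.
Proof. by rewrite /rdot -scalemxAr mxE ReM /= mul0r subr0. Qed.

Lemma rdotZl (a : R) u v : rdot (real_Cx a *: u) v = a * rdot u v.
Proof. by rewrite rdotC rdotZr rdotC. Qed.

Lemma rdot_adj M u v : rdot (M *m u) v = rdot u (adjm M *m v).
Proof. by rewrite /rdot adjmM mulmxA. Qed.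

Lemma rdotvv v : rdot v v = \sum_i cabs (v i 0) ^+ 2.
Proof.
rewrite /rdot mxE (big_morph _ (@ReD R) (erefl : complex.Re (0 : C) = 0)).
by apply: eq_bigr => i _; rewrite adjmE ReM Re_conj Im_conj cabs_sqr; ring.
Qed.

Lemma rdot_ge0 v : 0 <= rdot v v.
Proof. by rewrite rdotvv sumr_ge0 // => i _; rewrite sqr_ge0. Qed.

Lemma l2normE v : l2norm v = Num.sqrt (rdot v v).
Proof.
by rewrite rdotvv /l2norm; congr Num.sqrt; apply: eq_bigr => i _; rewrite cabs_sqr.
Qed.

Lemma l2norm_ge0 v : 0 <= l2norm v.
Proof. exact: sqrtr_ge0. Qed.

Lemma l2norm_sqr v : l2norm v ^+ 2 = rdot v v.
Proof. by rewrite l2normE sqr_sqrtr // rdot_ge0. Qed.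

Lemma rdot_CS u v : rdot u v <= l2norm u * l2norm v.
Proof.
have H (x y : R) : 0 <= x ^+ 2 * l2norm u ^+ 2 + 2 * x * y * rdot u v
    + y ^+ 2 * l2norm v ^+ 2.
  have := rdot_ge0 (real_Cx x *: u + real_Cx y *: v).
  rewrite rdotDl !rdotDr !rdotZl !rdotZr (rdotC v u) -!l2norm_sqr.
  by move=> h; apply: le_trans h _; rewrite le_eqVlt; apply/orP; left; apply/eqP; ring.
move: (l2norm_ge0 u) (l2norm_ge0 v) H.
set a := l2norm u; set b := l2norm v; set c := rdot u v => a0 b0 H.
(* If [c > a * b], the quadratic form of [H] is negative at [(1, - (a^2 + 1) / c)] when [b = 0], and
   at [(b^2, - c)] otherwise. *)
rewrite leNgt; apply/negP => ltc.
have c0 : 0 < c by apply: le_lt_trans ltc; rewrite mulr_ge0.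
have [b00|bn0] := eqVneq b 0.
  have := H 1 (- (a ^+ 2 + 1) / c); rewrite b00.
  have -> : 2 * 1 * (- (a ^+ 2 + 1) / c) * c = - 2 * (a ^+ 2 + 1).
    by field; rewrite gt_eqF.
  by have := sqr_ge0 a; nra.
have b1 : 0 < b by rewrite lt0r bn0.
have := H (b ^+ 2) (- c).
have -> : (b ^+ 2) ^+ 2 * a ^+ 2 + 2 * b ^+ 2 * (- c) * c + (- c) ^+ 2 * b ^+ 2
  = b ^+ 2 * ((a * b) ^+ 2 - c ^+ 2) by ring.
rewrite pmulr_rge0 ?exprn_gt0 // subr_ge0 leNgt ltr_pXn2r ?ltc //.
  by rewrite nnegrE mulr_ge0.
by rewrite nnegrE ltW.
Qed.

Lemma l2norm_triangle u v : l2norm (u + v) <= l2norm u + l2norm v.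
Proof.
rewrite -(@ler_pXn2r _ 2) ?nnegrE ?l2norm_ge0 ?addr_ge0 ?l2norm_ge0 //.
rewrite l2norm_sqr rdotDl !rdotDr (rdotC v u) -!l2norm_sqr.
by have := rdot_CS u v; nra.
Qed.

Lemma l2normZ c v : l2norm (c *: v) = cabs c * l2norm v.
Proof.
apply/eqP; rewrite -(@eqrXn2 _ 2) ?mulr_ge0 ?cabs_ge0 ?l2norm_ge0 //.
rewrite exprMn !l2norm_sqr !rdotvv mulr_sumr.
by apply/eqP/eq_bigr => i _; rewrite mxE cabsM exprMn.
Qed.

Lemma l2norm0 : l2norm (0 : 'cV[C]_N) = 0.
Proof. by rewrite -(scale0r 0) l2normZ cabs_real normr0 mul0r. Qed.

Lemma l2norm_sum (I : Type) (r : seq I) (P : pred I) (F : I -> 'cV[C]_N) :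
  l2norm (\sum_(i <- r | P i) F i) <= \sum_(i <- r | P i) l2norm (F i).
Proof.
elim/big_ind2: _ => [|x1 x2 y1 y2 h1 h2|//]; first by rewrite l2norm0.
exact: le_trans (l2norm_triangle _ _) (lerD _ _).
Qed.

Lemma l2norm_eq0 v : l2norm v = 0 -> v = 0.
Proof.
move=> v0; have := rdotvv v; rewrite -l2norm_sqr v0 expr0n /= => /esym/eqP.
rewrite psumr_eq0 => [/allP h|i _]; last exact: sqr_ge0.
apply/colP => i; rewrite mxE; apply/eqP.
have /= := h i (mem_index_enum _); rewrite expf_eq0 /= => /eqP vi0.
by rewrite -normr_eq0 normCx vi0.
Qed.

Lemma cabs_le_l2norm v i : cabs (v i 0) <= l2norm v.
Proof.
rewrite -(@ler_pXn2r _ 2) ?nnegrE ?cabs_ge0 ?l2norm_ge0 //.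
rewrite l2norm_sqr rdotvv (bigD1 i) //= lerDl.
by rewrite sumr_ge0 // => j _; rewrite sqr_ge0.
Qed.

Lemma l2norm_mulmx_bound M v :
  l2norm (M *m v) <= (\sum_j l2norm (col j M)) * l2norm v.
Proof.
have -> : M *m v = \sum_j v j 0 *: col j M.
  apply/colP => i; rewrite mxE summxE; apply: eq_bigr => j _.
  by rewrite !mxE mulrC.
apply: le_trans (l2norm_sum _ _ _) _; rewrite mulr_suml.
apply: ler_sum => j _; rewrite l2normZ mulrC.
by rewrite ler_wpM2l ?l2norm_ge0 // cabs_le_l2norm.
Qed.

Local Open Scope classical_set_scope.

(* Locked, so that unification never unfolds the supremum. *)
Definition opnorm M : R := locked (@spectral_norm R N) M.
Local Notation nrm := opnorm.

Lemma opnormE M : opnorm M = spectral_norm M.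
Proof. by rewrite /opnorm -lock. Qed.

Lemma spectral_norm_has_sup M :
  has_sup [set l2norm (M *m v) | v in [set v | l2norm v <= 1]].
Proof.
split; first by exists (l2norm (M *m 0)); exists 0; rewrite //= l2norm0.
exists (\sum_j l2norm (col j M)) => _ [v /= v1 <-].
apply: le_trans (l2norm_mulmx_bound M v) _.
by rewrite ler_piMr // sumr_ge0 // => j _; exact: l2norm_ge0.
Qed.

Lemma nrmP M v : l2norm (M *m v) <= nrm M * l2norm v.
Proof.
rewrite opnormE; have [v0|vn0] := eqVneq (l2norm v) 0.
  by rewrite (l2norm_eq0 v0) mulmx0 l2norm0 mulr0.
have v_gt0 : 0 < l2norm v by rewrite lt0r vn0 l2norm_ge0.
rewrite -ler_pdivrMr //.
apply: ub_le_sup; first by have [] := spectral_norm_has_sup M.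
exists (real_Cx (l2norm v)^-1 *: v) => /=.
  by rewrite l2normZ cabs_real ger0_norm ?invr_ge0 ?l2norm_ge0 // mulVf.
by rewrite -scalemxAr l2normZ cabs_real ger0_norm ?invr_ge0 ?l2norm_ge0 // mulrC.
Qed.

Lemma nrm_le M c : 0 <= c -> (forall v, l2norm (M *m v) <= c * l2norm v) ->
  nrm M <= c.
Proof.
move=> c0 h; rewrite opnormE; apply: ge_sup; first by have [] := spectral_norm_has_sup M.
by move=> _ [v /= v1 <-]; apply: le_trans (h v) _; rewrite ler_piMr.
Qed.

Lemma nrm_ge0 M : 0 <= nrm M.
Proof.
rewrite opnormE; apply: le_trans (ub_le_sup _ _); first exact: (l2norm_ge0 (M *m 0)).
  by have [] := spectral_norm_has_sup M.
by exists 0; rewrite //= l2norm0.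
Qed.

Lemma nrm_triangle M1 M2 : nrm (M1 + M2) <= nrm M1 + nrm M2.
Proof.
apply: nrm_le => [|v]; first by rewrite addr_ge0 ?nrm_ge0.
rewrite mulmxDl mulrDl; apply: le_trans (l2norm_triangle _ _) _.
by rewrite lerD ?nrmP.
Qed.

Lemma nrmZ_le c M : nrm (c *: M) <= cabs c * nrm M.
Proof.
apply: nrm_le => [|v]; first by rewrite mulr_ge0 ?cabs_ge0 ?nrm_ge0.
by rewrite -scalemxAl l2normZ -mulrA ler_wpM2l ?cabs_ge0 ?nrmP.
Qed.

Lemma nrm0 : nrm 0 = 0.
Proof.
apply/eqP; rewrite eq_le nrm_ge0 andbT; apply: nrm_le => // v.
by rewrite mul0mx l2norm0 mul0r.
Qed.

Lemma nrmZ c M : nrm (c *: M) = cabs c * nrm M.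
Proof.
apply/eqP; rewrite eq_le nrmZ_le /=.
have [->|cn0] := eqVneq c 0.
  by rewrite cabs_real normr0 mul0r nrm_ge0.
have cc : cabs c * cabs c^-1 = 1 by rewrite -cabsM mulfV // cabs_real normr1.
have := nrmZ_le c^-1 (c *: M); rewrite scalerA mulVf // scale1r => h.
by rewrite -[leRHS]mul1r -cc -mulrA ler_wpM2l // cabs_ge0.
Qed.

Lemma nrmZr (a : R) M : nrm (real_Cx a *: M) = `|a| * nrm M.
Proof. by rewrite nrmZ cabs_real. Qed.

Lemma nrmN M : nrm (- M) = nrm M.
Proof. by rewrite -scaleN1r nrmZ cabsN cabs_real normr1 mul1r. Qed.

Lemma nrmB M1 M2 : nrm (M1 - M2) <= nrm M1 + nrm M2.
Proof. by rewrite -(nrmN M2) nrm_triangle. Qed.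

Lemma nrmBC M1 M2 : nrm (M1 - M2) = nrm (M2 - M1).
Proof. by rewrite -nrmN opprB. Qed.

Lemma nrmM M1 M2 : nrm (M1 *m M2) <= nrm M1 * nrm M2.
Proof.
apply: nrm_le => [|v]; first by rewrite mulr_ge0 ?nrm_ge0.
rewrite -mulmxA -mulrA; apply: le_trans (nrmP _ _) _.
by rewrite ler_wpM2l ?nrm_ge0 ?nrmP.
Qed.

(** Equality fails for [N = 0]. *)
Lemma nrm1 : nrm 1%:M <= 1.
Proof. by apply: nrm_le => // v; rewrite mul1mx mul1r. Qed.

Lemma nrm_sum (I : Type) (r : seq I) (P : pred I) (F : I -> 'M[C]_N) :
  nrm (\sum_(i <- r | P i) F i) <= \sum_(i <- r | P i) nrm (F i).
Proof.
elim/big_ind2: _ => [|x1 x2 y1 y2 h1 h2|//]; first by rewrite nrm0.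
exact: le_trans (nrm_triangle _ _) (lerD _ _).
Qed.

Lemma nrm_adj_le M : nrm (adjm M) <= nrm M.
Proof.
apply: nrm_le => [|v]; first exact: nrm_ge0.
have [->|vn0] := eqVneq (l2norm (adjm M *m v)) 0.
  by rewrite mulr_ge0 ?nrm_ge0 ?l2norm_ge0.
have w_gt0 : 0 < l2norm (adjm M *m v) by rewrite lt0r vn0 l2norm_ge0.
rewrite -(ler_pM2r w_gt0) -expr2 l2norm_sqr rdot_adj adjmK.
apply: le_trans (rdot_CS _ _) _.
by rewrite (mulrC (nrm M)) -mulrA ler_wpM2l ?l2norm_ge0 ?nrmP.
Qed.

Lemma nrm_adj M : nrm (adjm M) = nrm M.
Proof.
by apply/le_anti; rewrite nrm_adj_le /=; have := nrm_adj_le (adjm M); rewrite adjmK.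
Qed.

Lemma cabs_le_nrm M i j : cabs (M i j) <= nrm M.
Proof.
have := cabs_le_l2norm (M *m delta_mx j 0) i; rewrite -colE mxE => h.
apply: le_trans h _; rewrite colE; apply: le_trans (nrmP _ _) _.
rewrite ler_piMr ?nrm_ge0 // -(@ler_pXn2r _ 2) ?nnegrE ?l2norm_ge0 //.
rewrite l2norm_sqr rdotvv (bigD1 j) //= mxE !eqxx /= cabs_real normr1 expr1n.
rewrite big1 ?addr0 // => k kj; rewrite mxE (negPf kj) /=.
by rewrite cabs_real normr0 expr0n.
Qed.

Lemma nrm_delta_le i j : nrm (delta_mx i j) <= 1.
Proof.
apply: nrm_le => // v; rewrite mul1r.
have -> : delta_mx i j *m v = v j 0 *: delta_mx i 0.
  apply/colP => a; rewrite !mxE (bigD1 j) //= !mxE eqxx andbT big1 => [|b bj].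
    by rewrite addr0 mulrC ?eqxx ?andbT.
  by rewrite mxE (negPf bj) andbF mul0r.
rewrite l2normZ; apply: le_trans (_ : cabs (v j 0) * 1 <= _); last first.
  by rewrite mulr1 cabs_le_l2norm.
rewrite ler_wpM2l ?cabs_ge0 // -(@ler_pXn2r _ 2) ?nnegrE ?l2norm_ge0 //.
rewrite l2norm_sqr rdotvv (bigD1 i) //= mxE !eqxx /= cabs_real normr1 expr1n.
rewrite big1 ?addr0 // => k kj; rewrite mxE (negPf kj) /=.
by rewrite cabs_real normr0 expr0n.
Qed.

Lemma nrm_le_entries M : nrm M <= \sum_i \sum_j cabs (M i j).
Proof.
rewrite {1}(matrix_sum_delta M); apply: le_trans (nrm_sum _ _ _) _.
apply: ler_sum => i _; apply: le_trans (nrm_sum _ _ _) _.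
apply: ler_sum => j _; rewrite nrmZ ler_piMr ?cabs_ge0 ?nrm_delta_le //.
Qed.

Lemma nrm_eq0 M : nrm M <= 0 -> M = 0.
Proof.
move=> h; apply/matrixP => i j; rewrite mxE; apply/eqP.
rewrite -normr_eq0 normCx.
by have /le_anti -> : cabs (M i j) <= 0 <= cabs (M i j)
  by rewrite cabs_ge0 (le_trans (cabs_le_nrm M i j)).
Qed.

Definition skew M := adjm M = - M.

Lemma rdot_skew M v : skew M -> rdot v (M *m v) = 0.
Proof.
move=> sM; have := rdot_adj M v v; rewrite sM mulNmx.
have -> : - (M *m v) = real_Cx (- 1) *: (M *m v).
  by rewrite real_CxN real_Cx1 scaleN1r.
rewrite rdotZr mulN1r rdotC => h; lra.
Qed.

(** The cross term [2 h <v, M v>] of the squared length vanishes, so the deviation from 1 is of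
    second order in [h]. Every isometry argument below rests on this. *)
Lemma nrm_1_skew M (h : R) : skew M ->
  nrm (1%:M + real_Cx h *: M) <= 1 + h ^+ 2 * nrm M ^+ 2.
Proof.
move=> sM; apply: nrm_le => [|v]; first by rewrite addr_ge0 // mulr_ge0 ?sqr_ge0.
have c1 : 1 <= 1 + h ^+ 2 * nrm M ^+ 2 by rewrite lerDl mulr_ge0 // sqr_ge0.
have c0 : 0 <= 1 + h ^+ 2 * nrm M ^+ 2 by apply: le_trans c1.
rewrite -(@ler_pXn2r _ 2) ?nnegrE ?mulr_ge0 ?l2norm_ge0 //.
rewrite mulmxDl mul1mx -scalemxAl l2norm_sqr rdotDl !rdotDr !rdotZl !rdotZr.
rewrite (rdotC (M *m v) v) rdot_skew // !mulr0 addr0 add0r -!l2norm_sqr.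
apply: (@le_trans _ _ ((1 + h ^+ 2 * nrm M ^+ 2) * l2norm v ^+ 2)).
  rewrite mulrDl mul1r lerD2l mulrA -expr2 -[leRHS]mulrA ler_wpM2l ?sqr_ge0 //.
  by rewrite -exprMn ler_pXn2r ?nnegrE ?mulr_ge0 ?nrm_ge0 ?l2norm_ge0 ?nrmP.
by rewrite exprMn ler_wpM2r ?sqr_ge0 // expr2 ler_peMr.
Qed.

Lemma nrm_mcomm M1 M2 : nrm (mcomm M1 M2) <= 2 * nrm M1 * nrm M2.
Proof.
apply: le_trans (nrmB _ _) _; apply: le_trans (lerD (nrmM _ _) (nrmM _ _)) _.
by rewrite (mulrC (nrm M2)) -mulrA mulr_natl mulr2n.
Qed.

Lemma skew0 : skew 0.
Proof. by rewrite /skew adjm0 oppr0. Qed.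

Lemma skewD M1 M2 : skew M1 -> skew M2 -> skew (M1 + M2).
Proof. by rewrite /skew adjmD opprD => -> ->. Qed.

Lemma skewZ (a : R) M : skew M -> skew (real_Cx a *: M).
Proof.
by rewrite /skew adjmZ conj_real => ->; rewrite scalerN.
Qed.

Lemma skew_mcomm M1 M2 : skew M1 -> skew M2 -> skew (mcomm M1 M2).
Proof.
rewrite /skew /mcomm adjmB !adjmM => -> ->.
by rewrite !mulmxN !mulNmx !opprK opprB.
Qed.

Lemma skew_sum (I : Type) (r : seq I) (P : pred I) (F : I -> 'M[C]_N) :
  (forall i, P i -> skew (F i)) -> skew (\sum_(i <- r | P i) F i).
Proof. by move=> h; elim/big_ind: _ => //; [exact: skew0|exact: skewD]. Qed.

End SpectralNorm.

(** * Topology of matrices and convergence of the exponential series *)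

Section MatrixTopology.
Variables (R : realType) (N : nat).
Local Notation C := (Cx R).
Local Notation nrm := (@opnorm R N).
Local Open Scope classical_set_scope.

Lemma mx_norm_le_nrm (M : 'M[C]_N) : `|M| <= real_Cx (nrm M).
Proof.
have [->|] := eqVneq `|M| 0; first by rewrite -real_Cx0 real_Cx_le nrm_ge0.
case/mx_norm_neq0 => ij Eij.
have -> : `|M| = `|M ij.1 ij.2| by [].
by rewrite normCx real_Cx_le cabs_le_nrm.
Qed.

Lemma cabs_le_mx_norm (M : 'M[C]_N) i j : real_Cx (cabs (M i j)) <= `|M|.
Proof.
rewrite -normCx (_ : `|M| = mx_norm M) // mx_normE.
rewrite -[leLHS]nngE num_le.
exact: (le_bigmax _ (fun ij : 'I_N * 'I_N => `|M ij.1 ij.2|%:nng) (i, j)).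
Qed.

(** The dimension-dependent factor only transfers convergence from the entrywise norm to the
    operator norm; it enters no final constant. *)
Lemma nrm_le_mx_norm (M : 'M[C]_N) (e : R) :
  `|M| <= real_Cx e -> nrm M <= (N * N)%:R * e.
Proof.
move=> Me; apply: le_trans (nrm_le_entries M) _.
apply: (@le_trans _ _ (\sum_(i < N) \sum_(j < N) e)).
  apply: ler_sum => i _; apply: ler_sum => j _.
  by rewrite -real_Cx_le; apply: le_trans Me; exact: cabs_le_mx_norm.
by rewrite !sumr_const !card_ord -mulrnA mulr_natl.
Qed.

(** The little-o form, including [h = 0], is what the one-step comparisons consume directly. *)
Definition mderiv (F : R -> 'M[C]_N) (t : R) (D : 'M[C]_N) : Prop :=
  forall e : R, 0 < e -> exists2 d : R, 0 < d &
    forall h : R, `|h| < d -> nrm (F (t + h) - F t - real_Cx h *: D) <= e * `|h|.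

Lemma has_derivative_mderiv F F' t : has_derivative F F' -> mderiv F t (F' t).
Proof.
move=> /(_ t) /cvgrPdist_le FF' e e0.
(* The divisor absorbs the factor [N * N] of [nrm_le_mx_norm]; its successor is nonzero also for
   [N = 0]. *)
have e'0 : 0 < real_Cx (e / (N * N).+1%:R) :> C.
  by rewrite -real_Cx0 real_Cx_lt divr_gt0.
have /nbhs_ballP [d /= d0 Hd] := FF' _ e'0.
exists d => // h hd; have [->|h0] := eqVneq h 0.
  by rewrite addr0 subrr real_Cx0 scale0r subrr nrm0 normr0 mulr0.
have /= := Hd h; rewrite /ball /= sub0r normrN => /(_ hd h0) /nrm_le_mx_norm.
have -> : F (t + h) - F t - real_Cx h *: F' t =
    - (real_Cx h *: (F' t - real_Cx h^-1 *: (F (t + h) - F t))).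
  rewrite scalerBr scalerA -real_CxM mulfV // real_Cx1 scale1r.
  by rewrite [RHS]opprB.
move=> H; rewrite nrmN nrmZr mulrC ler_wpM2r //; apply: le_trans H _.
rewrite mulrCA ler_piMr ?(ltW e0) // ler_pdivrMr ?mul1r ?ltr0n // ler_nat.
exact: leqnSn.
Qed.

Lemma mderiv_cont F t D : mderiv F t D ->
  forall e, 0 < e -> exists2 d : R, 0 < d &
    forall h, `|h| < d -> nrm (F (t + h) - F t) <= e.
Proof.
move=> FD e e0; have [d d0 Hd] := FD 1 ltr01.
have K0 : 0 < 1 + nrm D by rewrite ltr_wpDr ?nrm_ge0.
exists (Num.min d (e / (1 + nrm D))); first by rewrite lt_min d0 divr_gt0.
move=> h; rewrite lt_min => /andP[hd he].
have -> : F (t + h) - F t = (F (t + h) - F t - real_Cx h *: D) + real_Cx h *: D.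
  by rewrite subrK.
apply: le_trans (nrm_triangle _ _) _; rewrite nrmZr.
have := Hd h hd; rewrite ltr_pdivlMr // in he.
by have := normr_ge0 h; nra.
Qed.

Definition mexp_partial (M : 'M[C]_N) (n : nat) : 'M[C]_N :=
  \sum_(0 <= k < n) (k`!%:R)^-1 *: M ^+ k.

Lemma nrmX (M : 'M[C]_N) k : nrm (M ^+ k) <= nrm M ^+ k.
Proof.
elim: k => [|k IH]; first by rewrite !expr0; exact: nrm1.
rewrite !exprS; apply: le_trans (nrmM _ _) _.
by rewrite ler_wpM2l ?nrm_ge0.
Qed.

Lemma nrm_mexp_term (M : 'M[C]_N) k :
  nrm ((k`!%:R)^-1 *: M ^+ k) <= exp_coeff (nrm M) k.
Proof.
rewrite -real_Cx_nat -real_CxV nrmZr ger0_norm ?invr_ge0 //.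
by rewrite /exp_coeff /= mulrC ler_wpM2r ?invr_ge0 ?nrmX.
Qed.

Lemma cvg_dominated_exp (u : nat -> R) (a : R) : 0 <= a ->
  (forall k, `|u k| <= exp_coeff a k) -> cvgn (series u).
Proof.
move=> a0 ua; apply: normed_cvg; apply: series_le_cvg (is_cvg_series_exp_coeff a).
- by move=> n; exact: normr_ge0.
- by move=> n; exact: exp_coeff_ge0.
- exact: ua.
Qed.

Lemma cvgn_dist (u : nat -> R) : cvgn u -> forall e, 0 < e ->
  exists n0, forall n, (n0 <= n)%N -> `|u n - limn u| <= e.
Proof.
move=> cu e e0; have /cvgrPdist_le/(_ e e0) [n0 _ H] := cu.
by exists n0 => n nn; rewrite distrC; exact: H.
Qed.

Lemma uniform_index (I : finType) (P : I -> nat -> Prop) :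
  (forall i, exists n0, forall n, (n0 <= n)%N -> P i n) ->
  exists n0, forall n, (n0 <= n)%N -> forall i, P i n.
Proof.
move=> H; have [f Hf] := choice H.
exists (\max_i f i)%N => n nn i; apply: Hf; apply: leq_trans nn.
exact: leq_bigmax.
Qed.

(** The real and imaginary parts of each entry form real series dominated by the exponential series
    of [nrm M]; there are finitely many entries, so one index serves them all. *)
Lemma mexp_partial_cvg (M : 'M[C]_N) : exists L : 'M[C]_N,
  forall e : R, 0 < e -> exists n0, forall n, (n0 <= n)%N ->
    nrm (mexp_partial M n - L) <= e.
Proof.
pose re i j := series (fun k => complex.Re (((k`!%:R)^-1 *: M ^+ k) i j)).
pose im i j := series (fun k => complex.Im (((k`!%:R)^-1 *: M ^+ k) i j)).
have cre i j : cvgn (re i j).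
  apply: (@cvg_dominated_exp _ (nrm M)) => [|k]; first exact: nrm_ge0.
  apply: le_trans (Re_le_cabs _) _; apply: le_trans (cabs_le_nrm _ _ _) _.
  exact: nrm_mexp_term.
have cim i j : cvgn (im i j).
  apply: (@cvg_dominated_exp _ (nrm M)) => [|k]; first exact: nrm_ge0.
  apply: le_trans (Im_le_cabs _) _; apply: le_trans (cabs_le_nrm _ _ _) _.
  exact: nrm_mexp_term.
pose L : 'M[C]_N := \matrix_(i, j) Complex (limn (re i j)) (limn (im i j)).
have reE i j n : complex.Re (mexp_partial M n i j) = re i j n.
  rewrite /mexp_partial summxE /re /series /=.
  by rewrite (big_morph _ (@ReD R) (erefl : complex.Re (0 : C) = 0)).
have imE i j n : complex.Im (mexp_partial M n i j) = im i j n.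
  rewrite /mexp_partial summxE /im /series /=.
  by rewrite (big_morph _ (@ImD R) (erefl : complex.Im (0 : C) = 0)).
exists L => e e0.
pose e' := e / ((N * N).+1%:R * 2).
have e'0 : 0 < e' by rewrite divr_gt0 // mulr_gt0.
have [n1 H1] : exists n0, forall n, (n0 <= n)%N -> forall ij : 'I_N * 'I_N,
    `|re ij.1 ij.2 n - limn (re ij.1 ij.2)| <= e'.
  by apply: uniform_index => ij; exact: cvgn_dist.
have [n2 H2] : exists n0, forall n, (n0 <= n)%N -> forall ij : 'I_N * 'I_N,
    `|im ij.1 ij.2 n - limn (im ij.1 ij.2)| <= e'.
  by apply: uniform_index => ij; exact: cvgn_dist.
exists (maxn n1 n2) => n; rewrite geq_max => /andP[nn1 nn2].
apply: le_trans (nrm_le_entries _) _.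
apply: (@le_trans _ _ (\sum_(i < N) \sum_(j < N) (e' * 2))).
  apply: ler_sum => i _; apply: ler_sum => j _.
  apply: le_trans (cabs_le _) _; rewrite [_ * 2]mulr_natr mulr2n lerD //.
    by have := H1 n nn1 (i, j); rewrite !mxE ReD -reE.
  by have := H2 n nn2 (i, j); rewrite !mxE ImD -imE.
rewrite !sumr_const !card_ord -mulrnA -(mulr_natr (e' * 2)).
have -> : e' * 2 * (N * N)%:R = e * ((N * N)%:R / (N * N).+1%:R).
  rewrite /e'; have : (N * N).+1%:R != 0 :> R by rewrite pnatr_eq0.
  by move: ((N * N).+1%:R : R) ((N * N)%:R : R) => b c b0; field.
rewrite ler_piMr ?(ltW e0) // ler_pdivrMr ?mul1r ?ltr0n // ler_nat.
exact: leqnSn.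
Qed.

Lemma mexp_cvg (M : 'M[C]_N) (e : R) : 0 < e ->
  exists n0, forall n, (n0 <= n)%N -> nrm (mexp_partial M n - mexp M) <= e.
Proof.
have [L HL] := mexp_partial_cvg M; suff -> : mexp M = L by exact: HL.
apply: cvg_lim; first exact: norm_hausdorff.
(* The radius is a positive element of [Cx R], that is, one with zero imaginary part and positive
   real part. *)
apply/cvgrPdist_le => -[a b] ab0.
have [b0 a0] : b = 0 /\ 0 < a by move: ab0; rewrite ltcE /= => /andP[/eqP -> ->].
have [n0 H] := HL a a0; exists n0 => // n /= nn.
apply: le_trans (mx_norm_le_nrm _) _; rewrite b0 nrmBC.
by rewrite (_ : Complex a 0 = real_Cx a) // real_Cx_le; exact: H.
Qed.

End MatrixTopology.

(** * Dini-type comparison and calculus of matrix-valued functions *)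

Ltac mx_ring := apply/matrixP => ? ?; rewrite !mxE; ring.

Section Dini.
Variable R : realType.
Implicit Types (psi phi : R -> R) (t : R).
Local Open Scope classical_set_scope.

(** Consider the supremum of the initial segments on which [P] holds: the limit hypothesis reaches
    it, and the step hypothesis passes it unless it is [t]. *)
Lemma real_induction (P : R -> Prop) t : 0 <= t -> P 0 ->
  (forall c, 0 <= c < t -> P c ->
     exists2 d, 0 < d & forall h, 0 < h < d -> P (c + h)) ->
  (forall c, 0 < c <= t -> (forall s, 0 <= s < c -> P s) -> P c) -> P t.
Proof.
move=> t0 P0 Pstep Plim.
pose E := [set s | 0 <= s <= t /\ forall r, 0 <= r <= s -> P r].
have E0 : E 0.
  by split=> [|r r0]; [rewrite lexx|rewrite -(le_anti r0)].
have supE : has_sup E by split; [exists 0|exists t => s [/andP[]]].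
set c := sup E.
have c0 : 0 <= c by apply: ub_le_sup E0; exact: supE.2.
have ct : c <= t by apply: ge_sup => [|s [/andP[]]//]; exact: supE.1.
have Plt s : 0 <= s < c -> P s.
  move=> /andP[s0 sc]; have [|e [Ee1 Ee2] es] := @sup_adherent _ E (c - s) _ supE.
    by rewrite subr_gt0.
  by apply: Ee2; rewrite s0 /= ltW //; move: es; rewrite -/c opprB addrCA subrr addr0.
have Pc : P c.
  have [->//|c0'] := eqVneq c 0.
  by apply: Plim => //; rewrite ct lt0r c0' c0.
have [<-//|ctn] := eqVneq c t.
have {}ct : c < t by rewrite lt_neqAle ctn.
have [|d d0 Hd] := Pstep c _ Pc; first by rewrite c0.
pose m := Num.min (d / 2) (t - c).
have m0 : 0 < m by rewrite lt_min subr_gt0 ct divr_gt0.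
have md : m < d.
  have : m <= d / 2 by rewrite ge_min lexx.
  lra.
have mt : m <= t - c by rewrite ge_min lexx orbT.
suff : E (c + m).
  by move=> /(ub_le_sup supE.2); rewrite -/c gerDl leNgt m0.
split=> [|r /andP[r0 rc]]; first by apply/andP; split; lra.
have [rltc|cltr|->//] := ltgtP r c; first by apply: Plt; rewrite r0.
have -> : r = c + (r - c) by ring.
by apply: Hd; apply/andP; split; lra.
Qed.

(** This excludes upward jumps on arrival at [c] from the left, which is the half of continuity
    needed to pass an upper bound to the limit. *)
Definition left_lsc psi t := forall c, 0 < c <= t -> forall e, 0 < e ->
  exists2 d, 0 < d & forall h, 0 < h < d -> psi c <= psi (c - h) + e.

Lemma dini_barrier psi phi t : 0 <= t -> left_lsc psi t ->
  (forall x y, 0 <= x -> x <= y -> phi x <= phi y) -> psi 0 <= phi 0 ->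
  (forall c, 0 <= c < t -> psi c <= phi c ->
     exists2 d, 0 < d & forall h, 0 < h < d -> psi (c + h) <= phi (c + h)) ->
  psi t <= phi t.
Proof.
move=> t0 lsc mono le0 step.
apply: (@real_induction (fun s => psi s <= phi s)) => // c c0t H.
apply/ler_addgt0Pr => e e0; have [d d0 Hd] := lsc c c0t e e0.
have c0 : 0 < c by case/andP: c0t.
pose m := Num.min (d / 2) (c / 2).
have m0 : 0 < m by rewrite lt_min !divr_gt0.
have md : m <= d / 2 by rewrite ge_min lexx.
have mc : m <= c / 2 by rewrite ge_min lexx orbT.
have := Hd m; rewrite m0 /= => /(_ _)/le_trans; apply; first lra.
rewrite lerD2r; apply: le_trans (H _ _) (mono _ _ _ _).
- by apply/andP; split; lra.
- lra.
- lra.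
Qed.

(** [Phi] plays the part of a primitive of [phi]; the supergradient inequality replaces integration
    and is elementary for the monomials used later. The barrier has an extra slope [e], which is
    then sent to 0. *)
Lemma dini_integral psi (Phi phi : R -> R) t : 0 <= t -> left_lsc psi t ->
  (forall x y, 0 <= x -> x <= y -> Phi x <= Phi y) ->
  (forall c h, 0 <= c -> 0 <= h -> Phi c + h * phi c <= Phi (c + h)) ->
  (forall c, 0 <= c < t -> forall e, 0 < e -> exists2 d, 0 < d &
     forall h, 0 < h < d -> psi (c + h) <= psi c + h * (phi c + e)) ->
  psi t <= psi 0 + (Phi t - Phi 0).
Proof.
move=> t0 lsc mono sup step.
suff H e : 0 < e -> psi t <= psi 0 + (Phi t - Phi 0) + e * t.
  apply/ler_addgt0Pr => e e0.
  have d0 : 0 < e / (t + 1) by apply: divr_gt0 => //; lra.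
  apply: le_trans (H _ d0) _; rewrite lerD2l -mulrAC ler_pdivrMr; nra.
move=> e0.
apply: (@dini_barrier psi (fun s => psi 0 + (Phi s - Phi 0) + e * s)) => //.
- move=> x y x0 xy; have := mono x y x0 xy; nra.
- by rewrite subrr mulr0 !addr0.
move=> c ct H; have [d d0 Hd] := step c ct e e0; exists d => // h hd.
apply: le_trans (Hd h hd) _.
by have := sup c h; have := hd; case/andP: ct; case/andP: hd => *; nra.
Qed.

Lemma dini_gronwall psi (K : R) t : 0 <= t -> 0 <= K -> left_lsc psi t ->
  0 <= psi 0 ->
  (forall c, 0 <= c < t -> forall e, 0 < e -> exists2 d, 0 < d &
     forall h, 0 < h < d -> psi (c + h) <= (1 + K * h) * psi c + h * e) ->
  psi t <= psi 0 * expR ((K + 1) * t).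
Proof.
move=> t0 K0 lsc psi0 step.
suff H e : 0 < e -> psi t <= (psi 0 + e) * expR ((K + 1) * t).
  apply/ler_addgt0Pr => e e0.
  have d0 : 0 < e / expR ((K + 1) * t) by rewrite divr_gt0 // expR_gt0.
  apply: le_trans (H _ d0) _; rewrite mulrDl divfK //.
  by rewrite gt_eqF // expR_gt0.
move=> e0.
(* Raising the initial value by [e] keeps [phi] above [e]; raising the rate by 1 then lets
   [h * phi c] absorb the error [h * e]. *)
pose phi s := (psi 0 + e) * expR ((K + 1) * s).
have phi_mono x y : 0 <= x -> x <= y -> phi x <= phi y.
  by move=> x0 xy; rewrite ler_wpM2l ?addr_ge0 ?(ltW e0) // ler_expR ler_wpM2l // addr_ge0.
have phi0 : phi 0 = psi 0 + e by rewrite /phi mulr0 expR0 mulr1.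
apply: (@dini_barrier psi phi) => //; first by rewrite phi0 lerDl ltW.
move=> c ct H; have [d d0 Hd] := step c ct e e0; exists d => // h hd.
apply: le_trans (Hd h hd) _.
have c0 : 0 <= c by case/andP: ct.
have h0 : 0 < h by case/andP: hd.
have phic : e <= phi c.
  by apply: le_trans (phi_mono 0 c _ c0) => //; rewrite phi0 lerDr.
have -> : phi (c + h) = phi c * expR ((K + 1) * h).
  by rewrite /phi mulrDr expRD mulrA.
apply: (@le_trans _ _ (phi c * (1 + (K + 1) * h))).
  have : (1 + K * h) * psi c <= (1 + K * h) * phi c.
    by rewrite ler_wpM2l // addr_ge0 // mulr_ge0 // ltW.
  have : h * e <= h * phi c by rewrite ler_wpM2l // ltW.
  by move: (phi c) (psi c) => x y; nra.
by rewrite ler_wpM2l ?expR_ge1Dx // (le_trans _ phic) // ltW.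
Qed.

End Dini.

(** * Mean value inequalities for seminorms, and rules of differentiation *)

Section MatrixCalculus.
Variables (R : realType) (N : nat).
Local Notation C := (Cx R).
Local Notation M_ := 'M[C]_N.
Local Notation nrm := (@opnorm R N).
Implicit Types (F G : R -> M_) (A B D X Z W : M_).

(** The bound by a multiple of the operator norm serves as continuity; the multiple [K] may depend
    on the dimension. *)
Definition seminorm (f : M_ -> R) : Prop :=
  [/\ forall A B, f (A + B) <= f A + f B,
      forall (a : R) A, f (real_Cx a *: A) <= `|a| * f A &
      exists2 K, 0 <= K & forall A, f A <= K * nrm A].

Lemma seminorm_opnorm : seminorm nrm.
Proof.
split; [exact: nrm_triangle|by move=> a A; rewrite nrmZr|].
by exists 1 => // A; rewrite mul1r.
Qed.

Lemma seminormN f A : seminorm f -> f (- A) <= f A.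
Proof.
case=> _ fZ _; have := fZ (-1) A.
by rewrite real_CxN real_Cx1 scaleN1r normrN normr1 mul1r.
Qed.

Lemma seminormB f A B : seminorm f -> f (A - B) <= f A + f B.
Proof.
move=> sf; have [fD _ _] := sf; apply: le_trans (fD _ _) _.
by rewrite lerD2l; exact: seminormN.
Qed.

Lemma seminorm0 f : seminorm f -> f 0 = 0.
Proof.
move=> sf; have [fD fZ [K K0 fK]] := sf; apply: le_anti.
have := fK 0; rewrite nrm0 mulr0 => -> /=.
have := fD 0 0; rewrite addr0; move: (f 0) => x; lra.
Qed.

Lemma seminorm_ge0 f A : seminorm f -> 0 <= f A.
Proof.
move=> sf; have := seminormB A A sf; rewrite subrr (seminorm0 sf).
by move: (f A) => x; lra.
Qed.

Lemma seminorm_sum f (I : Type) (r : seq I) (P : pred I) (H : I -> M_) :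
  seminorm f ->
  f (\sum_(i <- r | P i) H i) <= \sum_(i <- r | P i) f (H i).
Proof.
move=> sf; have [fD _ _] := sf.
elim/big_ind2: _ => [|x1 x2 y1 y2 h1 h2|//]; first by rewrite (seminorm0 sf).
exact: le_trans (fD _ _) (lerD _ _).
Qed.

Lemma mderiv_lsc f F (F' : R -> M_) t A : seminorm f ->
  (forall s, 0 <= s <= t -> mderiv F s (F' s)) ->
  left_lsc (fun s => f (F s - A)) t.
Proof.
move=> sf FF' c /andP[c0 ct] e e0; have [fD _ [K K0 fK]] := sf.
have e'0 : 0 < e / (K + 1) by apply: divr_gt0 => //; rewrite ltr_wpDl.
have cc : 0 <= c <= t by rewrite ct ltW.
have [d d0 Hd] := mderiv_cont (FF' c cc) e'0; exists d => // h /andP[h0 hd].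
have := Hd (- h); rewrite normrN gtr0_norm // => /(_ hd) H.
have -> : F c - A = (F (c - h) - A) - (F (c - h) - F c).
  by mx_ring.
apply: le_trans (seminormB _ _ sf) _; rewrite lerD2l.
apply: le_trans (fK _) _; apply: le_trans (ler_wpM2l K0 H) _.
rewrite mulrCA ler_piMr ?(ltW e0) // ler_pdivrMr ?mul1r ?ltr_wpDl //.
by rewrite lerDl.
Qed.

(** The remainder of a step is measured through [K], but it is [o(h)]; hence integrating in time
    costs no factor [K], and locality norms are integrated without loss. *)
Lemma mvt f F (F' : R -> M_) (Phi phi : R -> R) t : seminorm f -> 0 <= t ->
  (forall s, 0 <= s <= t -> mderiv F s (F' s)) ->
  (forall x y, 0 <= x -> x <= y -> Phi x <= Phi y) ->
  (forall c h, 0 <= c -> 0 <= h -> Phi c + h * phi c <= Phi (c + h)) ->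
  (forall s, 0 <= s <= t -> f (F' s) <= phi s) ->
  f (F t - F 0) <= Phi t - Phi 0.
Proof.
move=> sf t0 FF' mono sup Hphi; have [fD fZ [K K0 fK]] := sf.
have := @dini_integral R (fun s => f (F s - F 0)) Phi phi t t0.
rewrite subrr (seminorm0 sf) add0r; apply => //; first exact: mderiv_lsc FF'.
move=> c /andP[c0 ct] e e0.
have cc : 0 <= c <= t by rewrite c0 ltW.
have e'0 : 0 < e / (K + 1) by apply: divr_gt0 => //; rewrite ltr_wpDl.
have [d d0 Hd] := FF' c cc _ e'0; exists d => // h /andP[h0 hd].
have := Hd h; rewrite gtr0_norm // => /(_ hd) H.
have -> : F (c + h) - F 0 = (F c - F 0) + real_Cx h *: F' c +
    (F (c + h) - F c - real_Cx h *: F' c).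
  by mx_ring.
apply: le_trans (fD _ _) _; rewrite mulrDr addrA lerD //.
  apply: le_trans (fD _ _) _; rewrite lerD2l; apply: le_trans (fZ _ _) _.
  by rewrite gtr0_norm // ler_wpM2l ?Hphi // ltW.
apply: le_trans (fK _) _; apply: le_trans (ler_wpM2l K0 H) _.
rewrite mulrA [h * e]mulrC ler_wpM2r ?(ltW h0) //.
rewrite mulrCA ler_piMr ?(ltW e0) // ler_pdivrMr ?mul1r ?ltr_wpDl //.
by rewrite lerDl.
Qed.

Lemma mvt_cst F (F' : R -> M_) (k t : R) : 0 <= t -> 0 <= k ->
  (forall s, 0 <= s <= t -> mderiv F s (F' s)) ->
  (forall s, 0 <= s <= t -> nrm (F' s) <= k) ->
  nrm (F t - F 0) <= k * t.
Proof.
move=> t0 k0 FF' H.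
have := @mvt nrm F F' (fun s => k * s) (fun=> k) t seminorm_opnorm t0 FF'.
rewrite mulr0 subr0; apply => //.
- by move=> x y _ xy; rewrite ler_wpM2l.
- by move=> c h _ _; rewrite mulrDr (mulrC h).
Qed.

Lemma mderiv_zero F t : 0 <= t -> (forall s, 0 <= s <= t -> mderiv F s 0) ->
  F t = F 0.
Proof.
move=> t0 F0; apply/eqP; rewrite -subr_eq0; apply/eqP/nrm_eq0.
have := @mvt_cst F (fun=> 0) 0 t t0 (lexx _) F0; rewrite mul0r; apply=> s _.
by rewrite nrm0.
Qed.

Lemma mderiv_ext F G t D : (forall s, F s = G s) -> mderiv F t D -> mderiv G t D.
Proof. by move=> /funext ->. Qed.

Lemma mderiv_cst A t : mderiv (fun=> A) t 0.
Proof.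
move=> e e0; exists 1 => // h _.
by rewrite subrr sub0r scaler0 oppr0 nrm0 mulr_ge0 // ltW.
Qed.

Lemma mderivD F G t A B :
  mderiv F t A -> mderiv G t B -> mderiv (fun s => F s + G s) t (A + B).
Proof.
move=> FA GB e e0; have e20 : 0 < e / 2 by rewrite divr_gt0.
have [d1 d10 H1] := FA _ e20; have [d2 d20 H2] := GB _ e20.
exists (Num.min d1 d2); first by rewrite lt_min d10.
move=> h; rewrite lt_min => /andP[hd1 hd2].
have -> : F (t + h) + G (t + h) - (F t + G t) - real_Cx h *: (A + B) =
    (F (t + h) - F t - real_Cx h *: A) + (G (t + h) - G t - real_Cx h *: B).
  by mx_ring.
apply: le_trans (nrm_triangle _ _) _.
by have := H1 h hd1; have := H2 h hd2; lra.
Qed.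

Lemma mderiv_linear (L : M_ -> M_) (K : R) F t A : 0 <= K ->
  (forall A B, L (A - B) = L A - L B) ->
  (forall (a : R) A, L (real_Cx a *: A) = real_Cx a *: L A) ->
  (forall A, nrm (L A) <= K * nrm A) ->
  mderiv F t A -> mderiv (fun s => L (F s)) t (L A).
Proof.
move=> K0 LB LZ LK FA e e0.
have e'0 : 0 < e / (K + 1) by apply: divr_gt0 => //; rewrite ltr_wpDl.
have [d d0 Hd] := FA _ e'0; exists d => // h hd.
rewrite -LZ -!LB; apply: le_trans (LK _) _.
apply: le_trans (ler_wpM2l K0 (Hd h hd)) _; rewrite mulrA ler_wpM2r //.
rewrite mulrCA ler_piMr ?(ltW e0) // ler_pdivrMr ?mul1r ?ltr_wpDl //.
by rewrite lerDl.
Qed.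

Lemma mderivZ c F t A : mderiv F t A -> mderiv (fun s => c *: F s) t (c *: A).
Proof.
apply: (@mderiv_linear (fun X => c *: X) (cabs c)); first exact: cabs_ge0.
- by move=> X Y; rewrite scalerBr.
- by move=> a X; rewrite !scalerA mulrC.
- by move=> X; rewrite nrmZ.
Qed.

Lemma mderivN F t A : mderiv F t A -> mderiv (fun s => - F s) t (- A).
Proof.
move=> FA; rewrite -scaleN1r; apply: mderiv_ext (mderivZ (-1) FA) => s.
by rewrite scaleN1r.
Qed.

Lemma mderivB F G t A B :
  mderiv F t A -> mderiv G t B -> mderiv (fun s => F s - G s) t (A - B).
Proof. by move=> FA /mderivN GB; exact: mderivD. Qed.

Lemma mderiv_adj F t A : mderiv F t A -> mderiv (fun s => adjm (F s)) t (adjm A).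
Proof.
apply: (@mderiv_linear (fun X => adjm X) 1) => //.
- by move=> X Y; rewrite adjmB.
- by move=> a X; rewrite adjmZ conj_real.
- by move=> X; rewrite nrm_adj mul1r.
Qed.

Lemma mderiv_sum (I : Type) (r : seq I) (P : pred I) (F : I -> R -> M_) t
    (A : I -> M_) : (forall i, P i -> mderiv (F i) t (A i)) ->
  mderiv (fun s => \sum_(i <- r | P i) F i s) t (\sum_(i <- r | P i) A i).
Proof.
move=> H; elim: r => [|i r IH].
  by rewrite big_nil; apply: mderiv_ext (mderiv_cst 0 t) => s; rewrite big_nil.
rewrite big_cons; case: ifP => Pi.
  by apply: mderiv_ext (mderivD (H i Pi) IH) => s; rewrite big_cons Pi.
by apply: mderiv_ext IH => s; rewrite big_cons Pi.
Qed.

Lemma mderivM F G t A B : mderiv F t A -> mderiv G t B ->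
  mderiv (fun s => F s *m G s) t (A *m G t + F t *m B).
Proof.
move=> FA GB e e0.
pose K := nrm A + nrm (F t) + nrm (G t) + 2.
have K0 : 0 < K by rewrite ltr_wpDl // !addr_ge0 ?nrm_ge0.
pose e1 := Num.min 1 (e / (2 * K)).
have e10 : 0 < e1 by rewrite lt_min ltr01 divr_gt0 // mulr_gt0.
have [d1 d10 H1] := FA _ e10; have [d2 d20 H2] := GB _ e10.
have [d3 d30 H3] := mderiv_cont GB e10.
exists (Num.min d1 (Num.min d2 d3)); first by rewrite !lt_min d10 d20.
move=> h; rewrite !lt_min => /and3P[hd1 hd2 hd3].
have -> : F (t + h) *m G (t + h) - F t *m G t -
    real_Cx h *: (A *m G t + F t *m B) =
    (F (t + h) - F t - real_Cx h *: A) *m G (t + h)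
    + F t *m (G (t + h) - G t - real_Cx h *: B)
    + real_Cx h *: (A *m (G (t + h) - G t)).
  rewrite !mulmxBl !mulmxBr scalerDr scalerBr -!scalemxAl -!scalemxAr.
  move: (F (t + h) *m _) (F t *m G t) (F t *m G (t + h)) => x y z.
  move: (real_Cx h *: (A *m G t)) (real_Cx h *: (F t *m B)) => a b.
  move: (real_Cx h *: (A *m G (t + h))) => c.
  by mx_ring.
have Gth : nrm (G (t + h)) <= nrm (G t) + 1.
  have -> : G (t + h) = G t + (G (t + h) - G t) by rewrite addrCA subrr addr0.
  apply: le_trans (nrm_triangle _ _) _; rewrite lerD2l.
  by apply: le_trans (H3 h hd3) _; rewrite ge_min lexx.
apply: le_trans (nrm_triangle _ _) _.
have e1K : e1 * K <= e.
  rewrite -ler_pdivlMr //; apply: (@le_trans _ _ (e / (2 * K))).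
    by rewrite ge_min lexx orbT.
  by rewrite invfM mulrCA mulrC; apply: ler_piMr; [rewrite divr_ge0 // ltW|lra].
apply: (@le_trans _ _ ((e1 * `|h|) * (nrm (G t) + 1) + nrm (F t) * (e1 * `|h|)
    + `|h| * (nrm A * e1))).
  apply: lerD; first apply: le_trans (nrm_triangle _ _) (lerD _ _).
  - apply: le_trans (nrmM _ _) (ler_pM _ _ _ _); rewrite ?nrm_ge0 //.
    exact: H1.
  - by apply: le_trans (nrmM _ _) (ler_wpM2l _ _); rewrite ?nrm_ge0 ?H2.
  rewrite nrmZr ler_wpM2l //; apply: le_trans (nrmM _ _) _.
  by rewrite ler_wpM2l ?nrm_ge0 ?H3.
have -> : e1 * `|h| * (nrm (G t) + 1) + nrm (F t) * (e1 * `|h|) +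
    `|h| * (nrm A * e1) = e1 * (K - 1) * `|h| by rewrite /K; ring.
rewrite ler_wpM2r //; apply: le_trans e1K; rewrite ler_wpM2l ?(ltW e10) //.
by rewrite gerDl; lra.
Qed.

Lemma mderivMr A F t B : mderiv F t B -> mderiv (fun s => F s *m A) t (B *m A).
Proof. by move=> FB; have := mderivM FB (mderiv_cst A t); rewrite mulmx0 addr0. Qed.

Lemma mderiv_id A t : mderiv (fun s => real_Cx s *: A) t A.
Proof.
move=> e e0; exists 1 => // h _.
have -> : real_Cx (t + h) *: A - real_Cx t *: A - real_Cx h *: A = 0.
  by rewrite real_CxD; move: (real_Cx t) (real_Cx h) => a b; mx_ring.
by rewrite nrm0 mulr_ge0 // ltW.
Qed.

Lemma mderiv_pow A k t : mderiv (fun s => real_Cx (s ^+ k) *: A) t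
  (real_Cx (k%:R * t ^+ k.-1) *: A).
Proof.
elim: k => [|k IH].
  by rewrite mul0r real_Cx0 scale0r; apply: mderiv_ext (mderiv_cst A t) => s;
    rewrite expr0 real_Cx1 scale1r.
have := mderivM (mderiv_id 1%:M t) IH.
rewrite mul1mx -scalemxAl mul1mx scalerA -scalerDl -real_CxM -real_CxD.
have -> : t ^+ k + t * (k%:R * t ^+ k.-1) = k.+1%:R * t ^+ k.
  case: k {IH} => [|k]; first by rewrite mul0r mulr0 addr0 mul1r.
  by rewrite /= exprS -(natr1 k.+1); ring.
apply: mderiv_ext => s.
by rewrite -scalemxAl mul1mx scalerA -real_CxM -exprS.
Qed.

End MatrixCalculus.

(** * The matrix exponential and its increments *)

Section Exponential.
Variables (R : realType) (N : nat).
Local Notation C := (Cx R).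
Local Notation M_ := 'M[C]_N.
Local Notation nrm := (@opnorm R N).
Implicit Types (F G : R -> M_) (A B D X Z W : M_).

Definition expm A : M_ := locked (@mexp R N) A.

Lemma expmE A : expm A = mexp A.
Proof. by rewrite /expm -lock. Qed.

Lemma expm_lim A (e : R) : 0 < e ->
  exists n0, forall n, (n0 <= n)%N -> nrm (mexp_partial A n - expm A) <= e.
Proof. by rewrite expmE; exact: mexp_cvg. Qed.

Lemma nrm_small_eq A B : (forall e : R, 0 < e -> nrm (A - B) <= e) -> A = B.
Proof.
move=> H; apply/eqP; rewrite -subr_eq0; apply/eqP/nrm_eq0.
by apply/ler_addgt0Pr => e e0; rewrite add0r H.
Qed.

Lemma mexp_partialS A n :
  mexp_partial A n.+1 = mexp_partial A n + (n`!%:R)^-1 *: A ^+ n.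
Proof. by rewrite /mexp_partial big_nat_recr. Qed.

Lemma mexp_partial0 A : mexp_partial A 0 = 0.
Proof. by rewrite /mexp_partial big_geq. Qed.

Lemma expm0 : expm 0 = 1%:M.
Proof.
apply: nrm_small_eq => e e0; have [n0 H] := expm_lim 0 e0.
have := H n0.+1 (leqnSn n0); rewrite nrmBC (_ : mexp_partial 0 n0.+1 = 1%:M) //.
elim: n0 {H} => [|n IH].
  by rewrite mexp_partialS mexp_partial0 add0r expr0 invr1 scale1r.
by rewrite mexp_partialS IH expr0n /= scaler0 addr0.
Qed.

Lemma expm_adj A : adjm (expm A) = expm (adjm A).
Proof.
have pE n : adjm (mexp_partial A n) = mexp_partial (adjm A) n.
  rewrite adjm_sum; apply: eq_bigr => k _; rewrite adjmZ.
  rewrite -real_Cx_nat -real_CxV conj_real; congr (_ *: _).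
  elim: k => [|k IH]; first by rewrite !expr0; exact: adjm1.
  by rewrite exprS exprSr adjmM IH.
apply: nrm_small_eq => e e0.
have e20 : 0 < e / 2 by rewrite divr_gt0.
have [n1 H1] := expm_lim A e20; have [n2 H2] := expm_lim (adjm A) e20.
have := H2 _ (leq_maxr n1 n2); have := H1 _ (leq_maxl n1 n2).
set n := maxn n1 n2; rewrite -nrm_adj adjmB pE => h1 h2.
have -> : adjm (expm A) - expm (adjm A) =
  (mexp_partial (adjm A) n - expm (adjm A)) - (mexp_partial (adjm A) n - adjm (expm A)).
  by mx_ring.
by apply: le_trans (nrmB _ _) _; lra.
Qed.

Lemma expm_comm A X : X *m A = A *m X -> X *m expm A = expm A *m X.
Proof.
move=> XA.
have pE n : X *m mexp_partial A n = mexp_partial A n *m X.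
  rewrite mulmx_sumr mulmx_suml; apply: eq_bigr => k _.
  rewrite -scalemxAl -scalemxAr; congr (_ *: _).
  elim: k => [|k IH]; first by rewrite expr0 mulmx1 mul1mx.
  by rewrite exprS -[(A * _) *m X]mulmxA -IH [X *m (A *m _)]mulmxA XA mulmxA.
apply: nrm_small_eq => e e0.
have K0 : 0 < 2 * nrm X + 1 by rewrite ltr_wpDl // mulr_ge0 // nrm_ge0.
have e20 : 0 < e / (2 * nrm X + 1) by rewrite divr_gt0.
have [n H] := expm_lim A e20; have {}H := H n (leqnn n).
have -> : X *m expm A - expm A *m X =
  (mexp_partial A n - expm A) *m X - X *m (mexp_partial A n - expm A).
  rewrite mulmxBl mulmxBr pE.
  by move: (X *m expm A) (expm A *m X) (_ *m X) => x y z; mx_ring.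
apply: le_trans (nrmB _ _) _; apply: le_trans (lerD (nrmM _ _) (nrmM _ _)) _.
rewrite ler_pdivlMr // in H; move: H (nrm_ge0 X) (nrm_ge0 (mexp_partial A n - expm A)).
by move: (nrm X) (nrm _) => x y; nra.
Qed.

(* The remainder [(s+h)^k - s^k - k h s^(k-1)] of order [h^2]. *)
Lemma pow_remainder (s h a : R) k : 1 <= a -> `|s| <= a -> `|s + h| <= a ->
  `|(s + h) ^+ k - s ^+ k - k%:R * h * s ^+ k.-1| <= h ^+ 2 * (2 * a) ^+ k.
Proof.
move=> a1 sa sha; have a0 : 0 <= a by apply: le_trans a1.
elim: k => [|k IH].
  by rewrite !expr0 mul0r mul0r subrr subr0 normr0 mulr1 sqr_ge0.
have -> : (s + h) ^+ k.+1 - s ^+ k.+1 - k.+1%:R * h * s ^+ k.+1.-1 =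
    (s + h) * ((s + h) ^+ k - s ^+ k - k%:R * h * s ^+ k.-1) +
    h ^+ 2 * (k%:R * s ^+ k.-1).
  rewrite /= -natr1; case: k {IH} => [|k] /=; first by rewrite !expr0 !expr1; ring.
  by rewrite !(exprS _ k.+1) !(exprS _ k); ring.
apply: le_trans (ler_normD _ _) _; rewrite normrM [`|h ^+ 2 * _|]normrM.
rewrite [`|h ^+ 2|]ger0_norm ?sqr_ge0 // (exprS (2 * a)).
have -> : h ^+ 2 * (2 * a * (2 * a) ^+ k) =
  a * (h ^+ 2 * (2 * a) ^+ k) + h ^+ 2 * (a * (2 * a) ^+ k) by ring.
apply: lerD; first by apply: ler_pM.
rewrite ler_wpM2l ?sqr_ge0 // normrM normr_nat normrX exprMn mulrCA.
apply: ler_pM; rewrite ?exprn_ge0 //.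
  by rewrite -natrX ler_nat ltnW // ltn_expl.
rewrite -exprS; apply: le_trans (_ : a ^+ k.-1 <= _).
  by apply: lerXn2r; rewrite ?nnegrE.
by apply: ler_weXn2l => //; apply: leq_trans (leq_pred k) _.
Qed.

Lemma series_exp_le (x : R) n : 0 <= x ->
  \sum_(0 <= k < n) exp_coeff x k <= expR x.
Proof.
move=> x0; apply: (nondecreasing_cvgn_le _ (is_cvg_series_exp_coeff x)).
by apply/nondecreasing_seqP => k; rewrite /series /= big_nat_recr //= lerDl exp_coeff_ge0.
Qed.

Lemma exprZmx (a : C) A k : (a *: A) ^+ k = a ^+ k *: A ^+ k.
Proof.
elim: k => [|k IH]; first by rewrite !expr0 scale1r.
by rewrite exprS IH exprS exprS; rewrite -[LHS]/(_ *m _) -scalemxAl -scalemxAr scalerA.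
Qed.

(** Differentiating a partial sum lowers its length by one. The bound is uniform in [n], so it
    survives the passage to the exponential. *)
Lemma mexp_partial_diff A (s h a : R) n :
  1 <= a -> `|s| <= a -> `|s + h| <= a ->
  nrm (mexp_partial (real_Cx (s + h) *: A) n.+1 -
       mexp_partial (real_Cx s *: A) n.+1 -
       real_Cx h *: (A *m mexp_partial (real_Cx s *: A) n)) <=
    h ^+ 2 * expR (2 * a * nrm A).
Proof.
move=> a1 sa sha; have a0 : 0 <= a by apply: le_trans a1.
pose r k : R := (s + h) ^+ k - s ^+ k - k%:R * h * s ^+ k.-1.
pose p (x : R) k := mexp_partial (real_Cx x *: A) k.
have pS x k : p x k.+1 = p x k + real_Cx (x ^+ k / k`!%:R) *: A ^+ k.
  rewrite /p mexp_partialS exprZmx scalerA; congr (_ + _ *: _).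
  by rewrite mulrC real_CxM real_CxV real_Cx_nat real_CxX.
have p0 x : p x 0%N = 0 by rewrite /p mexp_partial0.
pose w k := A ^+ k; have wS k : w k.+1 = A *m w k by exact: exprS.
have -> : p (s + h) n.+1 - p s n.+1 - real_Cx h *: (A *m p s n) =
   \sum_(0 <= k < n.+1) real_Cx (r k / k`!%:R) *: w k.
  have {pS} : forall x k, p x k.+1 = p x k + real_Cx (x ^+ k / k`!%:R) *: w k by exact: pS.
  move: p w p0 wS => p w p0 wS pS.
  elim: n => [|n IH].
    rewrite !pS !p0 mulmx0 scaler0 subr0 !add0r !expr0 subrr.
    by rewrite big_nat1 /r !expr0 !mul0r subrr subr0 mul0r real_Cx0 scale0r.
  have hAp : real_Cx h *: (A *m p s n.+1) = real_Cx h *: (A *m p s n) +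
      real_Cx (n.+1%:R * h * s ^+ n / (n.+1)`!%:R) *: w n.+1.
    rewrite pS mulmxDr scalerDr -scalemxAr scalerA -real_CxM wS.
    congr (_ + real_Cx _ *: _); rewrite factS natrM.
    have : n.+1%:R != 0 :> R by rewrite pnatr_eq0.
    have : n`!%:R != 0 :> R by rewrite pnatr_eq0 -lt0n fact_gt0.
    by move: (n.+1%:R : R) (n`!%:R : R) (s ^+ n) => x y z y0 x0; field; rewrite x0 y0.
  rewrite big_nat_recr; last by [].
  rewrite [LHS]/= [RHS]/= -IH hAp (pS (s + h) n.+1) (pS s n.+1).
  have -> : r n.+1 / (n.+1)`!%:R = (s + h) ^+ n.+1 / (n.+1)`!%:R
      - s ^+ n.+1 / (n.+1)`!%:R - n.+1%:R * h * s ^+ n / (n.+1)`!%:R.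
    by rewrite /r !mulrBl.
  move: ((s + h) ^+ n.+1 / _) (s ^+ n.+1 / _) (n.+1%:R * h * s ^+ n / _) => b c d.
  rewrite !real_CxB; move: (real_Cx b) (real_Cx c) (real_Cx d) => {}b {}c {}d.
  move: (p (s + h) _) (p s _) (real_Cx h *: _) (w _) => x y z v.
  by mx_ring.
apply: le_trans (nrm_sum _ _ _) _.
apply: le_trans (ler_wpM2l (sqr_ge0 h) (@series_exp_le _ n.+1 _)); last first.
  by rewrite !mulr_ge0 // nrm_ge0.
rewrite mulr_sumr; apply: ler_sum => k _.
rewrite nrmZr normrM [`|_^-1|]ger0_norm ?invr_ge0 // /exp_coeff /=.
rewrite exprMn !mulrA mulrAC ler_wpM2r ?invr_ge0 //.
apply: ler_pM; rewrite ?nrmX // ?nrm_ge0 //.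
exact: pow_remainder.
Qed.

Lemma mderiv_expm A t :
  mderiv (fun s => expm (real_Cx s *: A)) t (A *m expm (real_Cx t *: A)).
Proof.
move=> e e0; pose a := `|t| + 1.
pose K := expR (2 * a * nrm A); have K0 : 0 < K by exact: expR_gt0.
exists (Num.min 1 (e / K)); first by rewrite lt_min ltr01 divr_gt0.
move=> h; rewrite lt_min => /andP[h1 he].
suff : nrm (expm (real_Cx (t + h) *: A) - expm (real_Cx t *: A) -
            real_Cx h *: (A *m expm (real_Cx t *: A))) <= h ^+ 2 * K.
  move/le_trans; apply; rewrite -[h ^+ 2]real_normK ?num_real // expr2 mulrAC.
  by rewrite ler_wpM2r // -ler_pdivlMr // ltW.
apply/ler_addgt0Pr => d d0.
(* Two partial sums are replaced by their limits with weight 1 and a third with weight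
   [|h| * nrm A]. *)
pose L := 2 + `|h| * nrm A.
have L0 : 0 < L by rewrite ltr_wpDr // mulr_ge0 // nrm_ge0.
have d'0 : 0 < d / L by rewrite divr_gt0.
have [n1 H1] := expm_lim (real_Cx (t + h) *: A) d'0.
have [n2 H2] := expm_lim (real_Cx t *: A) d'0.
pose n := maxn n1 n2.
have {}H1 : nrm (mexp_partial (real_Cx (t + h) *: A) n.+1 - expm (real_Cx (t + h) *: A)) <= d / L.
  by apply: H1; rewrite ltnW // ltnS leq_maxl.
have H3 : nrm (mexp_partial (real_Cx t *: A) n.+1 - expm (real_Cx t *: A)) <= d / L.
  by apply: H2; rewrite ltnW // ltnS leq_maxr.
have {}H2 : nrm (mexp_partial (real_Cx t *: A) n - expm (real_Cx t *: A)) <= d / L.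
  by apply: H2; rewrite leq_maxr.
have := @mexp_partial_diff A t h a n.
rewrite lerDr normr_ge0 lerDl ler01 => /(_ isT isT).
have -> : `|t + h| <= a by apply: le_trans (ler_normD _ _) _; rewrite lerD2l ltW.
rewrite -/K => /(_ isT).
move: H1 H2 H3.
move: (expm (real_Cx (t + h) *: A)) (expm (real_Cx t *: A)) => E1 E2.
move: (mexp_partial (real_Cx (t + h) *: A) n.+1) (mexp_partial (real_Cx t *: A) n.+1)
  (mexp_partial _ n) => S1 S2 S3.
move=> H1 H2 H3 H.
have -> : E1 - E2 - real_Cx h *: (A *m E2) =
   (S1 - S2 - real_Cx h *: (A *m S3)) - (S1 - E1) + (S2 - E2)
   + real_Cx h *: (A *m (S3 - E2)).
  rewrite mulmxBr; move: (A *m S3) (A *m E2) (real_Cx h) => x y z; mx_ring.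
apply: le_trans (nrm_triangle _ _) _; apply: le_trans (lerD (nrm_triangle _ _) (lexx _)) _.
apply: le_trans (lerD (lerD (nrmB _ _) (lexx _)) (lexx _)) _.
apply: (@le_trans _ _ (h ^+ 2 * K + d / L + d / L + `|h| * (nrm A * (d / L)))).
  apply: lerD; first by apply: lerD => //; apply: lerD.
  rewrite nrmZr ler_wpM2l //.
  by apply: le_trans (nrmM _ _) _; rewrite ler_wpM2l ?nrm_ge0.
by rewrite le_eqVlt; apply/orP; left; apply/eqP; rewrite /L; field; rewrite gt_eqF.
Qed.

(** Along [s A] the product has zero derivative, since [A] commutes with its exponential. *)
Lemma expmN A : expm A *m expm (- A) = 1%:M.
Proof.
have H s : mderiv (fun s => expm (real_Cx s *: A) *m expm (real_Cx s *: (- A))) s 0.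
  have := mderivM (mderiv_expm A s) (mderiv_expm (- A) s).
  have -> : A *m expm (real_Cx s *: A) = expm (real_Cx s *: A) *m A.
    by apply: expm_comm; rewrite -scalemxAl -scalemxAr.
  by move: (expm _) (expm _) => E E'; rewrite mulNmx mulmxN mulmxA subrr.
have := mderiv_zero ler01 (fun s _ => H s).
by rewrite real_Cx1 real_Cx0 !scale1r !scale0r !expm0 mulmx1.
Qed.

(** A step multiplies [F] by [1 + h G], whose norm is [1 + O(h^2)] by [nrm_1_skew]. Unitarity of the
    flows is used only through this contraction. *)
Lemma ode_contraction G F t : 0 <= t ->
  (forall s, 0 <= s <= t -> skew (G s)) ->
  (forall s, 0 <= s <= t -> mderiv F s (G s *m F s)) ->
  nrm (F t) <= nrm (F 0).
Proof.
move=> t0 sG FG.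
have := @dini_integral R (fun s => nrm (F s)) (fun=> 0) (fun=> 0) t t0.
rewrite subrr addr0; apply => //.
- have := @mderiv_lsc R N nrm F (fun s => G s *m F s) t 0 (seminorm_opnorm R N) FG.
  by under eq_fun do rewrite subr0.
- by move=> c h _ _; rewrite mulr0 addr0.
move=> c /andP[c0 ct] e e0.
have cc : 0 <= c <= t by rewrite c0 ltW.
have e20 : 0 < e / 2 by rewrite divr_gt0.
have [d d0 Hd] := FG c cc _ e20.
pose K := nrm (G c) ^+ 2 * nrm (F c) + 1.
have K0 : 0 < K by rewrite ltr_wpDl // mulr_ge0 ?sqr_ge0 ?nrm_ge0.
exists (Num.min d (e / 2 / K)); first by rewrite lt_min d0 divr_gt0.
move=> h /andP[h0]; rewrite lt_min => /andP[hd hK].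
have := Hd h; rewrite gtr0_norm // => /(_ hd) H.
have -> : F (c + h) = (1%:M + real_Cx h *: G c) *m F c +
    (F (c + h) - F c - real_Cx h *: (G c *m F c)).
  by rewrite mulmxDl mul1mx -scalemxAl; move: (_ *: _) => ?; mx_ring.
apply: le_trans (nrm_triangle _ _) _; apply: le_trans (lerD (nrmM _ _) H) _.
have Hs := nrm_1_skew h (sG c cc).
apply: le_trans (lerD (ler_wpM2r (nrm_ge0 _) Hs) (lexx _)) _.
rewrite add0r mulrDl mul1r -addrA lerD2l.
rewrite ltr_pdivlMr // in hK; move: hK; rewrite /K.
rewrite -mulrA; move: (nrm (G c) ^+ 2 * nrm (F c)) => x hx.
by have := ler_wpM2l (ltW h0) (ltW hx); have := sqr_ge0 h; nra.
Qed.

Lemma nrm_expm_skew A : skew A -> nrm (expm A) <= 1.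
Proof.
move=> sA.
have := @ode_contraction (fun=> A) (fun s => expm (real_Cx s *: A)) 1 ler01.
rewrite real_Cx1 real_Cx0 scale1r scale0r expm0 => H.
by apply: le_trans (H _ _) (nrm1 _ _) => // s _; exact: mderiv_expm.
Qed.

Lemma skewN A : skew A -> skew (- A).
Proof. by rewrite /skew adjmN => ->. Qed.

(** Duhamel: [e^{-sA} e^{sB}] has derivative [e^{-sA} (B - A) e^{sB}], and the outer factors are
    contractions. *)
Lemma nrm_expm_sub A B : skew A -> skew B ->
  nrm (expm B - expm A) <= nrm (B - A).
Proof.
move=> sA sB.
have -> : expm B - expm A = expm A *m (expm (- A) *m expm B - 1%:M).
  by rewrite mulmxBr mulmxA expmN mul1mx mulmx1.
apply: le_trans (nrmM _ _) _; apply: le_trans (ler_wpM2r (nrm_ge0 _) (nrm_expm_skew sA)) _.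
rewrite mul1r.
pose F s := expm (real_Cx s *: - A) *m expm (real_Cx s *: B).
have FD s : mderiv F s (expm (real_Cx s *: - A) *m (B - A) *m expm (real_Cx s *: B)).
  have := mderivM (mderiv_expm (- A) s) (mderiv_expm B s).
  have -> : - A *m expm (real_Cx s *: - A) = expm (real_Cx s *: - A) *m - A.
    by apply: expm_comm; rewrite -scalemxAl -scalemxAr.
  rewrite -mulmxA -mulmxDr -mulmxDl -mulmxA; rewrite [- A + B]addrC.
  exact.
have := @mvt_cst R N F _ (nrm (B - A)) 1 ler01 (nrm_ge0 _) (fun s _ => FD s).
rewrite {1 2}/F real_Cx0 real_Cx1 !scale1r !scale0r !expm0 mulmx1 mulr1.
apply=> s _; apply: le_trans (nrmM _ _) _.
rewrite -[leRHS]mulr1; apply: ler_pM; rewrite ?nrm_ge0 ?nrm_expm_skew //; last exact: skewZ.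
apply: le_trans (nrmM _ _) _; rewrite ler_piMl ?nrm_ge0 ?nrm_expm_skew //.
exact/skewZ/skewN.
Qed.

(** The first [q] terms of [(e^{ad Z} - 1) / ad Z] applied to [W], the series of [(e^Z)' e^{-Z}]
    when [Z' = W]. *)
Definition dexp_trunc q Z W : M_ :=
  \sum_(0 <= m < q) real_Cx (m.+1`!%:R^-1) *: iter m (mcomm Z) W.

Lemma mcommDr Z A B : mcomm Z (A + B) = mcomm Z A + mcomm Z B.
Proof.
rewrite /mcomm mulmxDl mulmxDr.
by move: (Z *m A) (Z *m B) (A *m Z) (B *m Z) => *; mx_ring.
Qed.

Lemma mcommDl Z A B : mcomm (A + B) Z = mcomm A Z + mcomm B Z.
Proof.
rewrite /mcomm mulmxDl mulmxDr.
by move: (Z *m A) (Z *m B) (A *m Z) (B *m Z) => *; mx_ring.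
Qed.

Lemma mcommZr Z c A : mcomm Z (c *: A) = c *: mcomm Z A.
Proof. by rewrite /mcomm -scalemxAl -scalemxAr -scalerBr. Qed.

Lemma mcomm0 Z : mcomm Z 0 = 0.
Proof. by rewrite /mcomm mul0mx mulmx0 subrr. Qed.

Lemma mcomm0l Z : mcomm 0 Z = 0.
Proof. by rewrite /mcomm mul0mx mulmx0 subrr. Qed.

Lemma mcomm_sumr (I : Type) (r : seq I) (P : pred I) (F : I -> M_) Z :
  mcomm Z (\sum_(i <- r | P i) F i) = \sum_(i <- r | P i) mcomm Z (F i).
Proof. by apply: (big_morph (mcomm Z)); [exact: mcommDr|exact: mcomm0]. Qed.

Lemma mcomm_suml (I : Type) (r : seq I) (P : pred I) (F : I -> M_) Z :
  mcomm (\sum_(i <- r | P i) F i) Z = \sum_(i <- r | P i) mcomm (F i) Z.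
Proof.
by apply: (big_morph (fun A => mcomm A Z)) => [A B|]; [exact: mcommDl|exact: mcomm0l].
Qed.

Lemma expm_comm_scale A s : A *m expm (real_Cx s *: A) = expm (real_Cx s *: A) *m A.
Proof. by apply: expm_comm; rewrite -scalemxAl -scalemxAr. Qed.

(* [P s] solves [P' = W + [Z, P]] up to the Taylor remainder [s^q / q! ad_Z^q W]. *)
Lemma mderiv_dexp q Z W s :
  let P s := \sum_(0 <= m < q) real_Cx (s ^+ m.+1) *:
      (real_Cx (m.+1`!%:R^-1) *: iter m (mcomm Z) W) in
  mderiv P s (W + mcomm Z (P s) -
    real_Cx (s ^+ q) *: (real_Cx (q`!%:R^-1) *: iter q (mcomm Z) W)).
Proof.
move=> P; have : mderiv P s (\sum_(0 <= m < q) real_Cx (m.+1%:R * s ^+ m.+1.-1) *: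
      (real_Cx (m.+1`!%:R^-1) *: iter m (mcomm Z) W)).
  by apply: mderiv_sum => m _; exact: mderiv_pow.
congr mderiv; rewrite /P {P}.
pose w m := iter m (mcomm Z) W; have wS m : mcomm Z (w m) = w m.+1 by [].
rewrite -/(w q) -[W in RHS]/(w 0%N).
under eq_bigr do rewrite -/(w _).
under [in RHS]eq_bigr do rewrite -/(w _).
move: w wS => w wS; elim: q => [|q IH].
  by rewrite !big_geq // expr0 invr1 real_Cx1 !scale1r mcomm0 addr0 subrr.
rewrite big_nat_recr; last by [].
rewrite [in RHS]big_nat_recr; last by [].
rewrite [LHS]/= [X in _ + mcomm Z X]/= IH mcommDr !mcommZr wS.
have -> : real_Cx (q.+1%:R * s ^+ q) *: (real_Cx (q.+1`!%:R^-1) *: w q) =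
   real_Cx (s ^+ q) *: (real_Cx (q`!%:R^-1) *: w q).
  rewrite !scalerA -!real_CxM; congr (real_Cx _ *: _).
  have : q.+1%:R != 0 :> R by rewrite pnatr_eq0.
  have : q`!%:R != 0 :> R by rewrite pnatr_eq0 -lt0n fact_gt0.
  rewrite factS natrM.
  by move: (q.+1%:R : R) (q`!%:R : R) (s ^+ q) => x y z y0 x0; field; rewrite x0 y0.
move: (mcomm _ _) (real_Cx (s ^+ q) *: _) (real_Cx (s ^+ q.+1) *: _) => x y z.
by mx_ring.
Qed.

(* [Q s = e^{-sZ} e^{s(Z+hW)} - h e^{-sZ} P(s) e^{sZ}] has derivative
   [h e^{-sZ} (W (e^{s(Z+hW)} - e^{sZ}) + s^q/q! ad_Z^q W e^{sZ})]; conjugation by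
   the unitary [e^{sZ}] costs nothing. *)
Lemma expm_increment q Z W (h : R) : skew Z -> skew W ->
  nrm (expm (Z + real_Cx h *: W) - (1%:M + real_Cx h *: dexp_trunc q Z W) *m expm Z)
  <= `|h| * (`|h| * nrm W ^+ 2 + nrm (iter q (mcomm Z) W)).
Proof.
move=> sZ sW; pose V := Z + real_Cx h *: W.
have sV : skew V by apply: skewD => //; exact: skewZ.
pose P s := \sum_(0 <= m < q) real_Cx (s ^+ m.+1) *:
      (real_Cx (m.+1`!%:R^-1) *: iter m (mcomm Z) W).
have P0 : P 0 = 0.
  by rewrite /P big1 // => m _; rewrite exprS mul0r real_Cx0 scale0r.
have P1 : P 1 = dexp_trunc q Z W.
  by apply: eq_bigr => m _; rewrite expr1n real_Cx1 scale1r.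
pose E A s := expm (real_Cx s *: A).
pose rem s := real_Cx (s ^+ q) *: (real_Cx (q`!%:R^-1) *: iter q (mcomm Z) W).
pose Q s := E (- Z) s *m (E V s - real_Cx h *: (P s *m E Z s)).
have QD s : mderiv Q s
   (real_Cx h *: (E (- Z) s *m (W *m (E V s - E Z s) + rem s *m E Z s))).
  have PD : mderiv P s (W + mcomm Z (P s) - rem s) := mderiv_dexp q Z W s.
  have := mderivM (mderiv_expm (- Z) s) (mderivB (mderiv_expm V s)
     (mderivZ (real_Cx h) (mderivM PD (mderiv_expm Z s)))).
  rewrite (expm_comm_scale (- Z)); congr mderiv.
  rewrite -/(E V s) -/(E Z s) -/(E (- Z) s) -/(P s).
  have alg (EN EV EZ p r : M_) (a : C) :
     EN *m - Z *m (EV - a *: (p *m EZ)) + EN *m ((Z + a *: W) *m EV -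
       a *: ((W + mcomm Z p - r) *m EZ + p *m (Z *m EZ))) =
     a *: (EN *m (W *m (EV - EZ) + r *m EZ)).
    rewrite -mulmxA -mulmxDr [RHS]scalemxAr; congr (_ *m _); rewrite /mcomm.
    rewrite !mulmxBr !mulmxDl !mulNmx -!scalemxAl -!scalemxAr !mulmxA.
    move: (Z *m EV) (W *m EV) (Z *m p *m EZ) (p *m Z *m EZ) (W *m EZ) (r *m EZ) => *.
    by mx_ring.
  exact: alg.
have := @mvt_cst R N Q _ (`|h| * (`|h| * nrm W ^+ 2 + nrm (iter q (mcomm Z) W))) 1
   ler01 _ (fun s _ => QD s).
rewrite mulr1 => /(_ _ _)/(le_trans _); apply.
- have -> : expm V - (1%:M + real_Cx h *: dexp_trunc q Z W) *m expm Z =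
     expm Z *m (Q 1 - Q 0).
    rewrite /Q /E !real_Cx1 !real_Cx0 !scale1r !scale0r !expm0 P0 P1 mul0mx.
    rewrite scaler0 subr0 mulmx1 mulmxBr mulmxA expmN mul1mx mulmx1.
    rewrite mulmxDl mul1mx -scalemxAl.
    by move: (_ *: _) => ?; mx_ring.
  apply: le_trans (nrmM _ _) _.
  by rewrite ler_piMl ?nrm_ge0 ?nrm_expm_skew.
- by rewrite mulr_ge0 // addr_ge0 ?mulr_ge0 ?sqr_ge0 ?nrm_ge0.
move=> s /andP[s0 s1]; rewrite nrmZr ler_wpM2l //.
have unit1 X : skew X -> nrm (E X s) <= 1 by move=> sX; exact/nrm_expm_skew/skewZ.
apply: le_trans (nrmM _ _) _.
apply: le_trans (ler_wpM2r (nrm_ge0 _) (unit1 _ (skewN sZ))) _; rewrite mul1r.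
apply: le_trans (nrm_triangle _ _) _; apply: lerD.
  apply: le_trans (nrmM _ _) _; rewrite expr2 mulrCA ler_wpM2l ?nrm_ge0 //.
  apply: le_trans (nrm_expm_sub (skewZ s sZ) (skewZ s sV)) _.
  rewrite -scalerBr (_ : V - Z = real_Cx h *: W); last first.
    by rewrite /V; move: (_ *: _) => ?; mx_ring.
  by rewrite !nrmZr (ger0_norm s0) ler_piMl // mulr_ge0 // nrm_ge0.
apply: le_trans (nrmM _ _) _.
rewrite -[leRHS]mulr1; apply: ler_pM; rewrite ?nrm_ge0 ?unit1 //.
rewrite !nrmZr mulrA ler_piMl ?nrm_ge0 // mulr_ile1 //.
  by rewrite ger0_norm ?exprn_ge0 // exprn_ile1.
by rewrite ger0_norm ?invr_ge0 // invf_le1 ?ltr0n ?fact_gt0 // ler1n fact_gt0.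
Qed.

End Exponential.

(** * Comparison of the flow with the exponential of a path *)

Section Comparison.
Variables (R : realType) (N : nat).
Local Notation C := (Cx R).
Local Notation M_ := 'M[C]_N.
Local Notation nrm := (@opnorm R N).

(** Over a step the difference [Y - e^Z] is multiplied by [1 + h G], which is harmless to first
    order, and forced by [h (P - G) e^Z] plus the remainder of [expm_increment]. The accumulated
    forcing is the whole error. *)
Lemma ode_compare q (G Y Z W : R -> M_) (Phi phi : R -> R) (t : R) : 0 <= t ->
  Y 0 = 1%:M -> Z 0 = 0 ->
  (forall s, 0 <= s <= t -> mderiv Y s (G s *m Y s)) ->
  (forall s, 0 <= s <= t -> mderiv Z s (W s)) ->
  (forall s, 0 <= s <= t -> skew (G s)) ->
  (forall s, 0 <= s <= t -> skew (Z s)) ->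
  (forall s, 0 <= s <= t -> skew (W s)) ->
  (forall x y, 0 <= x -> x <= y -> Phi x <= Phi y) ->
  (forall c h, 0 <= c -> 0 <= h -> Phi c + h * phi c <= Phi (c + h)) ->
  (forall s, 0 <= s <= t ->
     nrm (dexp_trunc q (Z s) (W s) - G s) + nrm (iter q (mcomm (Z s)) (W s))
       <= phi s) ->
  nrm (Y t - expm (Z t)) <= Phi t - Phi 0.
Proof.
move=> t0 Y0 Z0 YD ZD sG sZ sW mono sup Hphi.
have := @dini_integral R (fun s => nrm (Y s - expm (Z s))) Phi phi t t0.
rewrite Y0 Z0 expm0 subrr nrm0 add0r; apply => //.
  move=> c /andP[c0 ct] e e0.
  have cc : 0 <= c <= t by rewrite ct ltW.
  have e20 : 0 < e / 2 by rewrite divr_gt0.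
  have [d1 d10 H1] := mderiv_cont (YD c cc) e20.
  have [d2 d20 H2] := mderiv_cont (ZD c cc) e20.
  exists (Num.min c (Num.min d1 d2)); first by rewrite !lt_min c0 d10.
  move=> h /andP[h0]; rewrite !lt_min => /and3P[hc hd1 hd2].
  have := H1 (- h); have := H2 (- h); rewrite normrN gtr0_norm //.
  move=> /(_ hd2) {}H2 /(_ hd1) {}H1.
  have sc : skew (Z (c - h)) by apply: sZ; apply/andP; split; lra.
  have H3 := le_trans (nrm_expm_sub (sZ c cc) sc) H2.
  have -> : Y c - expm (Z c) = (Y (c - h) - expm (Z (c - h)))
     - (Y (c - h) - Y c) + (expm (Z (c - h)) - expm (Z c)) by mx_ring.
  apply: le_trans (nrm_triangle _ _) _.
  apply: le_trans (lerD (nrmB _ _) (lexx _)) _.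
  by move: (nrm _) (nrm _) (nrm _) H1 H3 => x y z; lra.
move=> c /andP[c0 ct] e e0.
have cc : 0 <= c <= t by rewrite c0 ltW.
have e40 : 0 < e / 4 by rewrite divr_gt0.
have [d1 d10 H1] := YD c cc _ e40; have [d2 d20 H2] := ZD c cc _ e40.
(* [K] collects the coefficients of [h^2]; with [h * K < e / 2] they cost half of [e], and the two
   derivative remainders cost the other half. *)
pose K := nrm (G c) ^+ 2 * nrm (Y c - expm (Z c)) + nrm (W c) ^+ 2 + 1.
have K0 : 0 < K by rewrite ltr_wpDl // addr_ge0 // ?mulr_ge0 ?sqr_ge0 ?nrm_ge0.
exists (Num.min (t - c) (Num.min (e / 2 / K) (Num.min d1 d2))).
  by rewrite !lt_min subr_gt0 ct d10 d20 !divr_gt0.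
move=> h /andP[h0]; rewrite !lt_min => /and4P[htc hK hd1 hd2].
have := H1 h; have := H2 h; rewrite gtr0_norm // => /(_ hd2) {}H2 /(_ hd1) {}H1.
have sch : skew (Z (c + h)) by apply: sZ; apply/andP; split; lra.
have sZW : skew (Z c + real_Cx h *: W c).
  by apply: skewD; [exact: sZ|apply/skewZ/sW].
have H3 : nrm (expm (Z (c + h)) - expm (Z c + real_Cx h *: W c)) <= e / 4 * h.
  by apply: le_trans (nrm_expm_sub sZW sch) _; rewrite opprD addrA.
have H4 := expm_increment q h (sZ c cc) (sW c cc).
rewrite gtr0_norm // in H4.
have H5 := nrm_1_skew h (sG c cc).
have H6 := nrm_expm_skew (sZ c cc).
have H7 := Hphi c cc.
rewrite ltr_pdivlMr // in hK; move: hK; rewrite /K.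
set P := dexp_trunc _ _ _ in H4 H7.
set V := expm (Z c) in H4 H6 *.
set V' := expm (Z c + _) in H3 H4.
have -> : Y (c + h) - expm (Z (c + h)) = (Y (c + h) - Y c - real_Cx h *: (G c *m Y c))
   + (1%:M + real_Cx h *: G c) *m (Y c - V) - real_Cx h *: ((P - G c) *m V)
   - (V' - (1%:M + real_Cx h *: P) *m V) - (expm (Z (c + h)) - V').
  rewrite mulmxBr !mulmxDl !mul1mx mulNmx -!scalemxAl.
  move: (G c *m Y c) (G c *m V) (P *m V) (real_Cx h) => a b d x.
  by mx_ring.
move=> hK.
apply: le_trans (nrmB _ _) _; apply: le_trans (lerD (nrmB _ _) H3) _.
apply: le_trans (lerD (lerD (nrmB _ _) H4) (lexx _)) _.
apply: le_trans (lerD (lerD (lerD (nrm_triangle _ _) (lexx _)) (lexx _)) (lexx _)) _.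
have H8 : nrm ((1%:M + real_Cx h *: G c) *m (Y c - V)) <=
    (1 + h ^+ 2 * nrm (G c) ^+ 2) * nrm (Y c - V).
  by apply: le_trans (nrmM _ _) _; rewrite ler_wpM2r ?nrm_ge0.
have H9 : nrm (real_Cx h *: ((P - G c) *m V)) <= h * nrm (P - G c).
  rewrite nrmZr gtr0_norm // ler_wpM2l ?(ltW h0) //.
  by apply: le_trans (nrmM _ _) _; rewrite ler_piMr ?nrm_ge0.
apply: le_trans (lerD (lerD (lerD (lerD H1 H8) H9) (lexx _)) (lexx _)) _.
move: (nrm (G c) ^+ 2) (nrm (Y c - V)) (nrm (P - G c)) (nrm (W c) ^+ 2)
  (nrm (iter _ _ _)) (phi c) H7 hK => g y p w a f H7 hK.
have := ler_wpM2l (ltW h0) H7; have := ler_wpM2l (ltW h0) (ltW hK).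
by have := sqr_ge0 h; nra.
Qed.

End Comparison.

(** * Anti-Hermiticity of the Magnus terms *)

Section MagnusSkew.
Variables (R : realType) (N : nat).
Local Notation C := (Cx R).
Local Notation M_ := 'M[C]_N.
Implicit Types (G : R -> M_) (Om : nat -> R -> M_).

Lemma ratr_real_Cx (x : rat) : ratr x = real_Cx (ratr x) :> Cx R.
Proof. by rewrite -[RHS]/((real_complex R) (ratr x)) fmorph_rat. Qed.

(* The Taylor coefficients of [x / (e^x - 1)]. *)
Definition bern (m : nat) : R := ratr (bernoulli_number m) / m`!%:R.

Lemma magnus_rhsE G Om j t : magnus_rhs G Om j t =
  \sum_(1 <= m < j) real_Cx (bern m) *:
    \sum_(s : m.-tuple 'I_j |
            all (fun i : 'I_j => 0 < i)%N s && (\sum_(i <- s) i == j.-1)%N)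
      nested_comm [seq Om (nat_of_ord i) t | i <- s] (G t).
Proof.
apply: eq_bigr => m _; congr (_ *: _).
by rewrite ratr_real_Cx -real_Cx_nat -real_CxV -real_CxM.
Qed.

Definition magnus_deriv G Om j t : M_ :=
  if (j == 1)%N then G t else magnus_rhs G Om j t.

Lemma magnus_mderiv G Om j t : is_magnus G Om -> (1 <= j)%N ->
  mderiv (Om j) t (magnus_deriv G Om j t).
Proof.
move=> [_ H1 H2] j1; rewrite /magnus_deriv; case: eqVneq => [->|jn1].
  exact: has_derivative_mderiv.
by apply: has_derivative_mderiv; apply: H2; rewrite ltn_neqAle eq_sym jn1.
Qed.

Lemma skew_nested (s : seq M_) A :
  (forall B, B \in s -> skew B) -> skew A -> skew (nested_comm s A).
Proof.
elim: s => [//|B s IH] H sA /=; apply: skew_mcomm.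
  by apply: H; rewrite inE eqxx.
by apply: IH => // D Ds; apply: H; rewrite inE Ds orbT.
Qed.

Lemma skew_magnus_deriv G Om j t : (1 <= j)%N -> skew (G t) ->
  (forall i, (1 <= i < j)%N -> skew (Om i t)) -> skew (magnus_deriv G Om j t).
Proof.
move=> j1 sG H; rewrite /magnus_deriv; case: eqP => // _; rewrite magnus_rhsE.
apply: skew_sum => m _; apply: skewZ; apply: skew_sum => s /andP[/allP s0 _].
apply: skew_nested => // B /mapP[i si ->]; apply: H.
by rewrite ltn_ord andbT; exact: s0.
Qed.

(** By strong induction the derivative of [Om j] is anti-Hermitian, so [Om j + adjm (Om j)] is
    constant and vanishes at 0. *)
Lemma skew_magnus G Om t : is_magnus G Om ->
  (forall s, 0 <= s <= t -> skew (G s)) ->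
  forall j, (1 <= j)%N -> forall s, 0 <= s <= t -> skew (Om j s).
Proof.
move=> mag sG j; elim/ltn_ind: j => j IH j1 s /andP[s0 st].
have D r : 0 <= r <= s -> mderiv (fun r => Om j r + adjm (Om j r)) r 0.
  move=> /andP[r0 rs]; have DO := magnus_mderiv r mag j1.
  have rt : 0 <= r <= t by rewrite r0 (le_trans rs).
  have sD : skew (magnus_deriv G Om j r).
    apply: skew_magnus_deriv => // [|i /andP[i1 ij]]; first exact: sG.
    exact: IH.
  by have := mderivD DO (mderiv_adj DO); rewrite sD subrr.
have := mderiv_zero s0 D; have [-> // _ _] := mag.
by rewrite adjm0 addr0 => /eqP; rewrite addrC addr_eq0 => /eqP.
Qed.

End MagnusSkew.

(** * The Magnus recursion as an identity of graded series *)

Section NatSums.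
Variable V : zmodType.

Lemma sum_nat_cut (F : nat -> V) (a b : nat) : (a <= b)%N ->
  (forall i, (a <= i < b)%N -> F i = 0) ->
  \sum_(0 <= i < b) F i = \sum_(0 <= i < a) F i.
Proof.
move=> ab H; rewrite (big_cat_nat (n := a)) //= [X in _ + X]big_nat [X in _ + X]big1 ?addr0 // => i /H.
Qed.

Lemma sum_triangle (F : nat -> nat -> V) n :
  \sum_(0 <= k < n) \sum_(0 <= i < k.+1) F i (k - i)%N =
  \sum_(0 <= i < n) \sum_(0 <= j < n - i) F i j.
Proof.
elim: n => [|n IH]; first by rewrite !big_geq.
rewrite big_nat_recr //= IH [RHS]big_nat_recr //= subSn // subnn big_nat1.
rewrite big_nat_recr //= subnn addrA; congr (_ + _); rewrite -big_split /=.
apply: eq_big_nat => i /andP[_ ilt]; rewrite subSn ?(ltnW ilt) //.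
by rewrite big_nat_recr.
Qed.

Lemma sum_tuple_cons (T : finType) m (P : pred (seq T)) (F : seq T -> V) :
  \sum_(s : m.+1.-tuple T | P s) F s =
  \sum_(i : T) \sum_(s : m.-tuple T | P (i :: s)) F (i :: s).
Proof.
rewrite pair_big_dep /= (reindex (fun p : T * m.-tuple T => [tuple of p.1 :: p.2])) //.
exists (fun s : m.+1.-tuple T => (thead s, [tuple of behead s])).
  by move=> [i s] _ /=; rewrite theadE; congr (_, _); apply: val_inj.
by move=> s _ /=; rewrite -tuple_eta.
Qed.

End NatSums.

Section Graded.
Variables (R : realType) (N : nat).
Local Notation C := (Cx R).
Local Notation M_ := 'M[C]_N.
Implicit Types (o x y : nat -> M_) (A : M_) (Om : nat -> R -> M_).

(* A sequence [x] stands for the formal series [\sum_j lambda^j x_j]; [gconv o] is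
   the adjoint action of the series [o]. *)
Definition gconv o x (j : nat) : M_ :=
  \sum_(0 <= i < j.+1) mcomm (o i) (x (j - i)%N).

Lemma gconvE o x j :
  gconv o x j = \sum_(0 <= i < j.+1) mcomm (o i) (x (j - i)%N).
Proof. by []. Qed.

(** The generator carries one power of [lambda]: orders summing to [j - 1] in the recursion then
    give total degree [j]. *)
Definition gsingle A (j : nat) : M_ := if (j == 1)%N then A else 0.

(** The cleared degree 0 makes each adjoint action raise the degree; the cut above [q] keeps every
    sum finite. *)
Definition gtrunc q (u : nat -> M_) (i : nat) : M_ :=
  if (1 <= i <= q)%N then u i else 0.

Lemma iter_gconv_low o x m j : o 0%N = 0 -> x 0%N = 0 -> (j <= m)%N ->
  iter m (gconv o) x j = 0.
Proof.
move=> o0 x0; elim: m j => [|m IH] j; first by rewrite leqn0 => /eqP ->.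
move=> jm; rewrite iterS gconvE big_nat big1 // => i /andP[_ ij].
case: i ij => [|i] ij; first by rewrite o0 mcomm0l.
by rewrite IH ?mcomm0 //; lia.
Qed.

Lemma iter_gconv_high o x q D m j : (forall i, (q < i)%N -> o i = 0) ->
  (forall i, (D <= i)%N -> x i = 0) -> (D + m * q <= j)%N ->
  iter m (gconv o) x j = 0.
Proof.
move=> oq xD; elim: m j => [|m IH] j Dj; first by apply: xD; lia.
rewrite iterS gconvE big_nat big1 // => i /andP[_ ij].
have [iq|qi] := leqP i q; last by rewrite oq ?mcomm0l.
by rewrite IH ?mcomm0 //; lia.
Qed.

Lemma iter_gconv_ext o x y q m : (forall i, (i <= q)%N -> x i = y i) ->
  forall j, (j <= q)%N -> iter m (gconv o) x j = iter m (gconv o) y j.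
Proof.
move=> xy; elim: m => [//|m IH] j jq; rewrite !iterS !gconvE; apply: eq_big_nat => i _.
by rewrite IH //; lia.
Qed.

Lemma iter_gconv_lin o (a : nat -> C) (y : nat -> nat -> M_) n m j :
  iter m (gconv o) (fun i => \sum_(0 <= l < n) a l *: y l i) j =
  \sum_(0 <= l < n) a l *: iter m (gconv o) (y l) j.
Proof.
elim: m j => [//|m IH] j; rewrite iterS gconvE.
under eq_bigr do rewrite IH mcomm_sumr.
rewrite exchange_big /=; apply: eq_bigr => l _; rewrite gconvE scaler_sumr.
by apply: eq_bigr => i _; rewrite mcommZr.
Qed.

Lemma mcomm_graded o x q D : (forall i, (q < i)%N -> o i = 0) -> (0 < D)%N ->
  (forall i, (D <= i)%N -> x i = 0) ->
  mcomm (\sum_(0 <= i < q.+1) o i) (\sum_(0 <= j < D) x j) =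
  \sum_(0 <= k < D + q) gconv o x k.
Proof.
move=> oq D0 xD; rewrite /gconv.
rewrite (@sum_triangle _ (fun i j => mcomm (o i) (x j))).
rewrite [RHS](@sum_nat_cut _ _ q.+1); [|lia|]; last first.
  move=> i /andP[qi _]; rewrite /= big1 // => j _.
  by rewrite oq ?mcomm0l.
rewrite mcomm_suml; apply: eq_big_nat => i /andP[_ iq]; rewrite mcomm_sumr.
rewrite [RHS](@sum_nat_cut _ _ D) //; first lia.
by move=> j /andP[Dj _]; rewrite xD ?mcomm0.
Qed.

Lemma iter_mcomm_graded o x q D m E : (forall i, (q < i)%N -> o i = 0) ->
  (0 < D)%N -> (forall i, (D <= i)%N -> x i = 0) -> (D + m * q <= E)%N ->
  iter m (mcomm (\sum_(0 <= i < q.+1) o i)) (\sum_(0 <= j < D) x j) =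
  \sum_(0 <= k < E) iter m (gconv o) x k.
Proof.
move=> oq D0 xD DE.
rewrite (sum_nat_cut DE); last first.
  by move=> i /andP[Di _]; exact: (iter_gconv_high oq xD).
elim: m {DE} => [|m IH]; first by rewrite addn0.
rewrite iterS IH (@mcomm_graded _ _ q) //.
- by congr (\sum_(0 <= k < _) _); lia.
- lia.
- by move=> i; exact: iter_gconv_high.
Qed.

(** Expanding the [m]-fold convolution in degree [j + 1] lists the compositions of [j] into [m]
    positive parts. Their parts are at most [q], so the truncation does not affect them. *)
Lemma nested_comm_graded (u : nat -> M_) A q J m j : (J <= q.+1)%N -> (j < J)%N ->
  \sum_(s : m.-tuple 'I_J |
            all (fun i : 'I_J => 0 < i)%N s && (\sum_(i <- s) i == j)%N)
      nested_comm [seq u (nat_of_ord i) | i <- s] A =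
  iter m (gconv (gtrunc q u)) (gsingle A) j.+1.
Proof.
move=> Jq; elim: m j => [|m IH] j jJ.
  rewrite /= /gsingle eqSS; case: eqVneq => [->|jn0].
    rewrite (big_pred1 [tuple]) //= => s; rewrite tuple0 /= big_nil.
    by apply/esym/eqP.
  rewrite big_pred0 // => s; rewrite tuple0 /= big_nil eq_sym.
  exact: negbTE.
rewrite (@sum_tuple_cons _ _ m (fun s => all (fun i : 'I_J => 0 < i)%N s &&
   (\sum_(i <- s) i == j)%N) (fun s => nested_comm [seq u (nat_of_ord i) | i <- s] A)).
rewrite iterS gconvE big_nat_recr //= subnn.
rewrite (@iter_gconv_low _ _ m 0) // mcomm0 addr0.
rewrite big_mkord (big_ord_widen J (fun i => mcomm (gtrunc q u i)
  (iter m (gconv (gtrunc q u)) (gsingle A) (j.+1 - i)%N))) //.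
rewrite [RHS]big_mkcond /=; apply: eq_bigr => i _.
case: ifP => ij; last first.
  rewrite big_pred0 // => s; rewrite big_cons.
  by apply/negbTE; rewrite negb_and; apply/orP; right; apply/eqP; lia.
rewrite subSn // -IH; last lia.
rewrite mcomm_sumr /gtrunc.
case: (posnP (nat_of_ord i)) => i0.
  by rewrite big_pred0 //= big1 // => s _; rewrite mcomm0l.
rewrite (_ : (i <= q)%N); last by have := ltn_ord i; lia.
rewrite ?i0 /=; apply: eq_bigl => s; rewrite big_cons; congr (_ && _).
by apply/eqP/eqP; lia.
Qed.

(** Coefficientwise, [x / (e^x - 1)] times [(e^x - 1) / x] equals 1. *)
Lemma bern_inverse r :
  \sum_(0 <= l < r.+1) bern R l * ((r - l).+1`!%:R)^-1 = (r == 0%N)%:R.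
Proof.
have fnz k : k`!%:R != 0 :> R by rewrite pnatr_eq0 -lt0n fact_gt0.
apply: (mulfI (fnz r.+1)).
have -> : r.+1`!%:R * (r == 0%N)%:R = (r == 0%N)%:R :> R.
  by case: r => [|r]; rewrite ?mul1r ?mulr0.
have := congr1 (@ratr R) (bernoulli_numberE r).
rewrite ratr_nat => <-; rewrite rmorph_sum big_mkord mulr_sumr.
apply: eq_bigr => l _; have lr : (l <= r)%N by rewrite -ltnS.
rewrite [RHS]rmorphM rmorph_nat [RHS]/= /bern.
have <- : ('C(r.+1, l) * (l`! * (r - l).+1`!))%:R = r.+1`!%:R :> R.
  by rewrite -subSn // bin_fact // ltnW.
rewrite (natrM _ 'C(r.+1, l)) (natrM _ l`!); have := fnz l; have := fnz (r - l).+1.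
move: (l`!%:R : R) ((r - l).+1`!%:R : R) => a b b0 a0.
by field; rewrite a0 b0.
Qed.

(** This is the series [ad / (e^ad - 1)] applied to the generator. Its [m = 0] term lives in degree
    1 and gives the first Magnus term; iterates with [m >= j] vanish in degree [j], so [q] is a
    common upper limit. *)
Lemma magnus_deriv_graded (G : R -> M_) Om q j t : (1 <= j <= q)%N ->
  magnus_deriv G Om j t = \sum_(0 <= m < q) real_Cx (bern R m) *:
    iter m (gconv (gtrunc q (fun i => Om i t))) (gsingle (G t)) j.
Proof.
move=> /andP[j1 jq].
rewrite (@sum_nat_cut _ _ j) //; last first.
  by move=> m /andP[jm _]; rewrite iter_gconv_low ?scaler0.
rewrite /magnus_deriv; case: eqVneq => [->|jn1].
  rewrite big_nat1 /= /bern divr1 (_ : bernoulli_number 0 = 1).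
    by rewrite rmorph1 real_Cx1 scale1r.
  by have := bernoulli_numberE 0; rewrite big_ord1 bin0 mul1r.
have j2 : (1 < j)%N by rewrite ltn_neqAle eq_sym jn1.
rewrite magnus_rhsE [RHS]big_ltn ?(ltnW j2) //= /gsingle (negbTE jn1) scaler0 add0r.
apply: eq_big_nat => m _.
rewrite (@nested_comm_graded (fun i => Om i t) _ q); [|lia..].
by rewrite prednK.
Qed.

(** Two power series in the same adjoint action are composed, and the coefficient of its [r]-th
    power is the sum in [bern_inverse]. Cutting at [q] is harmless, since [q] or more actions begin
    in degree [q + 1]. *)
Lemma dexp_graded_low (G : R -> M_) Om q j t : (0 < q)%N -> (j <= q)%N ->
  let o := gtrunc q (fun i => Om i t) in
  let x := gtrunc q (fun i => magnus_deriv G Om i t) in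
  \sum_(0 <= m < q) real_Cx (m.+1`!%:R^-1) *: iter m (gconv o) x j =
  gsingle (G t) j.
Proof.
move=> q0 jq o x; pose y l := iter l (gconv o) (gsingle (G t)).
have xy i : (i <= q)%N -> x i = \sum_(0 <= l < q) real_Cx (bern R l) *: y l i.
  move=> iq; case: i iq => [|i] iq.
    by rewrite big1 // => l _; rewrite /y iter_gconv_low ?scaler0.
  by rewrite /x {1}/gtrunc iq /= (@magnus_deriv_graded _ _ q).
under eq_bigr do rewrite (iter_gconv_ext _ _ xy) // iter_gconv_lin.
have yy m l : iter m (gconv o) (y l) j = y (l + m)%N j.
  by rewrite /y addnC iterD.
have step l : (0 <= l < q)%N -> \sum_(0 <= m < q)
    real_Cx (m.+1`!%:R^-1) *: (real_Cx (bern R l) *: iter m (gconv o) (y l) j) =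
    \sum_(0 <= m < q - l) real_Cx (bern R l * m.+1`!%:R^-1) *: y (l + m)%N j.
  move=> lq; rewrite (@sum_nat_cut _ _ (q - l)); [|lia|].
    by apply: eq_bigr => m _; rewrite yy scalerA mulrC -real_CxM.
  move=> m /andP[qm _]; rewrite yy /y iter_gconv_low ?scaler0 //; lia.
under eq_bigr do rewrite scaler_sumr.
rewrite exchange_big /= (eq_big_nat _ _ step).
rewrite -(@sum_triangle _ (fun l m => real_Cx (bern R l * m.+1`!%:R^-1) *: y (l + m)%N j)).
rewrite big_ltn // big_nat1 subnn big_nat big1 => [|k /andP[k1 _]].
  have := bern_inverse 0; rewrite big_nat1 subnn eqxx => ->.
  by rewrite addr0 real_Cx1 scale1r.
have -> : \sum_(0 <= i < k.+1) real_Cx (bern R i * (k - i).+1`!%:R^-1) *: y (i + (k - i))%N j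
  = real_Cx (\sum_(0 <= i < k.+1) bern R i * (k - i).+1`!%:R^-1) *: y k j.
  rewrite -[real_Cx (\sum_(_ <= _ < _) _)]/(real_complex R _) rmorph_sum scaler_suml.
  by apply: eq_big_nat => i ik; rewrite subnKC //; lia.
rewrite bern_inverse; have -> : (k == 0)%N = false by lia.
by rewrite mulr0n real_Cx0 scale0r.
Qed.

Lemma dexp_graded (G : R -> M_) Om q t : (0 < q)%N ->
  let o := gtrunc q (fun i => Om i t) in
  let x := gtrunc q (fun i => magnus_deriv G Om i t) in
  dexp_trunc q (\sum_(1 <= j < q.+1) Om j t)
      (\sum_(1 <= j < q.+1) magnus_deriv G Om j t) - G t =
    \sum_(q.+1 <= j < q.+1 * q.+1) \sum_(0 <= m < q)
      real_Cx (m.+1`!%:R^-1) *: iter m (gconv o) x j.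
Proof.
move=> q0 o x.
have sumE (u : nat -> M_) :
    \sum_(1 <= j < q.+1) u j = \sum_(0 <= j < q.+1) gtrunc q u j.
  rewrite [RHS]big_ltn // {1}/gtrunc /= add0r.
  by apply: eq_big_nat => i /andP[i1 iq]; rewrite /gtrunc i1 -ltnS iq.
have oq i : (q < i)%N -> o i = 0.
  by move=> qi; rewrite /o /gtrunc ifF //; lia.
have xq i : (q.+1 <= i)%N -> x i = 0.
  by move=> qi; rewrite /x /gtrunc ifF //; lia.
rewrite !sumE -/o -/x /dexp_trunc.
(* [m] actions of degree at most [q] on a series below degree [q + 1] stay below [q + 1 + m q],
   which [(q + 1)^2] covers. *)
have step m : (0 <= m < q)%N -> real_Cx (m.+1`!%:R^-1) *:
     iter m (mcomm (\sum_(0 <= i < q.+1) o i)) (\sum_(0 <= j < q.+1) x j) =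
   \sum_(0 <= j < q.+1 * q.+1) real_Cx (m.+1`!%:R^-1) *: iter m (gconv o) x j.
  move=> mq; rewrite (@iter_mcomm_graded _ _ _ _ _ (q.+1 * q.+1) oq _ xq) //.
    by rewrite scaler_sumr.
  by nia.
rewrite (eq_big_nat _ _ step) exchange_big /= (big_cat_nat (n := q.+1)) //=; last first.
  by nia.
rewrite (_ : \sum_(0 <= i < q.+1) _ = G t); first by rewrite [LHS]addrC addKr.
rewrite (eq_big_nat _ _ (F2 := gsingle (G t))); last first.
  by move=> j jq; apply: dexp_graded_low => //; lia.
rewrite big_ltn // big_ltn; last lia.
rewrite big_nat big1 => [|i ?]; first by rewrite /gsingle /= add0r addr0.
by rewrite /gsingle ifF //; lia.
Qed.

Lemma iter_mcomm_high (G : R -> M_) Om q t :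
  let o := gtrunc q (fun i => Om i t) in
  let x := gtrunc q (fun i => magnus_deriv G Om i t) in
  iter q (mcomm (\sum_(1 <= j < q.+1) Om j t))
      (\sum_(1 <= j < q.+1) magnus_deriv G Om j t) =
    \sum_(q.+1 <= j < q.+1 * q.+1) iter q (gconv o) x j.
Proof.
move=> o x.
have sumE (u : nat -> M_) :
    \sum_(1 <= j < q.+1) u j = \sum_(0 <= j < q.+1) gtrunc q u j.
  rewrite [RHS]big_ltn // {1}/gtrunc /= add0r.
  by apply: eq_big_nat => i /andP[i1 iq]; rewrite /gtrunc i1 -ltnS iq.
have oq i : (q < i)%N -> o i = 0.
  by move=> qi; rewrite /o /gtrunc ifF //; lia.
have xq i : (q.+1 <= i)%N -> x i = 0.
  by move=> qi; rewrite /x /gtrunc ifF //; lia.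
rewrite !sumE -/o -/x (@iter_mcomm_graded _ _ _ _ _ (q.+1 * q.+1) oq _ xq) //; last by nia.
rewrite (big_cat_nat (n := q.+1)) //=; last by nia.
rewrite big_nat big1 ?add0r // => i iq.
by apply: iter_gconv_low => //; lia.
Qed.

End Graded.

(** * Error of the truncated Magnus expansion for a scale of seminorms *)

Section MagnusBounds.
Variables (R : realType) (c kap : nat -> R).
Hypotheses (c0 : forall p, 0 <= c p) (kap0 : forall p, 0 <= kap p).
Implicit Types (K : nat -> nat -> R).

(** The constants [c] are fixed before [N] and [f], so everything derived from them is uniform in
    the dimension. *)
Definition comm_scale N (f : nat -> 'M[Cx R]_N -> R) : Prop :=
  (forall p, seminorm (f p)) /\
  (forall p A B, f p (mcomm A B) <= c p * (f p.+1 A * f p.+1 B)).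

(** The recursion of [gconv] on the level of constants, read one index higher in the scale. *)
Definition gconst K K' (p j : nat) : R :=
  c p * \sum_(0 <= i < j.+1) K p.+1 i * K' p.+1 (j - i)%N.

Lemma gconst_ge0 K K' : (forall p j, 0 <= K p j) -> (forall p j, 0 <= K' p j) ->
  forall p j, 0 <= gconst K K' p j.
Proof.
move=> K0 K'0 p j; rewrite mulr_ge0 // sumr_ge0 // => i _; exact: mulr_ge0.
Qed.

Lemma iter_gconst_ge0 K K' m : (forall p j, 0 <= K p j) ->
  (forall p j, 0 <= K' p j) -> forall p j, 0 <= iter m (gconst K) K' p j.
Proof. by move=> K0 K'0; elim: m => [//|m IH] p j; exact: gconst_ge0. Qed.

Section Bounds.
Variables (N : nat) (f : nat -> 'M[Cx R]_N -> R) (g u : R) (K K' : nat -> nat -> R).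
Variables (o x : nat -> 'M[Cx R]_N).
Hypotheses (fs : comm_scale f) (g0 : 0 <= g) (u0 : 0 <= u).
Hypotheses (K0 : forall p j, 0 <= K p j) (K'0 : forall p j, 0 <= K' p j).
Hypotheses (o0 : o 0%N = 0).
Hypothesis oK : forall p i, (0 < i)%N -> f p (o i) <= K p i * u ^+ i.

(** With [u] equal to [g] times time, [g * u ^+ j.-1] is the shape of a time derivative of order
    [j]: [j] factors [g], but only [j - 1] of time. A commutator with terms of size [u ^+ i]
    preserves it. *)
Lemma gconv_bound y L : (forall p j, 0 <= L p j) -> y 0%N = 0 ->
  (forall p j, (0 < j)%N -> f p (y j) <= L p j * (g * u ^+ j.-1)) ->
  forall p j, (0 < j)%N -> f p (gconv o y j) <= gconst K L p j * (g * u ^+ j.-1).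
Proof.
move=> L0 y0 yL p j j0; rewrite gconvE /gconst -mulrA mulr_suml mulr_sumr.
apply: le_trans (seminorm_sum _ _ _ (fs.1 p)) _; rewrite !big_nat.
apply: ler_sum => i /andP[_ ij].
have T0 : 0 <= c p * (K p.+1 i * L p.+1 (j - i)%N * (g * u ^+ j.-1)).
  by do !apply: mulr_ge0 => //; exact: exprn_ge0.
case: (posnP i) => [i0|i0].
  by rewrite {1}i0 o0 mcomm0l (seminorm0 (fs.1 p)).
case: (posnP (j - i)) => [ji0|ji0].
  by rewrite {1}ji0 y0 mcomm0 (seminorm0 (fs.1 p)).
apply: le_trans (fs.2 _ _ _) _; rewrite ler_wpM2l //.
apply: (@le_trans _ _ ((K p.+1 i * u ^+ i) * (L p.+1 (j - i)%N * (g * u ^+ (j - i).-1)))).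
  by apply: ler_pM; rewrite ?(seminorm_ge0 _ (fs.1 _)) ?oK ?yL.
have -> : u ^+ j.-1 = u ^+ i * u ^+ (j - i).-1 by rewrite -exprD; congr (_ ^+ _); lia.
by rewrite le_eqVlt; apply/orP; left; apply/eqP; ring.
Qed.

Hypothesis x0 : x 0%N = 0.
Hypothesis xK : forall p j, (0 < j)%N -> f p (x j) <= K' p j * (g * u ^+ j.-1).

Lemma iter_gconv_bound m p j : (0 < j)%N ->
  f p (iter m (gconv o) x j) <= iter m (gconst K) K' p j * (g * u ^+ j.-1).
Proof.
elim: m p j => [|m IH] p j j0; first exact: xK.
rewrite !iterS; apply: gconv_bound => //; first exact: iter_gconst_ge0.
exact: iter_gconv_low.
Qed.

End Bounds.

(** In the application [g] is [alpha] times the interaction degree, and [kap] carries what depends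
    on [k], [chi], [T] and the index [p]. *)
Definition magnus_setting N (f : nat -> 'M[Cx R]_N -> R) (G : R -> 'M[Cx R]_N)
    Om (g t : R) : Prop :=
  [/\ comm_scale f, is_magnus G Om, 0 <= g, 0 <= t &
      forall p s, 0 <= s <= t -> f p (G s) <= kap p * g].

Definition magnus_bounded N (f : nat -> 'M[Cx R]_N -> R) (G : R -> 'M[Cx R]_N)
    Om (g t : R) K j : Prop :=
  forall i, (1 <= i <= j)%N -> forall p s, 0 <= s <= t ->
    f p (Om i s) <= K p i * (g * s) ^+ i /\
    f p (magnus_deriv G Om i s) <= K p i * (g * (g * s) ^+ i.-1).

Lemma gtrunc_bound N (f : nat -> 'M[Cx R]_N -> R) (y : nat -> 'M[Cx R]_N) q
    (L : nat -> nat -> R) (w : nat -> R) : comm_scale f ->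
  (forall p i, (1 <= i <= q)%N -> f p (y i) <= L p i * w i) ->
  (forall p i, 0 <= L p i * w i) ->
  forall p i, f p (gtrunc q y i) <= L p i * w i.
Proof.
move=> fs H L0 p i; rewrite /gtrunc; case: ifP => [iq|_]; first exact: H.
by rewrite (seminorm0 (fs.1 p)).
Qed.

Lemma ler_scaled_pow (K g y z : R) n : 0 <= K -> 0 <= g -> 0 <= y -> y <= z ->
  K * (g * y) ^+ n <= K * (g * z) ^+ n.
Proof.
move=> K0 g0 y0 yz; have z0 := le_trans y0 yz.
rewrite ler_wpM2l //; apply: lerXn2r; rewrite ?nnegrE.
- exact: mulr_ge0.
- exact: mulr_ge0.
- exact: ler_wpM2l.
Qed.

(** The slope omits the factor [j + 1] of the true derivative, so enlarging a single factor of the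
    power already dominates it. *)
Lemma pow_supergradient (K g : R) j (a h : R) : 0 <= K -> 0 <= g -> 0 <= a ->
  0 <= h -> K * (g * a) ^+ j.+1 + h * (K * (g * (g * a) ^+ j)) <=
            K * (g * (a + h)) ^+ j.+1.
Proof.
move=> K0 g0 a0 h0.
have -> : K * (g * a) ^+ j.+1 + h * (K * (g * (g * a) ^+ j)) =
  K * ((g * (a + h)) * (g * a) ^+ j) by rewrite exprS; ring.
rewrite ler_wpM2l // exprS ler_wpM2l ?mulr_ge0 ?addr_ge0 //.
by apply: lerXn2r; rewrite ?nnegrE ?mulr_ge0 ?addr_ge0 // ler_wpM2l // lerDl.
Qed.

(** The recursion bounds the derivative through lower orders, and [mvt] integrates it with the same
    constant. [K] is chosen before the dimension and the operators. *)
Lemma magnus_bounds j : exists2 K, (forall p i, 0 <= K p i) &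
  forall N f G Om g t, @magnus_setting N f G Om g t ->
    magnus_bounded f G Om g t K j.
Proof.
elim: j => [|j [K K0 IH]].
  exists (fun _ _ => 0) => // N f G Om g t _ i; lia.
(* The first summand serves the first Magnus term, whose derivative is [G]; the sum serves the
   recursion. *)
pose L p := kap p + \sum_(1 <= m < j.+1) `|bern R m| *
  iter m (gconst K) (fun p _ => kap p) p j.+1.
have L0 p : 0 <= L p.
  rewrite addr_ge0 // sumr_ge0 // => m _; rewrite mulr_ge0 //.
  by apply: iter_gconst_ge0.
exists (fun p i => if (i == j.+1)%N then L p else K p i).
  by move=> p i; case: ifP.
move=> N f G Om g t S i ij p s st; have [fs mag g0 t0 GK] := S.
case: eqVneq => [ij1|ij1]; last by apply: IH S _ _ _ _ st; lia.
have DL r : 0 <= r <= t -> f p (magnus_deriv G Om j.+1 r) <= L p * (g * (g * r) ^+ j).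
  move=> rt; have r0 : 0 <= r by case/andP: rt.
  have gr0 : 0 <= g * (g * r) ^+ j by rewrite mulr_ge0 // exprn_ge0 // mulr_ge0.
  rewrite /magnus_deriv; case: eqVneq => [j1|jn1].
    have -> : j = 0%N by lia.
    rewrite expr0 mulr1; apply: le_trans (GK _ _ rt) _; rewrite ler_wpM2r //.
    rewrite lerDl sumr_ge0 // => m _; rewrite mulr_ge0 //.
    by apply: iter_gconst_ge0.
  rewrite magnus_rhsE /L mulrDl mulr_suml; apply: ler_wpDl; first exact: mulr_ge0.
  apply: le_trans (seminorm_sum _ _ _ (fs.1 p)) _; apply: ler_sum => m _.
  have [_ fZ _] := fs.1 p; apply: le_trans (fZ _ _) _; rewrite -mulrA ler_wpM2l //.
  rewrite (@nested_comm_graded _ _ (fun i => Om i r) _ j) //.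
  apply: (@iter_gconv_bound N f g (g * r) K (fun p _ => kap p)) => //.
  - exact: mulr_ge0.
  - move=> p' i' _; apply: gtrunc_bound => // [p2 i2 i2j|p2 i2].
      by have [] := IH _ _ _ _ _ _ S i2 i2j p2 r rt.
    by rewrite mulr_ge0 // exprn_ge0 // mulr_ge0.
  - move=> p' j' _; rewrite /gsingle; case: eqVneq => [->|_].
      by rewrite mulr1; exact: GK.
    rewrite (seminorm0 (fs.1 p')) !mulr_ge0 // exprn_ge0 // mulr_ge0 //.
rewrite ij1; split; last exact: DL.
have /andP[s0 st'] := st.
have := @mvt R N (f p) (Om j.+1) (magnus_deriv G Om j.+1)
  (fun s => L p * (g * s) ^+ j.+1) (fun s => L p * (g * (g * s) ^+ j)) s (fs.1 p) s0.
have [-> // _ _] := mag.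
rewrite subr0 mulr0 expr0n /= mulr0 subr0; apply.
- by move=> r _; exact: magnus_mderiv.
- by move=> y z y0 yz; exact: ler_scaled_pow.
- by move=> a h a0 h0; exact: pow_supergradient.
- by move=> r /andP[r0 rs]; apply: DL; rewrite r0 (le_trans rs).
Qed.

(** The surviving orders run from [q + 1] to a constant, and [g * t <= 1] bounds each of them by
    order [q + 1]. The factor [nu] is the price of returning to the operator norm. *)
Lemma magnus_error q : (0 < q)%N -> exists2 C, 0 <= C &
  forall N f G Om (g t : R) Y (nu : R), @magnus_setting N f G Om g t ->
    is_time_ordered_exp G Y -> (forall s, 0 <= s <= t -> skew (G s)) ->
    0 <= nu -> (forall A, opnorm A <= nu * f 0%N A) -> g * t <= 1 ->
    opnorm (Y t - expm (\sum_(1 <= j < q.+1) Om j t)) <= C * nu * (g * t) ^+ q.+1.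
Proof.
move=> q0; have [K K0 KH] := magnus_bounds q.
pose cst m j := iter m (gconst K) K 0%N j.
have cst0 m j : 0 <= cst m j by apply: iter_gconst_ge0.
(* For each surviving degree, the inner sum is for [dexp_trunc - G] and the last term for the Taylor
   remainder. *)
pose C := \sum_(q.+1 <= j < q.+1 * q.+1)
  (\sum_(0 <= m < q) m.+1`!%:R^-1 * cst m j + cst q j).
have C0 : 0 <= C.
  apply: sumr_ge0 => j _; rewrite addr_ge0 //; apply: sumr_ge0 => m _.
  by rewrite mulr_ge0 // invr_ge0.
exists C => // N f G Om g t Y nu S [Y0 YD] sG nu0 fnu gt1.
have [fs mag g0 t0 GK] := S; have HB := KH _ _ _ _ _ _ S.
have Cnu0 : 0 <= C * nu by exact: mulr_ge0.
have := @ode_compare R N q G Y (fun s => \sum_(1 <= j < q.+1) Om j s)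
  (fun s => \sum_(1 <= j < q.+1) magnus_deriv G Om j s)
  (fun s => C * nu * (g * s) ^+ q.+1) (fun s => C * nu * (g * (g * s) ^+ q)) t t0 Y0.
rewrite mulr0 expr0n /= mulr0 subr0; apply.
- by rewrite big_nat big1 // => i /andP[i1 _]; have [-> // _ _] := mag.
- by move=> s _; exact: (has_derivative_mderiv s YD).
- move=> s _; rewrite big_nat; under eq_fun do rewrite big_nat.
  by apply: mderiv_sum => j /andP[j1 _]; exact: magnus_mderiv.
- exact: sG.
- move=> s st; rewrite big_nat; apply: skew_sum => j /andP[j1 _].
  exact: (skew_magnus mag sG).
- move=> s st; rewrite big_nat; apply: skew_sum => j /andP[j1 _].
  apply: skew_magnus_deriv => // [|i /andP[i1 _]]; first exact: sG.
  exact: (skew_magnus mag sG).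
- by move=> y z y0 yz; exact: ler_scaled_pow.
- by move=> a h a0 h0; exact: pow_supergradient.
move=> s st; rewrite dexp_graded // iter_mcomm_high.
set o := gtrunc q (fun i => Om i s).
set x := gtrunc q (fun i => magnus_deriv G Om i s).
have /andP[s0 st'] := st; have gs0 : 0 <= g * s by exact: mulr_ge0.
have gs1 : g * s <= 1 by apply: le_trans gt1; rewrite ler_wpM2l.
apply: le_trans (lerD (fnu _) (fnu _)) _; rewrite -mulrDr (mulrC C) -mulrA ler_wpM2l //.
apply: le_trans (lerD (seminorm_sum _ _ _ (fs.1 _)) (seminorm_sum _ _ _ (fs.1 _))) _.
rewrite -big_split /= mulr_suml !big_nat; apply: ler_sum => j /andP[qj _].
have it m : f 0%N (iter m (gconv o) x j) <= cst m j * (g * (g * s) ^+ q).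
  apply: (@le_trans _ _ (cst m j * (g * (g * s) ^+ j.-1))).
    apply: (@iter_gconv_bound N f g (g * s) K K); rewrite ?(leq_trans _ qj) //.
    - move=> p' i' _; apply: gtrunc_bound => // [p2 i2 i2j|p2 i2].
        by have [] := HB i2 i2j p2 s st.
      by rewrite mulr_ge0 // exprn_ge0.
    - move=> p' i' _.
      apply: (@gtrunc_bound _ _ _ _ _ (fun i => g * (g * s) ^+ i.-1)) => // [p2 i2 i2j|p2 i2].
        by have [] := HB i2 i2j p2 s st.
      by rewrite !mulr_ge0 // exprn_ge0.
  rewrite ler_wpM2l // ler_wpM2l //; apply: ler_wiXn2l => //.
  by rewrite -ltnS prednK // (leq_trans _ qj).
rewrite mulrDl; apply: lerD; last exact: it.
apply: le_trans (seminorm_sum _ _ _ (fs.1 _)) _; rewrite mulr_suml.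
apply: ler_sum => m _; have [_ fZ _] := fs.1 0%N.
apply: le_trans (fZ _ _) _; rewrite ger0_norm ?invr_ge0 // -mulrA.
by rewrite ler_wpM2l ?invr_ge0.
Qed.

(** For [g * t > 1] both exponentials have norm at most 1 and the right-hand side is at least 2. *)
Lemma magnus_error_global q : (0 < q)%N -> exists C,
  forall N f G Om (g t : R) Y (nu : R), @magnus_setting N f G Om g t ->
    is_time_ordered_exp G Y -> (forall s, 0 <= s <= t -> skew (G s)) ->
    1 <= nu -> (forall A, opnorm A <= nu * f 0%N A) ->
    opnorm (Y t - expm (\sum_(1 <= j < q.+1) Om j t)) <= C * nu * (g * t) ^+ q.+1.
Proof.
move=> q0; have [C C0 H] := magnus_error q0; exists (C + 2).
move=> N f G Om g t Y nu S HY sG nu1 fnu; have [fs mag g0 t0 GK] := S.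
have nu0 : 0 <= nu by apply: le_trans nu1.
have gt0 : 0 <= g * t by exact: mulr_ge0.
have [gt1|gt1] := leP (g * t) 1.
  apply: le_trans (H _ _ _ _ _ _ _ _ S HY sG nu0 fnu gt1) _.
  by rewrite ler_wpM2r ?exprn_ge0 // ler_wpM2r // lerDl.
have [Y0 YD] := HY.
have Y1 : opnorm (Y t) <= 1.
  apply: le_trans (ode_contraction t0 sG _) _.
    by move=> s _; exact: (has_derivative_mderiv s YD).
  by rewrite Y0; exact: nrm1.
have V1 : opnorm (expm (\sum_(1 <= j < q.+1) Om j t)) <= 1.
  apply: nrm_expm_skew; rewrite big_nat; apply: skew_sum => j /andP[j1 _].
  by apply: (skew_magnus mag sG) => //; rewrite t0 lexx.
apply: le_trans (nrmB _ _) _; apply: le_trans (lerD Y1 V1) _.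
have -> : 1 + 1 = 2 * 1 * 1 :> R by ring.
rewrite !mulr1 -[leLHS]mulr1; apply: ler_pM => //.
  by rewrite -[leLHS]mulr1; apply: ler_pM => //; rewrite lerDr.
by apply: exprn_ege1; exact: ltW.
Qed.

End MagnusBounds.

(** * Supports of operators *)

Section Support.
Variables (R : realType) (n : nat).
Local Notation C := (Cx R).
Local Notation cfg := (config n).
Implicit Types (S : {set 'I_n}) (M : qop R n) (x y z w : cfg).

Definition entry M x y : C := M (enum_rank x) (enum_rank y).

Definition flip x w : cfg := [ffun i => x i (+) w i].

Lemma flipK w : involutive (flip^~ w).
Proof. by move=> x; apply/ffunP => i; rewrite !ffunE -addbA addbb addbF. Qed.

Lemma entryM M1 M2 x z : entry (M1 *m M2) x z = \sum_y entry M1 x y * entry M2 y z.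
Proof.
rewrite /entry mxE (reindex (@enum_rank cfg)) //.
exact/onW_bij/enum_rank_bij.
Qed.

Lemma entry_eq M1 M2 : (forall x y, entry M1 x y = entry M2 x y) -> M1 = M2.
Proof.
by move=> H; apply/matrixP => i j; have := H (enum_val i) (enum_val j);
  rewrite /entry !enum_valK.
Qed.

(* Tensor form [M = M_S (x) 1]: diagonal off [S], and invariant under
   simultaneous bit flips of row and column off [S]. *)
Definition acts_on S M : Prop :=
  (forall x y i, i \notin S -> x i != y i -> entry M x y = 0) /\
  (forall x y w, (forall i, i \in S -> w i = false) ->
     entry M (flip x w) (flip y w) = entry M x y).

Lemma supported_onP S M : supported_on S M <-> acts_on S M.
Proof.
split=> [[MS HM]|[H1 H2]].
  split=> [x y i iS xy|x y w wS].
    have F : [forall (j | j \notin S), x j == y j] = false.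
      by apply/negbTE/negP => /forallP/(_ i); rewrite iS (negbTE xy).
    by rewrite /entry HM F mulr0.
  rewrite /entry !HM.
  have rE (x' : cfg) : restr S (flip x' w) = restr S x'.
    by apply/ffunP => u; rewrite !ffunE wS ?addbF //; exact: valP.
  rewrite !rE; congr (_ * _%:R); congr nat_of_bool.
  by apply: eq_forallb => i; rewrite !ffunE (inj_eq (@addIb _)).
pose ext (a : {ffun {i | i \in S} -> bool}) : cfg :=
  [ffun i => if insub i is Some u then a u else false].
exists (fun a b => entry M (ext a) (ext b)) => x y.
case: (boolP [forall (i | i \notin S), x i == y i]) => [/forallP xy|nxy]; last first.
  rewrite mulr0.
  have /existsP [i /andP[iS xyi]] : [exists i, (i \notin S) && (x i != y i)].
    apply: contraR nxy => /existsPn H; apply/forallP => i; apply/implyP => iS.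
    by have := H i; rewrite iS negbK.
  exact: H1 iS xyi.
(* Off [S] the configurations [x] and [y] agree; flipping by [w] turns both extensions by [false]
   back into [x] and [y] at once. *)
pose w : cfg := [ffun i => (i \notin S) && x i].
rewrite mulr1 -(H2 _ _ w); last by move=> i iS; rewrite ffunE iS.
have E (x' : cfg) : (forall i, i \notin S -> x' i = x i) ->
    flip (ext (restr S x')) w = x'.
  move=> Hx; apply/ffunP => i; rewrite !ffunE.
  case: insubP => [u iS ui|iS]; last by rewrite iS /= Hx.
  by rewrite ffunE ui iS addbF.
by rewrite !E // => i iS; have := xy i; rewrite iS => /eqP.
Qed.

Lemma supported_on0 S : supported_on S (0 : qop R n).
Proof. by apply/supported_onP; split=> *; rewrite /entry !mxE. Qed.

Lemma supported_onD S M1 M2 :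
  supported_on S M1 -> supported_on S M2 -> supported_on S (M1 + M2).
Proof.
move=> /supported_onP[A1 A2] /supported_onP[B1 B2]; apply/supported_onP; split.
  move=> x y i iS xy; have := A1 x y i iS xy; have := B1 x y i iS xy.
  by rewrite /entry !mxE => -> ->; rewrite addr0.
move=> x y w wS; have := A2 x y w wS; have := B2 x y w wS.
by rewrite /entry !mxE => -> ->.
Qed.

Lemma supported_onZ S (c : C) M : supported_on S M -> supported_on S (c *: M).
Proof.
move=> /supported_onP[A1 A2]; apply/supported_onP; split.
  move=> x y i iS xy; have := A1 x y i iS xy.
  by rewrite /entry !mxE => ->; rewrite mulr0.
move=> x y w wS; have := A2 x y w wS.
by rewrite /entry !mxE => ->.
Qed.

Lemma supported_onN S M : supported_on S M -> supported_on S (- M).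
Proof. by rewrite -scaleN1r; exact: supported_onZ. Qed.

Lemma supported_onB S M1 M2 :
  supported_on S M1 -> supported_on S M2 -> supported_on S (M1 - M2).
Proof. by move=> H1 H2; apply: supported_onD => //; exact: supported_onN. Qed.

Lemma supported_on_sum S (I : Type) (r : seq I) (P : pred I) (F : I -> qop R n) :
  (forall i, P i -> supported_on S (F i)) ->
  supported_on S (\sum_(i <- r | P i) F i).
Proof.
by move=> H; elim/big_ind: _ => //; [exact: supported_on0|exact: supported_onD].
Qed.

Lemma supported_on_adj S M : supported_on S M -> supported_on S (adjm M).
Proof.
move=> /supported_onP[A1 A2]; apply/supported_onP; split.
  move=> x y i iS xy; have := A1 y x i iS; rewrite eq_sym => /(_ xy).
  by rewrite /entry adjmE => ->; rewrite rmorph0.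
move=> x y w wS; have := A2 y x w wS.
by rewrite /entry !adjmE => ->.
Qed.

Lemma supported_onM S M1 M2 :
  supported_on S M1 -> supported_on S M2 -> supported_on S (M1 *m M2).
Proof.
move=> /supported_onP[A1 A2] /supported_onP[B1 B2]; apply/supported_onP; split.
  move=> x z i iS xz; rewrite entryM big1 // => y _.
  have [xy|xy] := eqVneq (x i) (y i); last by rewrite (A1 x y i) ?mul0r.
  by rewrite (B1 y z i) ?mulr0 // -xy.
move=> x z w wS; rewrite !entryM (reindex (flip^~ w)) /=; last first.
  by apply/onW_bij/inv_bij/flipK.
by apply: eq_bigr => y _; rewrite A2 ?B2.
Qed.

Lemma supported_on_mcomm S M1 M2 :
  supported_on S M1 -> supported_on S M2 -> supported_on S (mcomm M1 M2).
Proof. by move=> H1 H2; apply: supported_onB; exact: supported_onM. Qed.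

Lemma supported_on_sub S S' M :
  S \subset S' -> supported_on S M -> supported_on S' M.
Proof.
move=> /fintype.subsetP SS /supported_onP[A1 A2]; apply/supported_onP; split.
  by move=> x y i iS; apply: A1; apply: contra iS; exact: SS.
by move=> x y w wS; apply: A2 => i iS; apply: wS; exact: SS.
Qed.

Lemma supported_onT M : supported_on [set: 'I_n] M.
Proof.
apply/supported_onP; split=> [x y i|x y w wS]; first by rewrite inE.
have E (x' : cfg) : flip x' w = x'.
  by apply/ffunP => i; rewrite ffunE wS ?addbF // inE.
by rewrite !E.
Qed.

(* In [M M'] (resp. [M' M]) the only intermediate configuration is [u] (resp. [v]),
   which takes the values of [z] on [S] and of [x] off it (resp. the reverse). *)
Lemma supported_on_disjoint S S' M M' : [disjoint S & S'] ->
  supported_on S M -> supported_on S' M' -> mcomm M M' = 0.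
Proof.
move=> dSS /supported_onP[A1 A2] /supported_onP[B1 B2].
apply/eqP; rewrite subr_eq0; apply/eqP/entry_eq => x z; rewrite !entryM.
pose u : cfg := [ffun i => if i \in S then z i else x i].
pose v : cfg := [ffun i => if i \in S then x i else z i].
rewrite (bigD1 u) //= [X in _ + X]big1 ?addr0; last first.
  move=> y yu; have /existsP [i yi] : [exists i, y i != u i].
    by rewrite -negb_forall; apply: contra yu => /forallP H; apply/eqP/ffunP => i;
      exact/eqP.
  move: yi; rewrite ffunE; case: ifP => iS yi.
    rewrite (B1 y z i) ?mulr0 //; apply: contraL dSS => iS'.
    by apply/pred0Pn; exists i; rewrite /= iS iS'.
  by rewrite (A1 x y i) ?mul0r ?iS // eq_sym.
rewrite (bigD1 v) //= [X in _ = _ + X]big1 ?addr0; last first.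
  move=> y yv; have /existsP [i yi] : [exists i, y i != v i].
    by rewrite -negb_forall; apply: contra yv => /forallP H; apply/eqP/ffunP => i;
      exact/eqP.
  move: yi; rewrite ffunE; case: ifP => iS yi.
    rewrite (B1 x y i) ?mul0r //; last by rewrite eq_sym.
    apply: contraL dSS => iS'.
    by apply/pred0Pn; exists i; rewrite /= iS iS'.
  by rewrite (A1 y z i) ?mulr0 ?iS.
pose w1 : cfg := [ffun i => (i \notin S) && (x i (+) z i)].
pose w2 : cfg := [ffun i => (i \in S) && (x i (+) z i)].
have -> : entry M v z = entry M x u.
  rewrite -(A2 x u w1); last by move=> i iS; rewrite ffunE iS.
  congr entry; apply/ffunP => i; rewrite !ffunE; case: ifP => iS //=.
  - by rewrite addbF.
  - by rewrite addbA addbb.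
  - by rewrite addbF.
  - by rewrite addbA addbb.
have -> : entry M' x v = entry M' u z.
  rewrite -(B2 x v w2); last first.
    move=> i iS; rewrite ffunE; case: (boolP (i \in S)) => //= iS'.
    by have /pred0P/(_ i) := dSS; rewrite /= iS' iS.
  congr entry; apply/ffunP => i; rewrite !ffunE; case: ifP => iS //=.
  - by rewrite addbA addbb.
  - by rewrite addbF.
  - by rewrite addbA addbb.
  - by rewrite addbF.
by rewrite mulrC.
Qed.

End Support.

(** * Geometry of the lattice and norms defined by local decompositions *)

Section LatticeGeometry.
Variables (n : nat) (periodic : bool).
Local Notation dist := (@lattice_dist n periodic).
Implicit Types X : {set 'I_n}.

Lemma lattice_dist_triangle x y z : (dist x z <= dist x y + dist y z)%N.
Proof.
rewrite /lattice_dist; have := ltn_ord x; have := ltn_ord y; have := ltn_ord z.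
by case: periodic; lia.
Qed.

Lemma lattice_dist_sym x y : dist x y = dist y x.
Proof. by rewrite /lattice_dist (maxnC x) (minnC x). Qed.

Lemma lattice_distxx x : dist x x = 0%N.
Proof. by rewrite /lattice_dist maxnn minnn subnn min0n; case: periodic. Qed.

Lemma lattice_dist_lt x y : (dist x y < n)%N.
Proof.
by rewrite /lattice_dist; have := ltn_ord x; have := ltn_ord y; case: periodic; lia.
Qed.

(* A site is determined by its distance to [x], its side of [x], and whether the
   distance is measured the short way round. *)
Lemma card_annulus x a b :
  (#|[set j | (a <= dist x j < b)%N]| <= 4 * (b - a))%N.
Proof.
case E: (b - a)%N => [|m].
  rewrite muln0 leqn0 cards_eq0; apply/eqP/setP => j; rewrite !inE.
  by apply/negbTE; lia.
pose r (j : 'I_n) := (maxn x j - minn x j)%N.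
pose f (j : 'I_n) : bool * bool * 'I_m.+1 :=
  ((j <= x)%N, (r j <= n - r j)%N, inord (dist x j - a)).
have finj : {in [set j | (a <= dist x j < b)%N] &, injective f}.
  move=> j j'; rewrite !inE => Hj Hj' [e1 e2 /(congr1 val)].
  rewrite /= !inordK; [|lia|lia] => e3; apply: val_inj => /=.
  move: Hj Hj' e1 e2 e3; rewrite /r /lattice_dist.
  have := ltn_ord x; have := ltn_ord j; have := ltn_ord j'.
  by case: periodic; lia.
rewrite -(card_in_imset finj); apply: leq_trans (max_card _) _.
by rewrite !card_prod !card_bool card_ord; lia.
Qed.

Variable chi : nat.

(** Steps of length [chi + 1] let a term touching one neighbourhood fit into the next one, and stay
    positive for [chi = 0], so that [n] steps fill the lattice. *)
Definition nbhd (X : {set 'I_n}) (r : nat) : {set 'I_n} :=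
  [set j | [exists x in X, (dist x j <= r * chi.+1)%N]].

Lemma nbhdP X r j :
  reflect (exists2 x, x \in X & (dist x j <= r * chi.+1)%N) (j \in nbhd X r).
Proof. by rewrite inE; exact: exists_inP. Qed.

Lemma sub_nbhd X r : X \subset nbhd X r.
Proof.
by apply/fintype.subsetP => x xX; apply/nbhdP; exists x; rewrite ?lattice_distxx.
Qed.

Lemma nbhdS X r : nbhd X r \subset nbhd X r.+1.
Proof.
apply/fintype.subsetP => j /nbhdP[x xX xj]; apply/nbhdP; exists x => //; lia.
Qed.

Lemma nbhd_full X r : X != finset.set0 -> (n <= r)%N -> nbhd X r = [set: 'I_n].
Proof.
case/set0Pn => x xX nr; apply/setP => j; rewrite [RHS]inE; apply/nbhdP.
by exists x => //; have := lattice_dist_lt x j; nia.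
Qed.

Lemma card_exists_dist (X : {set 'I_n}) (P : 'I_n -> pred 'I_n) (b : nat) :
  (forall x, (#|[set j | P x j]| <= b)%N) ->
  (#|[set j | [exists x in X, P x j]]| <= #|X| * b)%N.
Proof.
move=> H; rewrite -sum1_card; apply: (@leq_trans (\sum_j \sum_(x in X) P x j)).
  rewrite big_mkcond /=; apply: leq_sum => j _; rewrite inE.
  case: exists_inP => // -[x xX Pxj].
  by rewrite (bigD1 x) //= Pxj.
rewrite exchange_big /= -sum_nat_const; apply: leq_sum => x _.
apply: leq_trans (H x); rewrite -sum1_card [in leqRHS]big_mkcond /=.
by apply: leq_sum => j _; rewrite inE; case: (P x j).
Qed.

Lemma card_nbhd X r : (#|nbhd X r| <= #|X| * (4 * (r * chi.+1).+1))%N.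
Proof.
apply: (@card_exists_dist _ (fun x j => (dist x j <= r * chi.+1)%N)) => x.
have := card_annulus x 0 (r * chi.+1).+1; rewrite subn0; apply: leq_trans.
by apply: subset_leq_card; apply/fintype.subsetP => j; rewrite !inE.
Qed.

(** A crossing term has sites on both sides of radius [r (chi + 1)] about some [x] in [X], so its
    index lies in an annulus of width [2 chi]. In one dimension the number of sites there does not
    depend on [r]. *)
Lemma card_boundary X r (S : 'I_n -> {set 'I_n}) :
  (forall j, j \in S j) ->
  (forall i, {in S i &, forall j l, (dist j l <= chi)%N}) ->
  (#|[set j | ~~ [disjoint S j & nbhd X r] && ~~ (S j \subset nbhd X r)]|
     <= #|X| * (8 * chi))%N.
Proof.
move=> jS diam.
pose P x j := ((r * chi.+1).+1 - chi <= dist x j < (r * chi.+1 + chi).+1)%N.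
apply: (@leq_trans #|[set j | [exists x in X, P x j]]|).
  apply: subset_leq_card; apply/fintype.subsetP => j; rewrite !inE.
  case/andP => /pred0Pn[y /andP[/= yS /nbhdP[x xX xy]]].
  case/fintype.subsetPn => z zS /nbhdP zX.
  apply/exists_inP; exists x => //; rewrite /P.
  have yj := diam j _ _ yS (jS j); have jz := diam j _ _ (jS j) zS.
  have := lattice_dist_triangle x y j; have := lattice_dist_triangle x j z.
  have : ~~ (dist x z <= r * chi.+1)%N by apply/negP => xz; apply: zX; exists x.
  by lia.
apply: card_exists_dist => x; apply: leq_trans (card_annulus x _ _) _.
by lia.
Qed.

Lemma nbhd_grow X r (S : {set 'I_n}) :
  {in S &, forall j l, (dist j l <= chi)%N} ->
  ~~ [disjoint S & nbhd X r] -> S \subset nbhd X r.+1.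
Proof.
move=> diam /pred0Pn[y /andP[/= yS /nbhdP[x xX xy]]].
apply/fintype.subsetP => z zS; apply/nbhdP; exists x => //.
by have := lattice_dist_triangle x y z; have := diam _ _ yS zS; lia.
Qed.

End LatticeGeometry.

(** * Norms as infima over weighted local decompositions *)

Section Gauge.
Variables (R : realType) (n : nat) (I : finType) (P : pred I).
Variables (supp : I -> {set 'I_n}) (Wt : 'I_n -> I -> R).
Hypothesis Wt0 : forall j l, 0 <= Wt j l.
Local Notation nrm := (@opnorm R (qdim n)).
Implicit Types M : qop R n.

(** Labels are kept apart from supports because a weight may depend on more than the support, as for
    neighbourhoods remembering their origin. *)
Definition decomposes (a : R) M : Prop := 0 <= a /\
  exists M_ : I -> qop R n,
    [/\ forall l, P l -> supported_on (supp l) (M_ l),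
        M = \sum_(l | P l) M_ l &
        forall j, \sum_(l | P l) Wt j l * nrm (M_ l) <= a].

(** Terms with other indices are grouped along [pi]; the triangle inequality inside each fibre
    suffices, the weight being that of the common target. *)
Lemma decomposes_push (I' : finType) (P' : pred I') (pi : I' -> I)
    (F : I' -> qop R n) a : 0 <= a ->
  (forall l, P' l -> P (pi l) /\ supported_on (supp (pi l)) (F l)) ->
  (forall j, \sum_(l | P' l) Wt j (pi l) * nrm (F l) <= a) ->
  decomposes a (\sum_(l | P' l) F l).
Proof.
move=> a0 H1 H2; split=> //.
have piP l : P' l -> P (pi l) by case/H1.
exists (fun l => \sum_(l' | P' l' && (pi l' == l)) F l'); split.
- move=> l Pl; apply: supported_on_sum => l' /andP[/H1[_ sF] /eqP <-].
  exact: sF.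
- exact: partition_big.
move=> j; apply: le_trans (H2 j); rewrite [leRHS](partition_big pi P) //.
apply: ler_sum => l Pl.
apply: (@le_trans _ _ (Wt j l * \sum_(l' | P' l' && (pi l' == l)) nrm (F l'))).
  by rewrite ler_wpM2l // nrm_sum.
by rewrite mulr_sumr; apply: ler_sum => l' /andP[_ /eqP ->].
Qed.

Lemma decomposesD a b M M' :
  decomposes a M -> decomposes b M' -> decomposes (a + b) (M + M').
Proof.
move=> [a0 [F [F1 F2 F3]]] [b0 [F' [F1' F2' F3']]]; split; first exact: addr_ge0.
exists (fun l => F l + F' l); split.
- by move=> l Pl; apply: supported_onD; [exact: F1|exact: F1'].
- by rewrite big_split F2 F2'.
move=> j; apply: le_trans (lerD (F3 j) (F3' j)); rewrite -big_split /=.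
by apply: ler_sum => l _; rewrite -mulrDr ler_wpM2l // nrm_triangle.
Qed.

Lemma decomposesZ a (c : Cx R) M : decomposes a M -> decomposes (cabs c * a) (c *: M).
Proof.
move=> [a0 [F [F1 F2 F3]]]; split; first by rewrite mulr_ge0 ?cabs_ge0.
exists (fun l => c *: F l); split.
- by move=> l Pl; apply: supported_onZ; exact: F1.
- by rewrite F2 scaler_sumr.
move=> j; apply: le_trans (ler_wpM2l (cabs_ge0 c) (F3 j)); rewrite mulr_sumr.
by apply: ler_sum => l _; rewrite nrmZ mulrCA.
Qed.

Hypothesis full : exists2 l, P l & supp l = [set: 'I_n].

(** Everything is put on one label supported on the whole lattice. This makes the infimum finite,
    with a bound allowed to depend on [n]. *)
Lemma decomposes_bound :
  exists2 K : R, 0 <= K & forall M, decomposes (K * nrm M) M.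
Proof.
have [l0 Pl0 sl0] := full; exists (\sum_j Wt j l0).
  by apply: sumr_ge0 => j _.
move=> M; have {2}-> : M = \sum_(l | l == l0) M by rewrite big_pred1_eq.
apply: (decomposes_push (pi := id)).
- by rewrite mulr_ge0 ?nrm_ge0 // sumr_ge0.
- by move=> l /eqP ->; rewrite Pl0 sl0; split=> //; exact: supported_onT.
move=> j; rewrite (big_pred1 l0) // ler_wpM2r ?nrm_ge0 //.
by rewrite (bigD1 j) //= lerDl sumr_ge0.
Qed.

Local Open Scope classical_set_scope.

Definition gauge M : R := inf [set a | decomposes a M].

Lemma gauge_has_inf M : has_inf [set a | decomposes a M].
Proof.
split; last by exists 0 => a [].
by have [K _ H] := decomposes_bound; exists (K * nrm M); exact: H.
Qed.

Lemma gauge_le a M : decomposes a M -> gauge M <= a.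
Proof. by move=> H; apply: ge_inf => //; case: (gauge_has_inf M). Qed.

Lemma gauge_ge0 M : 0 <= gauge M.
Proof. by apply: lb_le_inf; [case: (gauge_has_inf M)|move=> a []]. Qed.

Lemma gauge_near M e : 0 < e -> exists2 a, a < gauge M + e & decomposes a M.
Proof.
move=> e0; have [a Da ae] := inf_adherent e0 (gauge_has_inf M).
by exists a.
Qed.

Lemma gaugeZ c M : gauge (c *: M) <= cabs c * gauge M.
Proof.
apply/ler_addgt0Pr => e e0.
have c1 : 0 < cabs c + 1 by rewrite ltr_wpDl // cabs_ge0.
have [a ae Da] := gauge_near M (divr_gt0 e0 c1).
apply: le_trans (gauge_le (decomposesZ c Da)) _.
apply: le_trans (ler_wpM2l (cabs_ge0 c) (ltW ae)) _; rewrite mulrDr lerD2l.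
by rewrite mulrCA ler_piMr ?(ltW e0) // ler_pdivrMr // mul1r lerDl.
Qed.

Lemma gaugeD M M' : gauge (M + M') <= gauge M + gauge M'.
Proof.
apply/ler_addgt0Pr => e e0; have e20 : 0 < e / 2 by rewrite divr_gt0.
have [a ae Da] := gauge_near M e20; have [b be Db] := gauge_near M' e20.
by apply: le_trans (gauge_le (decomposesD Da Db)) _; lra.
Qed.

Lemma seminorm_gauge : seminorm gauge.
Proof.
split; [exact: gaugeD|by move=> a A; rewrite -cabs_real gaugeZ|].
have [K K0 H] := decomposes_bound; exists K => // M; exact: gauge_le.
Qed.

Lemma gauge_le_linear (phi : R) (C : R) M : 0 <= C ->
  (forall a, decomposes a M -> phi <= C * a) -> phi <= C * gauge M.
Proof.
move=> C0 H; apply/ler_addgt0Pr => e e0.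
have c1 : 0 < C + 1 by rewrite ltr_wpDl.
have [a ae Da] := gauge_near M (divr_gt0 e0 c1).
apply: le_trans (H _ Da) _.
apply: le_trans (ler_wpM2l C0 (ltW ae)) _; rewrite mulrDr lerD2l.
by rewrite mulrCA ler_piMr ?(ltW e0) // ler_pdivrMr // mul1r lerDl.
Qed.

End Gauge.

(** * The two families of locality norms *)

Section PolynomialGauge.
Variables (R : realType) (n : nat).
Hypothesis n0 : (0 < n)%N.
Local Notation nrm := (@opnorm R (qdim n)).
Implicit Types (S X : {set 'I_n}) (M A B : qop R n).

Definition size_weight p (i : 'I_n) S : R := (i \in S)%:R * #|S|%:R ^+ p.

Definition nonempty : pred {set 'I_n} := fun S => S != finset.set0.

Lemma size_weight_ge0 p i S : 0 <= size_weight p i S.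
Proof. by rewrite mulr_ge0 // exprn_ge0. Qed.

Lemma nonempty_full : exists2 S, nonempty S & id S = [set: 'I_n].
Proof.
exists [set: 'I_n] => //; apply/set0Pn; exists (Ordinal n0); exact: finset.in_setT.
Qed.

Definition poly_gauge p : qop R n -> R :=
  gauge nonempty id (size_weight p).

Lemma seminorm_poly_gauge p : seminorm (poly_gauge p).
Proof. exact: (seminorm_gauge (@size_weight_ge0 p) nonempty_full). Qed.

(** Each nonempty support is counted at one of its sites at least. This is the sole origin of the
    factor [n] in the theorem. *)
Lemma poly_gauge_opnorm A : nrm A <= n%:R * poly_gauge 0 A.
Proof.
apply: (gauge_le_linear (@size_weight_ge0 0) nonempty_full) => // a.
move=> [a0 [F [F1 F2 F3]]]; rewrite F2; apply: le_trans (nrm_sum _ _ _) _.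
apply: (@le_trans _ _ (\sum_(i < n) \sum_(S | nonempty S) size_weight 0 i S * nrm (F S))).
  rewrite exchange_big /=; apply: ler_sum => S /set0Pn[i iS].
  rewrite -mulr_suml ler_peMl ?nrm_ge0 // (bigD1 i) //=.
  rewrite {1}/size_weight iS expr0 mul1r lerDl sumr_ge0 // => j _.
  exact: size_weight_ge0.
apply: (@le_trans _ _ (\sum_(i < n) a)); first exact: ler_sum.
by rewrite sumr_const card_ord mulr_natl.
Qed.

Lemma sum_meeting p S (beta : {set 'I_n} -> R) b : (forall S', 0 <= beta S') ->
  (forall i, \sum_(S' | nonempty S') size_weight p.+1 i S' * beta S' <= b) ->
  \sum_(S' | nonempty S' && ~~ [disjoint S & S']) #|S'|%:R ^+ p * beta S'
    <= #|S|%:R * b.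
Proof.
move=> beta0 H.
apply: (@le_trans _ _ (\sum_(j in S) \sum_(S' | nonempty S')
    size_weight p.+1 j S' * beta S')).
  rewrite exchange_big /= big_mkcondr /=; apply: ler_sum => S' nS'.
  case: ifP => [|_]; last first.
    by apply: sumr_ge0 => j _; rewrite mulr_ge0 // size_weight_ge0.
  case/pred0Pn => j /andP[/= jS jS'].
  rewrite (bigD1 j) //= {1}/size_weight jS' mul1r.
  apply: ler_wpDr; first by apply: sumr_ge0 => i _; rewrite mulr_ge0 // size_weight_ge0.
  rewrite ler_wpM2r // exprS ler_peMl ?exprn_ge0 // ler1n card_gt0; exact: nS'.
apply: (@le_trans _ _ (\sum_(j in S) b)); first by apply: ler_sum => j _.
by rewrite sumr_const mulr_natl.
Qed.

(** The factor [#|S|] of [sum_meeting], one for each site where [S'] can touch [S], raises the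
    exponent on [S]: here a commutator loses one index of the scale. *)
Lemma sum_cross p i (alpha beta : {set 'I_n} -> R) a b :
  (forall S, 0 <= alpha S) -> (forall S, 0 <= beta S) -> 0 <= b ->
  (forall i, \sum_(S | nonempty S) size_weight p.+1 i S * alpha S <= a) ->
  (forall i, \sum_(S | nonempty S) size_weight p.+1 i S * beta S <= b) ->
  \sum_(S | nonempty S) \sum_(S' | nonempty S' && ~~ [disjoint S & S'])
    (i \in S)%:R * (#|S|%:R ^+ p * alpha S) * (#|S'|%:R ^+ p * beta S') <= a * b.
Proof.
move=> alpha0 beta0 b0 Ha Hb; apply: le_trans (ler_wpM2r b0 (Ha i)).
rewrite mulr_suml; apply: ler_sum => S nS; rewrite -mulr_sumr.
apply: le_trans (ler_wpM2l _ (sum_meeting S beta0 Hb)) _.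
  by do !apply: mulr_ge0 => //; exact: exprn_ge0.
by rewrite le_eqVlt; apply/orP; left; apply/eqP; rewrite /size_weight exprS; ring.
Qed.

(** Disjoint terms commute. For nonempty sets the union has size at most [2 #|S| #|S'|], whence
    [2 ^+ p]; one factor 2 comes from the commutator, another from the cases [i \in S] and
    [i \in S']. *)
Lemma decomposes_mcomm p a b A B :
  decomposes nonempty id (size_weight p.+1) a A ->
  decomposes nonempty id (size_weight p.+1) b B ->
  decomposes nonempty id (size_weight p) (4 * 2 ^+ p * (a * b)) (mcomm A B).
Proof.
move=> [a0 [F [F1 F2 F3]]] [b0 [G [G1 G2 G3]]].
pose Q (u : {set 'I_n} * {set 'I_n}) :=
  nonempty u.1 && (nonempty u.2 && ~~ [disjoint u.1 & u.2]).
have -> : mcomm A B = \sum_(u | Q u) mcomm (F u.1) (G u.2).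
  rewrite F2 G2 mcomm_suml -(@pair_big_dep _ _ _ _ _ nonempty
     (fun S S' => nonempty S' && ~~ [disjoint S & S']) (fun S S' => mcomm (F S) (G S'))) /=.
  apply: eq_bigr => S nS; rewrite mcomm_sumr big_mkcondr /=.
  apply: eq_bigr => S' nS'; case: ifP => // /negbFE dSS.
  exact: supported_on_disjoint dSS (F1 S nS) (G1 S' nS').
apply: (decomposes_push (@size_weight_ge0 p) (pi := fun u => u.1 :|: u.2)).
- by rewrite !mulr_ge0 // exprn_ge0.
- move=> [S S'] /= /and3P[/= nS nS' _]; split.
    by case/set0Pn: nS => i iS; apply/set0Pn; exists i; rewrite inE iS.
  apply: supported_on_mcomm.
    by apply: supported_on_sub (F1 S nS); exact: finset.subsetUl.
  by apply: supported_on_sub (G1 S' nS'); exact: finset.subsetUr.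
move=> i.
pose t S S' := (i \in S)%:R * (#|S|%:R ^+ p * nrm (F S)) * (#|S'|%:R ^+ p * nrm (G S')).
pose t' S S' := (i \in S')%:R * (#|S'|%:R ^+ p * nrm (G S')) * (#|S|%:R ^+ p * nrm (F S)).
apply: (@le_trans _ _ (2 ^+ p * 2 * (\sum_(u | Q u) t u.1 u.2 + \sum_(u | Q u) t' u.1 u.2))).
  rewrite -big_split mulr_sumr; apply: ler_sum => -[S S'] /= /and3P[/= nS nS' _].
  have S1 : (0 < #|S|)%N by rewrite card_gt0.
  have S1' : (0 < #|S'|)%N by rewrite card_gt0.
  apply: (@le_trans _ _ (((i \in S)%:R + (i \in S')%:R) *
      (2 ^+ p * #|S|%:R ^+ p * #|S'|%:R ^+ p) * (2 * nrm (F S) * nrm (G S')))).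
    apply: ler_pM; rewrite ?size_weight_ge0 ?nrm_ge0 ?nrm_mcomm //.
    apply: ler_pM; rewrite ?exprn_ge0 //.
      by rewrite inE -natrD ler_nat; case: (i \in S); case: (i \in S').
    rewrite -!exprMn; apply: lerXn2r; rewrite ?nnegrE ?mulr_ge0 //.
    rewrite -!natrM ler_nat; apply: leq_trans (leq_card_setU _ _) _; nia.
  by rewrite /t /t' le_eqVlt; apply/orP; left; apply/eqP; ring.
have -> : 4 * 2 ^+ p * (a * b) = 2 ^+ p * 2 * (a * b + b * a) by ring.
rewrite ler_wpM2l ?mulr_ge0 ?exprn_ge0 //; apply: lerD.
  rewrite -(@pair_big_dep _ _ _ _ _ nonempty
     (fun S S' => nonempty S' && ~~ [disjoint S & S']) t) /=.
  by apply: sum_cross => // S; exact: nrm_ge0.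
rewrite -(@pair_big_dep _ _ _ _ _ nonempty
   (fun S S' => nonempty S' && ~~ [disjoint S & S']) t') /=.
rewrite (exchange_big_dep nonempty) /=; last by move=> S S' _ /andP[].
have := @sum_cross p i (fun S => nrm (G S)) (fun S => nrm (F S)) b a
  (fun S => nrm_ge0 _) (fun S => nrm_ge0 _) a0 G3 F3.
apply: le_trans; apply: ler_sum => S nS; rewrite le_eqVlt; apply/orP; left; apply/eqP.
by apply: eq_bigl => S'; rewrite nS disjoint_sym.
Qed.

Lemma poly_gauge_mcomm p A B :
  poly_gauge p (mcomm A B) <= 4 * 2 ^+ p * (poly_gauge p.+1 A * poly_gauge p.+1 B).
Proof.
have c0 : 0 <= 4 * 2 ^+ p :> R by rewrite mulr_ge0 // exprn_ge0.
have gA0 := gauge_ge0 (@size_weight_ge0 p.+1) nonempty_full A.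
rewrite mulrA; apply: (gauge_le_linear (@size_weight_ge0 p.+1) nonempty_full).
  exact: mulr_ge0.
move=> b Db; have b0 : 0 <= b by case: Db.
rewrite mulrAC; apply: (gauge_le_linear (@size_weight_ge0 p.+1) nonempty_full).
  exact: mulr_ge0.
move=> a Da; rewrite mulrAC -mulrA.
exact: (gauge_le (@size_weight_ge0 p) nonempty_full (decomposes_mcomm Da Db)).
Qed.

Lemma comm_scale_poly_gauge : comm_scale (fun p => 4 * 2 ^+ p) poly_gauge.
Proof. by split=> [p|p A B]; [exact: seminorm_poly_gauge|exact: poly_gauge_mcomm]. Qed.

End PolynomialGauge.

Lemma linear_le_pow2 r c : ((r * c).+1 <= c.+1 * 2 ^ r)%N.
Proof.
have : (r < 2 ^ r)%N by exact: ltn_expl.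
by move: (2 ^ r)%N => x; nia.
Qed.

(** * Norms with exponential weights on growing neighbourhoods *)

Section NeighborhoodGauge.
Variables (R : realType) (n : nat) (periodic : bool) (chi k : nat) (lam : R).
Hypotheses (n0 : (0 < n)%N) (k0 : (0 < k)%N) (lam1 : 1 <= lam).
Local Notation nrm := (@opnorm R (qdim n)).
Local Notation label := ({set 'I_n} * 'I_n.+1)%type.
Implicit Types (S X : {set 'I_n}) (M A B : qop R n).

Definition small_set : pred {set 'I_n} := fun X => (X != finset.set0) && (#|X| <= k)%N.

(** The radius stops at [n], where the neighbourhood is already the whole lattice. *)
Definition nb_label : pred label := fun l => small_set l.1.

Definition nb_supp (l : label) : {set 'I_n} := nbhd periodic chi l.1 l.2.

(** Sites of the origin [X] are counted, not those of its neighbourhood: spreading is paid for by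
    [lam] per step only. *)
Definition nb_weight (i : 'I_n) (l : label) : R := (i \in l.1)%:R * lam ^+ l.2.

Lemma lam_ge0 : 0 <= lam.
Proof. exact: le_trans lam1. Qed.

Lemma nb_weight_ge0 i l : 0 <= nb_weight i l.
Proof. by rewrite mulr_ge0 // exprn_ge0 // lam_ge0. Qed.

Lemma nb_full : exists2 l, nb_label l & nb_supp l = [set: 'I_n].
Proof.
exists ([set Ordinal n0]%SET, ord_max).
  by rewrite /nb_label /small_set /= cards1 k0 andbT; apply/set0Pn;
    exists (Ordinal n0); rewrite inE.
by apply: nbhd_full => //; apply/set0Pn; exists (Ordinal n0); rewrite inE.
Qed.

Definition nb_gauge : qop R n -> R := gauge nb_label nb_supp nb_weight.

Lemma sum_label (F : {set 'I_n} -> 'I_n.+1 -> R) :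
  \sum_(l | nb_label l) F l.1 l.2 = \sum_(r < n.+1) \sum_(X | small_set X) F X r.
Proof.
rewrite exchange_big pair_big /=; apply: eq_bigl => -[X r].
by rewrite /nb_label /= andbT.
Qed.

End NeighborhoodGauge.

(** * Exponential weights dominate polynomial ones *)

Section GaugeComparison.
Variables (R : realType) (n : nat) (periodic : bool) (chi k p : nat).
Hypotheses (n0 : (0 < n)%N) (k0 : (0 < k)%N).
Local Notation nrm := (@opnorm R (qdim n)).
Local Notation lam := (2 ^+ p.+2 : R).
Implicit Types (S X : {set 'I_n}) (M A B : qop R n).

(** Times [2 ^+ r], it bounds both the size of a neighbourhood of radius [r] and the number of sites
    within that radius of a given site. *)
Definition nb_growth : R := (4 * k * chi.+2)%:R.

Lemma sum_geom_le (m : nat) : \sum_(r < m) (2^-1 : R) ^+ r <= 2.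
Proof.
suff -> : \sum_(r < m) (2^-1 : R) ^+ r = 2 - 2 * 2^-1 ^+ m.
  by rewrite gerBl mulr_ge0 // exprn_ge0.
elim: m => [|m IH]; first by rewrite big_ord0 expr0; ring.
by rewrite big_ord_recr /= IH exprS; field.
Qed.

(** Of the [p + 2] factors [2 ^+ r] in [lam ^+ r], [p] pay for the size weight and one for the sites
    near [i]; the last makes the sum over [r] geometric, whence the factor 2. *)
Lemma decomposes_nb_poly a M :
  decomposes (nb_label k) (nb_supp periodic chi) (nb_weight lam) a M ->
  decomposes (@nonempty n) id (size_weight R p) (2 * nb_growth ^+ p.+1 * a) M.
Proof.
move=> [a0 [F [F1 -> F3]]].
pose D := nb_growth; have D0 : 0 <= D by [].
apply: (decomposes_push (@size_weight_ge0 R n p) (pi := nb_supp periodic chi)).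
- by rewrite !mulr_ge0 // exprn_ge0.
- move=> [X r] /[dup] hl /andP[/= /set0Pn[x xX] _]; split; last exact: F1.
  by apply/set0Pn; exists x; have /fintype.subsetP := sub_nbhd periodic chi X r; apply.
move=> i; pose m X r := nrm (F (X, r)).
have m0 X r : 0 <= m X r by exact: nrm_ge0.
pose near y (r : nat) := (lattice_dist periodic y i <= r * chi.+1)%N.
rewrite -[leLHS]/(\sum_(l | nb_label k l) size_weight R p i (nb_supp periodic chi l) * nrm (F l)).
have -> : \sum_(l | nb_label k l) size_weight R p i (nb_supp periodic chi l) * nrm (F l)
  = \sum_(r < n.+1) \sum_(X | small_set k X)
     size_weight R p i (nbhd periodic chi X r) * m X r.
  rewrite -(sum_label k (fun X r => size_weight R p i (nbhd periodic chi X r) * m X r)).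
  by apply: eq_bigr => -[].
have inner y (r : 'I_n.+1) : \sum_(X | small_set k X) (y \in X)%:R * m X r <= a / lam ^+ r.
  rewrite ler_pdivlMr ?exprn_gt0 //; apply: le_trans (F3 y).
  have -> : \sum_(l | nb_label k l) nb_weight lam y l * nrm (F l) =
     \sum_(l | nb_label k l) (y \in l.1)%:R * lam ^+ l.2 * m l.1 l.2.
    by apply: eq_bigr => -[].
  rewrite (sum_label k (fun X (r : 'I_n.+1) => (y \in X)%:R * lam ^+ r * m X r)).
  rewrite (bigD1 r) //=; apply: ler_wpDr.
    by do 2!apply: sumr_ge0 => ? _; rewrite !mulr_ge0 // !exprn_ge0.
  by rewrite mulr_suml; apply: ler_sum => X _; rewrite mulrAC.
have level (r : 'I_n.+1) : \sum_(X | small_set k X)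
     size_weight R p i (nbhd periodic chi X r) * m X r <= D ^+ p.+1 * a * 2^-1 ^+ r.
  (* A site [i] of the neighbourhood is near some [y] of [X]; the sum is moved to such [y], where
     the weight at the origin applies. *)
  apply: (@le_trans _ _ (\sum_(y | near y r) (D * 2 ^+ r) ^+ p * (a / lam ^+ r))).
    apply: (@le_trans _ _ (\sum_(y | near y r) (D * 2 ^+ r) ^+ p *
        \sum_(X | small_set k X) (y \in X)%:R * m X r)); last first.
      apply: ler_sum => y _; rewrite ler_wpM2l ?inner //.
      by rewrite exprn_ge0 // mulr_ge0 // exprn_ge0.
    under [leRHS]eq_bigr do rewrite mulr_sumr.
    rewrite exchange_big /=; apply: ler_sum => X /andP[nX Xk].
    have T0 y : 0 <= (D * 2 ^+ r) ^+ p * ((y \in X)%:R * m X r).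
      by rewrite !mulr_ge0 // exprn_ge0 // mulr_ge0 // exprn_ge0.
    rewrite /size_weight; case: nbhdP => [[y yX yi]|_]; last first.
      by rewrite !mul0r; apply: sumr_ge0.
    rewrite (bigD1 y) //= yX !mul1r; apply: ler_wpDr; first exact: sumr_ge0.
    rewrite ler_wpM2r // lerXn2r ?nnegrE // ?mulr_ge0 ?exprn_ge0 //.
    rewrite /D /nb_growth -natrX -natrM ler_nat.
    apply: leq_trans (card_nbhd _ _ _ _) _.
    have := linear_le_pow2 r chi.+1; move: (2 ^ r)%N => x; nia.
  rewrite sumr_const -[leLHS]mulr_natr.
  have cardle : #|[pred y | near y r]|%:R <= D * 2 ^+ r.
    rewrite /D /nb_growth -natrX -natrM ler_nat.
    have := card_annulus periodic i 0 (r * chi.+1).+1; rewrite subn0.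
    move=> H; apply: leq_trans (_ : 4 * (r * chi.+1).+1 <= _)%N.
      apply: leq_trans H; apply: subset_leq_card; apply/fintype.subsetP => y.
      by rewrite !inE /near lattice_dist_sym.
    have := linear_le_pow2 r chi.+1; move: (2 ^ r)%N => x; nia.
  have T0 : 0 <= (D * 2 ^+ r) ^+ p * (a / lam ^+ r).
    by rewrite mulr_ge0 ?divr_ge0 ?exprn_ge0 // mulr_ge0 // exprn_ge0.
  apply: le_trans (ler_wpM2l T0 cardle) _.
  have -> : lam ^+ r = (2 ^+ r) ^+ p * (2 ^+ r) * 2 ^+ r :> R.
    by rewrite -!exprM -!exprD; congr (_ ^+ _); lia.
  rewrite exprMn exprS exprVn.
  have : 2 ^+ r != 0 :> R by rewrite expf_neq0.
  move: (2 ^+ r : R) => x x0; rewrite le_eqVlt; apply/orP; left; apply/eqP.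
  have xp : x ^+ p != 0 by rewrite expf_neq0.
  by move: (x ^+ p) xp (D ^+ p) => y y0 z; field; rewrite x0 y0.
apply: le_trans (ler_sum _ (fun r _ => level r)) _.
rewrite -mulr_sumr -[leRHS]mulrA mulrC; rewrite ler_wpM2r ?sum_geom_le //.
by rewrite mulr_ge0 // exprn_ge0.
Qed.

Lemma poly_gauge_le_nb M : poly_gauge p M <=
  2 * nb_growth ^+ p.+1 * nb_gauge periodic chi k lam M.
Proof.
have lam1 : 1 <= lam by rewrite exprn_ege1 // ler1n.
apply: (gauge_le_linear (nb_weight_ge0 lam1) (nb_full periodic chi n0 k0)).
  by rewrite mulr_ge0 // exprn_ge0.
move=> a Da.
exact: (gauge_le (@size_weight_ge0 R n p) (nonempty_full n0) (decomposes_nb_poly Da)).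
Qed.

End GaugeComparison.

(** * Lieb-Robinson bound *)

Section SkewStep.
Variables (R : realType) (N : nat).
Local Notation nrm := (@opnorm R N).

(* [M + h[K,M] = (1 + hK) M (1 - hK) + h^2 KMK], and [1 + hK] is unitary up to
   [O(h^2)]. *)
Lemma nrm_skew_step (K M : 'M[Cx R]_N) (h b : R) : skew K -> 0 <= h <= 1 ->
  nrm K <= b ->
  nrm (M + real_Cx h *: mcomm K M) <= (1 + (3 * b ^+ 2 + b ^+ 4) * h ^+ 2) * nrm M.
Proof.
move=> sK /andP[h0 h1] Kb; have b0 : 0 <= b by apply: le_trans Kb; exact: nrm_ge0.
have -> : M + real_Cx h *: mcomm K M =
   (1%:M + real_Cx h *: K) *m M *m (1%:M + real_Cx (- h) *: K)
   + real_Cx (h ^+ 2) *: (K *m M *m K).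
  rewrite real_CxN scaleNr !mulmxDl !mulmxDr !mul1mx !mulmx1 !mulmxN -!scalemxAl -!scalemxAr.
  rewrite scalerA -real_CxM -expr2 /mcomm.
  move: (real_Cx h) (real_Cx (h ^+ 2)) (K *m M) (M *m K) (K *m M *m K) => *.
  by mx_ring.
have g (x : R) : x ^+ 2 = h ^+ 2 -> nrm (1%:M + real_Cx x *: K) <= 1 + h ^+ 2 * b ^+ 2.
  move=> xh; apply: le_trans (nrm_1_skew x sK) _; rewrite xh lerD2l ler_wpM2l ?sqr_ge0 //.
  by apply: lerXn2r; rewrite ?nnegrE ?nrm_ge0.
apply: le_trans (nrm_triangle _ _) _.
apply: (@le_trans _ _ ((1 + h ^+ 2 * b ^+ 2) * nrm M * (1 + h ^+ 2 * b ^+ 2) +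
    h ^+ 2 * (b * nrm M * b))).
  apply: lerD.
    apply: le_trans (nrmM _ _) (ler_pM _ _ _ _); rewrite ?nrm_ge0 ?g ?sqrrN //.
    by apply: le_trans (nrmM _ _) (ler_pM _ _ _ _); rewrite ?nrm_ge0 ?g.
  rewrite nrmZr ger0_norm ?sqr_ge0 // ler_wpM2l ?sqr_ge0 //.
  apply: le_trans (nrmM _ _) (ler_pM _ _ _ _); rewrite ?nrm_ge0 //.
  by apply: le_trans (nrmM _ _) (ler_pM _ _ _ _); rewrite ?nrm_ge0.
have h4 : h ^+ 4 <= h ^+ 2 by apply: ler_wiXn2l; rewrite ?h0.
have -> : (1 + h ^+ 2 * b ^+ 2) * nrm M * (1 + h ^+ 2 * b ^+ 2) +
    h ^+ 2 * (b * nrm M * b) = (1 + 3 * b ^+ 2 * h ^+ 2 + b ^+ 4 * h ^+ 4) * nrm M by ring.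
rewrite ler_wpM2r ?nrm_ge0 //.
by have := ler_wpM2l (exprn_ge0 4 b0) h4; lra.
Qed.

End SkewStep.

Section LiebRobinson.
Variables (R : realType) (n : nat) (periodic : bool) (chi k : nat) (lam : R).
Hypotheses (n0 : (0 < n)%N) (k0 : (0 < k)%N) (lam1 : 1 <= lam).
Variables (K : 'I_n -> qop R n) (S : 'I_n -> {set 'I_n}).
Hypotheses (KS : forall j, supported_on (S j) (K j)) (Kskew : forall j, skew (K j)).
Hypotheses (K1 : forall j, opnorm (K j) <= 1) (jS : forall j, j \in S j).
Hypothesis diam :
  forall i, {in S i &, forall j l, (lattice_dist periodic j l <= chi)%N}.
Local Notation nrm := (@opnorm R (qdim n)).
Local Notation label := ({set 'I_n} * 'I_n.+1)%type.
Local Notation supp := (@nb_supp n periodic chi).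
Local Notation dec := (decomposes (nb_label k) supp (@nb_weight R n lam)).
Local Notation gaug := (@nb_gauge R n periodic chi k lam).
Local Notation A := (\sum_j K j).
Implicit Types (M B : qop R n) (l : label).

Definition inner_part l : qop R n := \sum_(j | S j \subset supp l) K j.

Definition boundary_part l : qop R n :=
  \sum_(j | ~~ [disjoint S j & supp l] && ~~ (S j \subset supp l)) K j.

Lemma mcomm_split l M : supported_on (supp l) M ->
  mcomm A M = mcomm (inner_part l) M + mcomm (boundary_part l) M.
Proof.
move=> sM; rewrite (bigID (fun j => S j \subset supp l)) /= mcommDl.
rewrite -/(inner_part l); apply: (congr1 (fun X => mcomm (inner_part l) M + X)).
rewrite /boundary_part.
rewrite !mcomm_suml big_mkcond [RHS]big_mkcond; apply: eq_bigr => j _.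
case: (boolP (S j \subset supp l)) => //= _; rewrite ?andbT ?andbF //.
by case: (boolP [disjoint S j & supp l]) => // d; exact: supported_on_disjoint d (KS j) sM.
Qed.

Lemma nrm_sum_card (P : pred 'I_n) : nrm (\sum_(j | P j) K j) <= #|[set j | P j]|%:R.
Proof.
apply: le_trans (nrm_sum _ _ _) _; apply: le_trans (ler_sum _ (fun j _ => K1 j)) _.
by rewrite sumr_const cardsE.
Qed.

(** The product of 2 for the commutator, [8 k chi] for the boundary terms and [lam] for moving to
    the next radius. *)
Definition lr_rate : R := 16 * k%:R * chi%:R * lam.

Lemma lr_rate_ge0 : 0 <= lr_rate.
Proof. by rewrite !mulr_ge0 // (lam_ge0 lam1). Qed.

(** The cap is harmless: radius [n] already supports every operator. *)
Definition next_label l : label := (l.1, inord (minn l.2.+1 n)).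

(** Commuting with an anti-Hermitian operator on the same support is isometric to first order, so
    labels stay put. The crude bound [n] on the inner part enters only with [h ^+ 2]. *)
Lemma decomposes_inner a M h : 0 <= h <= 1 -> dec a M ->
  exists2 F : label -> qop R n, dec ((1 + (3 * n%:R ^+ 2 + n%:R ^+ 4) * h ^+ 2) * a)
    (\sum_(l | nb_label k l) (F l + real_Cx h *: mcomm (inner_part l) (F l))) &
  [/\ forall l, nb_label k l -> supported_on (supp l) (F l),
      M = \sum_(l | nb_label k l) F l &
      forall j, \sum_(l | nb_label k l) nb_weight lam j l * nrm (F l) <= a].
Proof.
move=> h01 [a0 [F [F1 F2 F3]]]; exists F => //.
have c0 : 0 <= 1 + (3 * n%:R ^+ 2 + n%:R ^+ 4) * h ^+ 2 :> R.
  by rewrite addr_ge0 // mulr_ge0 ?sqr_ge0 // addr_ge0 ?mulr_ge0 ?exprn_ge0.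
apply: (decomposes_push (nb_weight_ge0 lam1) (pi := id)).
- exact: mulr_ge0.
- move=> l hl; split=> //; apply: supported_onD; first exact: F1.
  apply/supported_onZ/supported_on_mcomm; last exact: F1.
  by apply: supported_on_sum => j Sj; exact: supported_on_sub (KS j).
move=> j; apply: le_trans (ler_wpM2l c0 (F3 j)); rewrite mulr_sumr.
apply: ler_sum => l hl; rewrite mulrCA ler_wpM2l ?nb_weight_ge0 //.
apply: nrm_skew_step => //; first by apply: skew_sum.
apply: le_trans (nrm_sum_card _) _; rewrite ler_nat.
by apply: leq_trans (max_card _) _; rewrite card_ord.
Qed.

Lemma decomposes_boundary a h (F : label -> qop R n) : 0 <= a -> 0 <= h ->
  (forall l, nb_label k l -> supported_on (supp l) (F l)) ->
  (forall j, \sum_(l | nb_label k l) nb_weight lam j l * nrm (F l) <= a) ->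
  dec (lr_rate * h * a)
    (\sum_(l | nb_label k l) real_Cx h *: mcomm (boundary_part l) (F l)).
Proof.
move=> a0 h0 F1 F3.
have c0 : 0 <= lr_rate * h by rewrite mulr_ge0 // lr_rate_ge0.
have lam0 := lam_ge0 lam1.
have vE l : nat_of_ord (next_label l).2 = minn l.2.+1 n.
  by rewrite /next_label /= inordK // ltnS geq_minr.
apply: (decomposes_push (nb_weight_ge0 lam1) (pi := next_label)).
- exact: mulr_ge0.
- move=> l hl; split=> //; apply: supported_onZ.
  have [ln|nl] := ltnP l.2 n; last first.
    rewrite (_ : supp _ = [set: 'I_n]); first exact: supported_onT.
    apply: nbhd_full; first by case/andP: hl.
    by rewrite vE leq_min leqnn andbT leqW.
  rewrite /nb_supp vE (minn_idPl ln); apply: supported_on_mcomm.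
    apply: supported_on_sum => j /andP[touch _].
    apply: supported_on_sub (KS j).
    by apply: nbhd_grow; [exact: diam|exact: touch].
  by apply: supported_on_sub (F1 l hl); exact: nbhdS.
move=> j; apply: le_trans (ler_wpM2l c0 (F3 j)); rewrite mulr_sumr.
apply: ler_sum => l /andP[_ Xk].
have wE : nb_weight lam j (next_label l) <= lam * nb_weight lam j l.
  rewrite /nb_weight vE mulrCA -exprS ler_wpM2l //.
  by apply: ler_weXn2l => //; exact: geq_minl.
have bE : nrm (boundary_part l) <= 8 * k%:R * chi%:R.
  apply: le_trans (nrm_sum_card _) _; rewrite -!natrM ler_nat.
  apply: leq_trans (card_boundary l.1 l.2 jS diam) _.
  by move: (#|l.1|) Xk => x; nia.
have fE : nrm (real_Cx h *: mcomm (boundary_part l) (F l)) <=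
    h * (2 * (8 * k%:R * chi%:R) * nrm (F l)).
  rewrite nrmZr ger0_norm // ler_wpM2l //; apply: le_trans (nrm_mcomm _ _) _.
  by rewrite ler_wpM2r ?nrm_ge0 // ler_wpM2l.
apply: le_trans (ler_pM _ _ wE fE) _; rewrite ?nrm_ge0 ?nb_weight_ge0 //.
by rewrite le_eqVlt; apply/orP; left; apply/eqP; rewrite /lr_rate; ring.
Qed.

Lemma nb_gauge_step M h : 0 <= h <= 1 ->
  gaug (M + real_Cx h *: mcomm A M) <=
    (1 + lr_rate * h + (3 * n%:R ^+ 2 + n%:R ^+ 4) * h ^+ 2) * gaug M.
Proof.
move=> h01; have /andP[h0 h1] := h01.
apply: (gauge_le_linear (nb_weight_ge0 lam1) (nb_full periodic chi n0 k0)).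
  apply: addr_ge0; last by rewrite mulr_ge0 ?sqr_ge0 // addr_ge0 ?mulr_ge0 ?exprn_ge0.
  by rewrite addr_ge0 // mulr_ge0 // lr_rate_ge0.
move=> a Da; have a0 : 0 <= a by case: Da.
have [F D1 [F1 F2 F3]] := decomposes_inner h01 Da.
have D2 := decomposes_boundary a0 h0 F1 F3.
have := decomposesD (nb_weight_ge0 lam1) D1 D2.
have -> : \sum_(l | nb_label k l) (F l + real_Cx h *: mcomm (inner_part l) (F l)) +
   \sum_(l | nb_label k l) real_Cx h *: mcomm (boundary_part l) (F l) =
   M + real_Cx h *: mcomm A M.
  rewrite -big_split F2 mcomm_sumr scaler_sumr -big_split /=.
  by apply: eq_bigr => l hl; rewrite -addrA -scalerDr -(mcomm_split (F1 l hl)).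
move/(gauge_le (nb_weight_ge0 lam1) (nb_full periodic chi n0 k0))/le_trans; apply.
by rewrite le_eqVlt; apply/orP; left; apply/eqP; ring.
Qed.

Definition heisenberg B (s : R) : qop R n :=
  expm (real_Cx s *: A) *m B *m expm (real_Cx s *: - A).

Lemma mderiv_heisenberg B s :
  mderiv (heisenberg B) s (mcomm A (heisenberg B s)).
Proof.
have := mderivM (mderivMr B (mderiv_expm A s)) (mderiv_expm (- A) s).
congr mderiv; rewrite (expm_comm_scale (- A)) /mcomm /heisenberg.
by rewrite !mulmxN !mulmxA.
Qed.

Lemma lieb_robinson B t : 0 <= t ->
  gaug (heisenberg B t) <= gaug B * expR ((lr_rate + 1) * t).
Proof.
move=> t0; have sg : seminorm gaug.
  exact: (seminorm_gauge (nb_weight_ge0 lam1) (nb_full periodic chi n0 k0)).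
have H0 : heisenberg B 0 = B.
  by rewrite /heisenberg real_Cx0 !scale0r expm0 mul1mx mulmx1.
have := @dini_gronwall R (fun s => gaug (heisenberg B s)) lr_rate t t0 lr_rate_ge0.
rewrite H0; apply.
- have := @mderiv_lsc R (qdim n) gaug (heisenberg B) _ t 0 sg
     (fun s _ => mderiv_heisenberg B s).
  by under eq_fun do rewrite subr0.
- exact: seminorm_ge0.
move=> c _ e e0; have [gD _ [L L0 gL]] := sg.
have e1 : 0 < e / 2 / (L + 1) by rewrite !divr_gt0 // ltr_wpDl.
have [d d0 Hd] := mderiv_heisenberg B c e1.
(* The coefficient of [h^2] depends on [n], but it only restricts the step length and not the
   exponential rate. *)
pose Q : R := (3 * n%:R ^+ 2 + n%:R ^+ 4) * gaug (heisenberg B c).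
have Q0 : 0 <= Q.
  by rewrite mulr_ge0 ?(seminorm_ge0 _ sg) // addr_ge0 ?mulr_ge0 ?exprn_ge0.
have Q1 : 0 < Q + 1 by rewrite ltr_wpDl.
exists (Num.min 1 (Num.min d (e / 2 / (Q + 1)))); first by rewrite !lt_min ltr01 d0 !divr_gt0.
move=> h /andP[h0]; rewrite !lt_min => /and3P[h1 hd hQ].
have := Hd h; rewrite gtr0_norm // => /(_ hd) H.
have h01 : 0 <= h <= 1 by rewrite !ltW.
have -> : heisenberg B (c + h) = (heisenberg B c + real_Cx h *: mcomm A (heisenberg B c))
   + (heisenberg B (c + h) - heisenberg B c - real_Cx h *: mcomm A (heisenberg B c)).
  by move: (heisenberg B (c + h)) (heisenberg B c) (_ *: _) => x y z; mx_ring.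
apply: le_trans (gD _ _) _.
apply: (@le_trans _ _ ((1 + lr_rate * h + (3 * n%:R ^+ 2 + n%:R ^+ 4) * h ^+ 2)
    * gaug (heisenberg B c) + h * (e / 2))).
  apply: lerD; first exact: nb_gauge_step.
  apply: le_trans (gL _) _; apply: le_trans (ler_wpM2l L0 H) _.
  rewrite (mulrC h (e / 2)) [leLHS]mulrA ler_wpM2r ?(ltW h0) // mulrCA.
  rewrite ler_piMr ?divr_ge0 ?(ltW e0) //.
  by rewrite ler_pdivrMr ?mul1r ?ltr_wpDl // lerDl.
rewrite ltr_pdivlMr // in hQ.
have -> : (1 + lr_rate * h + (3 * n%:R ^+ 2 + n%:R ^+ 4) * h ^+ 2) * gaug (heisenberg B c) =
    (1 + lr_rate * h) * gaug (heisenberg B c) + h * (h * Q) by rewrite /Q; ring.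
rewrite -addrA lerD2l -mulrDr ler_wpM2l ?(ltW h0) //.
by move: hQ; rewrite mulrDr mulr1; move: (h * Q) => y; lra.
Qed.


End LiebRobinson.

(** * The interaction picture *)

Section InteractionPicture.
Variables (R : realType) (n : nat).
Implicit Types (A B : qop R n).

Lemma skew_iherm A : adjm A = A -> skew ('i *: A).
Proof. by move=> hA; rewrite /skew adjmZ conjCi hA scaleNr. Qed.

Lemma interaction_pictureE alpha A B s : interaction_picture alpha A B s =
  (- 'i * real_Cx alpha) *:
    (expm (real_Cx s *: ('i *: A)) *m B *m expm (real_Cx s *: - ('i *: A))).
Proof.
have -> : real_Cx s *: ('i *: A) = ('i * real_Cx s) *: A.
  by rewrite scalerA [real_Cx s * _]mulrC.
have -> : real_Cx s *: - ('i *: A) = (- 'i * real_Cx s) *: A.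
  by rewrite -scaleNr scalerA [real_Cx s * _]mulrC.
by rewrite !expmE.
Qed.

Lemma skew_interaction_picture alpha A B s : adjm A = A -> adjm B = B ->
  skew (interaction_picture alpha A B s).
Proof.
move=> hA hB; have ca : (- 'i * real_Cx alpha)^* = - (- 'i * real_Cx alpha) :> Cx R.
  by apply: Cx_eq; rewrite ?Re_conj ?Im_conj /=; ring.
rewrite interaction_pictureE /skew adjmZ ca scaleNr; congr (- (_ *: _)).
rewrite !adjmM !expm_adj !adjmZ !conj_real adjmN adjmZ conjCi hA hB.
by rewrite !scaleNr !opprK mulmxA.
Qed.

Lemma interaction_degree_ge0 (B_ : {set 'I_n} -> qop R n) : 0 <= interaction_degree B_.
Proof. exact: bigmax_ge_id. Qed.

Lemma sum_le_interaction_degree (B_ : {set 'I_n} -> qop R n) i :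
  \sum_(X : {set 'I_n} | i \in X) opnorm (B_ X) <= interaction_degree B_.
Proof.
under eq_bigr do rewrite opnormE.
exact: (le_bigmax _ (fun i => \sum_(X : {set 'I_n} | i \in X) spectral_norm (B_ X))).
Qed.

Lemma local_sum_small k (B_ : {set 'I_n} -> qop R n) : local_terms k B_ ->
  local_sum B_ = \sum_(X | small_set k X) B_ X.
Proof.
move=> H; rewrite /local_sum big_mkcond [RHS]big_mkcond; apply: eq_bigr => X _.
rewrite /small_set; case: (boolP (X != finset.set0)) => //= nX.
by case: leqP => // kX; have [_ ->] := H X nX.
Qed.

(** All terms get radius 0, where [lam] does not count and the weighted sum is dominated by the
    interaction degree. *)
Lemma nb_gauge_local_sum periodic chi k (lam : R) (B_ : {set 'I_n} -> qop R n) :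
  (0 < n)%N -> (0 < k)%N -> 1 <= lam -> local_terms k B_ ->
  nb_gauge periodic chi k lam (local_sum B_) <= interaction_degree B_.
Proof.
move=> n0 k0 lam1 H; rewrite (local_sum_small H).
apply: (gauge_le (nb_weight_ge0 lam1) (nb_full periodic chi n0 k0)).
apply: (decomposes_push (nb_weight_ge0 lam1) (pi := fun X => (X, ord0))).
- exact: interaction_degree_ge0.
- move=> X sX; split=> //; case/andP: sX => nX _.
  by apply: supported_on_sub (H X nX).1; exact: sub_nbhd.
move=> j; apply: le_trans (sum_le_interaction_degree B_ j).
rewrite [leRHS]big_mkcond [leLHS]big_mkcond; apply: ler_sum => X _.
rewrite /nb_weight /= expr0 mulr1.
case: ifP => _; first by case: ifP => _; rewrite ?mul1r ?mul0r.
by case: ifP => // _; exact: nrm_ge0.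
Qed.

(* The terms need not be Hermitian, but their Hermitian parts still sum to [A]. *)
Lemma geometrically_local_skew periodic chi A :
  geometrically_local periodic chi A -> adjm A = A ->
  exists (K : 'I_n -> qop R n) (S : 'I_n -> {set 'I_n}),
    'i *: A = \sum_j K j /\
    forall j, [/\ supported_on (S j) (K j), skew (K j), opnorm (K j) <= 1, j \in S j &
      {in S j &, forall i l, (lattice_dist periodic i l <= chi)%N}].
Proof.
move=> [A_ [AE HA]] hA.
have [S HS] := choice (fun i => (HA i).2).
exists (fun j => real_Cx 2^-1 *: ('i *: A_ j - adjm ('i *: A_ j))), S; split.
  rewrite -scaler_sumr big_split /= sumrN -adjm_sum -scaler_sumr -AE.
  rewrite skew_iherm // opprK scalerDr -scalerDl -real_CxD.
  have -> : 2^-1 + 2^-1 = 1 :> R by field.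
  by rewrite real_Cx1 scale1r.
move=> j; have [jS diam sA] := HS j; split=> //.
- apply/supported_onZ/supported_onB; first exact: supported_onZ.
  by apply/supported_on_adj/supported_onZ.
- by apply: skewZ; rewrite /skew adjmB adjmK opprB.
rewrite nrmZr ger0_norm ?invr_ge0 // ler_pdivrMl // mulr1.
apply: le_trans (nrmB _ _) _; rewrite nrm_adj nrmZ cabs_i mul1r.
by have := (HA j).1; rewrite -opnormE; lra.
Qed.

End InteractionPicture.

(** * Locality of the interaction picture, uniformly on the time interval *)

Section InteractionBound.
Variables (R : realType) (k chi : nat) (T : R).
Hypothesis (k0 : (0 < k)%N).

Definition picture_const (p : nat) : R :=
  2 * nb_growth R chi k ^+ p.+1 * expR ((lr_rate chi k (2 ^+ p.+2) + 1) * T).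

Lemma picture_const_ge0 p : 0 <= picture_const p.
Proof. by rewrite mulr_ge0 ?expR_ge0 // mulr_ge0 // exprn_ge0. Qed.

Lemma poly_gauge_interaction n periodic (A : qop R n) (B_ : {set 'I_n} -> qop R n)
    (alpha s : R) p :
  (0 < n)%N -> adjm A = A -> geometrically_local periodic chi A ->
  local_terms k B_ -> 0 <= alpha -> 0 <= s <= T ->
  poly_gauge p (interaction_picture alpha A (local_sum B_) s) <=
    picture_const p * (alpha * interaction_degree B_).
Proof.
move=> n0 hA gA lB alpha0 /andP[s0 sT].
have [K [S [KE HK]]] := geometrically_local_skew gA hA.
pose lam : R := 2 ^+ p.+2; have lam1 : 1 <= lam by rewrite exprn_ege1 // ler1n.
rewrite interaction_pictureE KE -/(heisenberg K (local_sum B_) s).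
apply: le_trans (gaugeZ (@size_weight_ge0 R n p) (nonempty_full n0) _ _) _.
rewrite cabsM cabsN cabs_i mul1r cabs_real ger0_norm // mulrCA ler_wpM2l //.
apply: le_trans (poly_gauge_le_nb periodic chi p n0 k0 _) _.
rewrite /picture_const -[leRHS]mulrA ler_wpM2l ?mulr_ge0 ?exprn_ge0 //.
have := @lieb_robinson R n periodic chi k lam n0 k0 lam1 K S _ _ _ _ _ (local_sum B_) s s0.
move=> /(_ (fun j => let: And5 h _ _ _ _ := HK j in h)
  (fun j => let: And5 _ h _ _ _ := HK j in h)
  (fun j => let: And5 _ _ h _ _ := HK j in h)
  (fun j => let: And5 _ _ _ h _ := HK j in h)
  (fun j => let: And5 _ _ _ _ h := HK j in h)) /le_trans; apply.
have rate0 : 0 <= lr_rate chi k lam + 1 by rewrite addr_ge0 // lr_rate_ge0.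
rewrite mulrC; apply: ler_pM; rewrite ?expR_ge0 //.
- exact: (gauge_ge0 (nb_weight_ge0 lam1) (nb_full periodic chi n0 k0)).
- by rewrite ler_expR ler_wpM2l.
- exact: nb_gauge_local_sum.
Qed.

End InteractionBound.

(** A constant scale for the case [n = 0], where no nonempty set supports a decomposition. *)
Lemma comm_scale_opnorm (R : realType) N :
  comm_scale (fun p => 4 * 2 ^+ p) (fun _ => @opnorm R N).
Proof.
split=> [p|p A B]; first exact: seminorm_opnorm.
apply: le_trans (nrm_mcomm _ _) _; rewrite -mulrA ler_wpM2r ?mulr_ge0 ?nrm_ge0 //.
apply: (@le_trans _ _ (4 * 1)); first by rewrite mulr1 ler_nat.
by rewrite ler_wpM2l // exprn_ege1 // ler1n.
Qed.

Theorem theorem1 (R : realType) (q k chi : nat) (T : R) :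
  (1 <= q)%N -> (1 <= k)%N -> 0 < T ->
  exists C : R,
  forall (n : nat) (periodic : bool) (A : qop R n) (B_ : {set 'I_n} -> qop R n),
  A \is hermsymmx -> geometrically_local periodic chi A ->
  local_sum B_ \is hermsymmx -> local_terms k B_ ->
  forall (alpha t : R), 0 < alpha < 1 -> 0 <= t <= T ->
  forall (Y : R -> qop R n) (Omega : nat -> R -> qop R n),
  is_time_ordered_exp (interaction_picture alpha A (local_sum B_)) Y ->
  is_magnus (interaction_picture alpha A (local_sum B_)) Omega ->
  spectral_norm (Y t - mexp (\sum_(1 <= j < q.+1) Omega j t)) <=
    C * n%:R * (alpha * interaction_degree B_ * t) ^+ q.+1.
Proof.
move=> q1 k1 T0.
have c0 p : 0 <= 4 * 2 ^+ p :> R by rewrite mulr_ge0 // exprn_ge0.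
have [C HC] := magnus_error_global c0 (picture_const_ge0 k chi T) q1.
exists C => n periodic A B_ /hermsymmx_adjm hA gA /hermsymmx_adjm hB lB.
move=> alpha t /andP[alpha0 _] /andP[t0 tT] Y Omega HY mag.
have sG s : 0 <= s <= t -> skew (interaction_picture alpha A (local_sum B_) s).
  by move=> _; exact: skew_interaction_picture.
(* For [n = 0] the right-hand side is 0, so an exact equality is needed: the generator vanishes and
   [g = 0] is admissible. *)
rewrite -opnormE -expmE; case: (posnP n) => [n0|n0].
  have B0 : local_sum B_ = 0.
    rewrite /local_sum big_pred0 // => X; apply/negbTE; rewrite negbK.
    by apply/eqP/setP => i; have := ltn_ord i; rewrite [X in (_ < X)%N]n0.
  have G0 s : interaction_picture alpha A (local_sum B_) s = 0.
    by rewrite B0 /interaction_picture mulmx0 mul0mx scaler0.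
  have S : magnus_setting (fun p => 4 * 2 ^+ p) (picture_const k chi T)
      (fun _ => @opnorm R (qdim n)) (interaction_picture alpha A (local_sum B_)) Omega 0 t.
    split=> //; first exact: comm_scale_opnorm.
    by move=> p s _; rewrite G0 nrm0 mulr0.
  have := HC _ _ _ _ _ _ _ 1 S HY sG (lexx _) (fun X => _).
  rewrite mul0r expr0n /= mulr0 [X in C * X](_ : _ = 0) ?mulr0 ?mul0r; last by rewrite n0.
  by apply=> X; rewrite mul1r.
have S : magnus_setting (fun p => 4 * 2 ^+ p) (picture_const k chi T)
    (@poly_gauge R n) (interaction_picture alpha A (local_sum B_)) Omega
    (alpha * interaction_degree B_) t.
  split=> //; first exact: comm_scale_poly_gauge.
    by rewrite mulr_ge0 ?(ltW alpha0) // interaction_degree_ge0.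
  move=> p s /andP[s0 st].
  apply: (@poly_gauge_interaction _ _ _ _ _ _ periodic) => //; first exact: ltW.
  by rewrite s0 (le_trans st).
apply: (HC _ _ _ _ _ _ _ n%:R S HY sG); first by rewrite ler1n.
exact: poly_gauge_opnorm.
Qed.
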